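(* For every dimension $d\ge1$ there exists a constant $C>0$, depending only on $d$, such that for every function $u:\mathbb{R}^d\to\mathbb{R}$ with $u\ge0$ and $\int_{\mathbb{R}^d}u\,dx<\infty$, $$\|u\|_{\frac{3d+3}{3d+1}}\;\le\; C\,\|\nabla u\|_1^{\frac{2d}{3d+3}}\cdot\sup_{\nu>0}\ \inf_{v:\mathbb{R}^d\to\mathbb{R}}\left\{\nu^{\frac{2}{d+1}}W_2^2(u,v)+\nu^{-\frac{d-1}{d+1}}\big\||\nabla|^{-\frac12}v\big\|_2^2\right\}^{\frac13}.$$
   Context: All norms are over $\mathbb{R}^d$: $\|f\|_p=\left(\int_{\mathbb{R}^d}|f|^p\,dx\right)^{1/p}$, and $\|\nabla u\|_1=\int_{\mathbb{R}^d}|\nabla u|\,dx$, understood as the total variation of the distributional gradient when $u$ is merely of bounded variation. $W_2$ denotes the Wasserstein distance: for nonnegative densities $u,v$ with equal total mass, $$W_2^2(u,v):=\inf_\pi\iint|x-y|^2\,d\pi(x,y),$$ the infimum being over nonnegative measures $\pi$ on $\mathbb{R}^d\times\mathbb{R}^d$ whose projections on the first and second coordinates are the measures with densities $u$ and $v$, respectively. Thus only $v\ge0$ with $\int v=\int u$ are admissible in the infimum (otherwise $W_2^2(u,v)=+\infty$). $\||\nabla|^{-\frac12}v\|_2$ is the homogeneous fractional Sobolev norm of order $-\frac12$, $\||\nabla|^{-\frac12}v\|_2^2=\int_{\mathbb{R}^d}|k|^{-1}|\mathcal{F}v(k)|^2\,dk$ with $\mathcal{F}$ the Fourier transform (value $+\infty$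 if the integral diverges). The inequality is understood for $u$ such that the right-hand side quantities are finite. *)

(* Defs.v *)
From HB Require Import structures.
From mathcomp Require Import all_boot all_order all_algebra.
From mathcomp Require Import complex.
From mathcomp Require Import all_classical all_reals all_analysis.

Set Implicit Arguments.
Unset Strict Implicit.
Unset Printing Implicit Defensive.

Import Order.TTheory GRing.Theory Num.Theory.
Import numFieldNormedType.Exports.

Local Open Scope classical_set_scope.
Local Open Scope ring_scope.

(* The sigma-algebra generated by the coordinates. *)
Section measurable_rV.
Context {disp : measure_display} {T : measurableType disp}.
Variable n : nat.

Definition rV_coord (i : 'I_n) (x : 'rV[T]_n) : T := x ord0 i.

Let rV_set0 : g_sigma_preimage rV_coord set0.
Proof. exact: sigma_algebra0. Qed.

Let rV_setC A : g_sigma_preimage rV_coord A -> g_sigma_preimage rV_coord (~` A).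
Proof. exact: sigma_algebraC. Qed.

Let rV_bigcup (F : (set 'rV[T]_n)^nat) :
  (forall i, g_sigma_preimage rV_coord (F i)) ->
  g_sigma_preimage rV_coord (\bigcup_i (F i)).
Proof. exact: sigma_algebra_bigcup. Qed.

HB.instance Definition _ := @isMeasurable.Build (measure_tuple_display disp)
  ('rV[T]_n) (g_sigma_preimage rV_coord) rV_set0 rV_setC rV_bigcup.

Lemma measurable_rV_coord (i : 'I_n) :
  measurable_fun [set: 'rV[T]_n] (rV_coord i).
Proof.
move=> _ Y mY; rewrite setTI; apply: sub_sigma_algebra => /=.
rewrite -bigcup_seq/=; exists i => /=; first by rewrite mem_index_enum.
by exists Y => //; rewrite setTI.
Qed.

Lemma measurable_fun_rVP {d1} (T1 : measurableType d1) (f : T1 -> 'rV[T]_n) :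
  (forall i, measurable_fun [set: T1] (rV_coord i \o f)) ->
  measurable_fun [set: T1] f.
Proof.
move=> mf _ A mA.
have : preimage_set_system setT f (g_sigma_preimage rV_coord)
         (setT `&` f @^-1` A) by exists A.
rewrite -g_sigma_preimage_comp; apply: smallest_sub.
  exact: sigma_algebra_measurable.
move=> B; rewrite -bigcup_seq/= => -[i _ [C mC <-]].
exact: mf.
Qed.

End measurable_rV.

Section lebesgue_rV.
Context {R : realType}.

Definition rV_cons n (p : R * 'rV[R]_n) : 'rV[R]_n.+1 :=
  row_mx (const_mx p.1 : 'rV_1) p.2.

Lemma measurable_rV_cons n :
  measurable_fun [set: R * 'rV[R]_n] (@rV_cons n).
Proof.
apply: measurable_fun_rVP => i.
have [j ->|j ->] := split_ordP (i : 'I_(1 + n)).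
  apply: (eq_measurable_fun fst) => [p _|]; last exact: measurable_fst.
  transitivity ((const_mx p.1 : 'rV_1) ord0 j); first by rewrite mxE.
  exact/esym/(row_mxEl (const_mx p.1) p.2 ord0 j).
apply: (eq_measurable_fun (rV_coord j \o snd)) => [p _|].
  exact/esym/(row_mxEr (const_mx p.1) p.2 ord0 j).
apply: measurableT_comp; [exact: measurable_rV_coord|exact: measurable_snd].
Qed.

Let rV_uncons n (x : 'rV[R]_n.+1) : R * 'rV[R]_n :=
  (x ord0 ord0, @rsubmx _ 1 1 n x).

Let rV_consK n : cancel (@rV_cons n) (@rV_uncons n).
Proof.
move=> [a x]; congr pair; last exact: row_mxKr.
transitivity (row_mx (const_mx a : 'rV_1) x ord0 (lshift n ord0)).
  by congr (row_mx _ _ _ _); exact/val_inj.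
by rewrite row_mxEl mxE.
Qed.

Let measurable_rV_uncons n : measurable_fun [set: 'rV[R]_n.+1] (@rV_uncons n).
Proof.
apply/measurable_fun_pairP; split; first exact: measurable_rV_coord.
apply: measurable_fun_rVP => i.
apply: (eq_measurable_fun (rV_coord (rshift 1 i : 'I_n.+1))) => [x _|].
  by rewrite /= /rV_coord mxE.
exact: measurable_rV_coord.
Qed.

Section step.
Variables (n : nat) (m : {sigma_finite_measure set 'rV[R]_n -> \bar R}).

Definition lebesgue_rVS : set 'rV[R]_n.+1 -> \bar R :=
  pushforward ((@lebesgue_measure R) \x m)%E (@rV_cons n).

Let step0 : lebesgue_rVS set0 = 0%E.
Proof. by rewrite /lebesgue_rVS /pushforward preimage_set0 measure0. Qed.

Let step_ge0 A : (0 <= lebesgue_rVS A)%E.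
Proof. by rewrite /lebesgue_rVS /pushforward measure_ge0. Qed.

Let step_sigma_additive : semi_sigma_additive lebesgue_rVS.
Proof.
by apply: measure_semi_sigma_additive; exact: measurable_rV_cons.
Qed.

HB.instance Definition _ :=
  isMeasure.Build _ _ _ lebesgue_rVS step0 step_ge0 step_sigma_additive.

Let step_sigma_finite : sigma_finite setT lebesgue_rVS.
Proof.
have /sigma_finiteP[F [TF ndF Foo]] := sigma_finiteT (@lebesgue_measure R).
have /sigma_finiteP[G [TG ndG Goo]] := sigma_finiteT m.
exists (fun k => @rV_uncons n @^-1` (F k `*` G k)).
  rewrite -preimage_bigcup (_ : \bigcup_k (F k `*` G k) = setT)//.
  rewrite -setXTT TF TG predeqE => -[x y]; split=> [[k _ [/= Fx Gy]]|].
    by split; exists k.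
  move=> [/= [i _ Fx] [k _ Gy]]; exists (maxn i k) => //; split.
    by move: x Fx; exact/subsetPset/ndF/leq_maxl.
  by move: y Gy; exact/subsetPset/ndG/leq_maxr.
move=> k; have [mF Fk] := Foo k; have [mG Gk] := Goo k; split.
  rewrite -[X in measurable X]setTI; apply: measurable_rV_uncons => //.
  exact: measurableX.
rewrite /lebesgue_rVS /pushforward -comp_preimage.
rewrite (_ : @rV_uncons n \o @rV_cons n = id); last exact/funext/rV_consK.
by rewrite product_measure1E// lte_mul_pinfty// ge0_fin_numE.
Qed.

HB.instance Definition _ :=
  Measure_isSigmaFinite.Build _ _ _ lebesgue_rVS step_sigma_finite.

End step.

Fixpoint lebesgue_rV n : {sigma_finite_measure set 'rV[R]_n -> \bar R} :=
  if n is n'.+1 then lebesgue_rVS (lebesgue_rV n') else \d_(0 : 'rV[R]_0).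

Lemma lebesgue_rV_box n (B : 'I_n -> set R) :
  (forall i, measurable (B i)) ->
  lebesgue_rV n [set x | forall i, B i (x ord0 i)] =
  (\prod_(i < n) lebesgue_measure (B i))%E.
Proof.
elim: n B => [|n ih] B mB.
  rewrite big_ord0 /= diracE mem_set//=.
  by case.
rewrite big_ord_recl -(ih (fun i => B (lift ord0 i)))//.
pose C : set 'rV[R]_n := [set x | forall i, B (lift ord0 i) (x ord0 i)].
have mC : measurable C.
  rewrite (_ : C = \bigcap_(i in [set: 'I_n])
      (setT `&` rV_coord i @^-1` B (lift ord0 i))); last first.
    by apply/seteqP; split=> [x Cx i _|x Cx i]; [split|have [] := Cx i I].
  apply: fin_bigcap_measurable => // i _.
  exact: measurable_rV_coord.
suff E : @rV_cons n @^-1` [set x | forall i, B i (x ord0 i)] = B ord0 `*` C.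
  rewrite /= /lebesgue_rVS /pushforward E.
  by rewrite (@product_measure1E _ _ _ _ _ lebesgue_measure (lebesgue_rV n)
    _ _ (mB ord0) mC).
apply/seteqP; split=> [[a x] H|[a x] [Ba Cx] i].
  split=> [|i] /=.
    have := H ord0; congr (B _ _).
    transitivity (row_mx (const_mx a : 'rV_1) x ord0 (lshift n ord0)).
      by congr (row_mx _ _ _ _); exact/val_inj.
    by rewrite row_mxEl mxE.
  have := H (lift ord0 i); congr (B _ _).
  transitivity (row_mx (const_mx a : 'rV_1) x ord0 (rshift 1 i)).
    by congr (row_mx _ _ _ _); exact/val_inj.
  by rewrite row_mxEr.
have [j ->|j ->] := split_ordP (i : 'I_(1 + n)).
  rewrite (_ : lshift n j = ord0 :> 'I_n.+1); last first.
    by apply/val_inj; rewrite /= (ord1 j).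
  move: Ba; congr (B _ _); apply/esym.
  transitivity (row_mx (const_mx a : 'rV_1) x ord0 (lshift n ord0)).
    by congr (row_mx _ _ _ _); exact/val_inj.
  by rewrite row_mxEl mxE.
rewrite (_ : rshift 1 j = lift ord0 j :> 'I_n.+1); last exact/val_inj.
move: (Cx j); congr (B _ _); apply/esym.
transitivity (row_mx (const_mx a : 'rV_1) x ord0 (rshift 1 j)).
  by congr (row_mx _ _ _ _); exact/val_inj.
by rewrite row_mxEr.
Qed.

End lebesgue_rV.

Section norms.
Context {R : realType} {d : nat}.
Implicit Types (x k : 'rV[R]_d) (u v : 'rV[R]_d -> R).

Definition dotp x k : R := \sum_i x ord0 i * k ord0 i.

(* The library norm on 'rV[R]_d is the sup norm. *)
Definition enorm x : R := Num.sqrt (dotp x x).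

Definition partial (i : 'I_d) (f : 'rV[R]_d -> R) x : R :=
  'D_(delta_mx ord0 i) f x.

Definition is_C1 (f : 'rV[R]_d -> R) : Prop :=
  forall i, (forall x, derivable f x (delta_mx ord0 i)) /\
            continuous (partial i f).

Definition divergence (phi : 'rV[R]_d -> 'rV[R]_d) x : R :=
  \sum_i partial i (rV_coord i \o phi) x.

Definition test_field : set ('rV[R]_d -> 'rV[R]_d) :=
  [set phi : 'rV[R]_d -> 'rV[R]_d |
   [/\ forall i, is_C1 (rV_coord i \o phi),
       compact (closure [set x | phi x != 0]) &
       forall x, enorm (phi x) <= 1]].

(* |Du|(R^d), the total variation of the distributional gradient of u. It is
   the integral of |grad u| when u is weakly differentiable. *)
Definition gradient_variation u : \bar R :=
  ereal_sup [set (\int[lebesgue_rV d]_x (u x * divergence phi x)%:E)%E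
            | phi in test_field].

(* The measures on the product with marginal densities u and v. *)
Definition couplings u v
    : set {measure set ('rV[R]_d * 'rV[R]_d) -> \bar R} :=
  [set pi | forall A : set 'rV[R]_d, measurable A ->
     pi (A `*` setT) = (\int[lebesgue_rV d]_(x in A) (u x)%:E)%E /\
     pi (setT `*` A) = (\int[lebesgue_rV d]_(y in A) (v y)%:E)%E].

Definition wasserstein2_sq u v : \bar R :=
  ereal_inf [set (\int[pi]_z (enorm (z.1 - z.2) ^+ 2)%:E)%E
            | pi in couplings u v].

(* Only these v have finite Wasserstein distance from u. *)
Definition admissible u : set ('rV[R]_d -> R) :=
  [set v : 'rV[R]_d -> R |
   [/\ measurable_fun [set: 'rV[R]_d] v, forall x, 0 <= v x &
     (\int[lebesgue_rV d]_x (v x)%:E = \int[lebesgue_rV d]_x (u x)%:E)%E]].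

(* (2 pi)^(-d/2) * \int e^(-i k.x) v(x) dx, for integrable v. *)
Definition fourier v k : R[i] :=
  let c := (2 * pi) `^ (- (d%:R / 2)) in
  Complex (c * \int[lebesgue_rV d]_x (v x * cos (dotp k x)))
          (- (c * \int[lebesgue_rV d]_x (v x * sin (dotp k x)))).

(* 0^-1 = 0 at k = 0, a null set when 0 < d. *)
Definition hdot_mhalf_sq v : \bar R :=
  (\int[lebesgue_rV d]_k ((enorm k)^-1 * Normc.normc (fourier v k) ^+ 2)%:E)%E.

Definition sup_inf u : \bar R :=
  ereal_sup [set
    ereal_inf [set
      (((nu `^ (2 / (d + 1)%:R))%:E * wasserstein2_sq u v +
        (nu `^ (- ((d - 1)%:R / (d + 1)%:R)))%:E * hdot_mhalf_sq v) `^ (3^-1))%E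
    | v in admissible u]
  | nu in [set nu : R | 0 < nu]].

End norms.

(* Main.v *)
(* Slice the range of u at the heights mu_j = mu0 * 2^((3d+1)j) and compare, at
   height mu_j, with cubes of side ~ r_j = r0 * 4^-j.  A point of {u > mu_(j+1)}
   is bad if u <= mu_j on half of the cube around it: the bad points are paid for
   by the variation of u between the heights mu_j and mu_(j+1), and these
   variations add up to at most that of u.  Around a good point the cube carries
   mass at least m_j ~ mu_j r_j^d.  A transport plan from u to v either moves a
   good portion of the mass farther than l_j = r0 * 2^j, which costs l_j^2, or
   leaves in a cube of side ~ l_j a mass of v comparable to that of u, hence at
   least m_j, and then m_j times the mass is at most the interaction
   \iint v v 1_{|x-y| <~ l_j}.  As l_j grows geometrically, the transport terms
   sum to r0^-2 W_2^2; the interactions are nonnegative averages of |v^(k)|^2 over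
   the frequencies |k| <~ 1 / l_j and sum to the integral of |k|^-1 |v^(k)|^2.
   Letting mu0 = 2^(-(3d+1)n) and r0 = a 4^n, so that mu0 / r0 plays the role of nu
   and 4^j mu_j that of mu_j^p, and n -> oo, this bounds the integral of u^p by
   C (a |Du| + a^(-2d/(d+1)) S^3); the choice of a finishes the proof. *)

Require Import Defs.
From HB Require Import structures.
From mathcomp Require Import all_boot all_order all_algebra.
From mathcomp Require Import complex ring lra.
From mathcomp Require Import all_classical all_reals all_analysis measurable_realfun.

Set Implicit Arguments.
Unset Strict Implicit.
Unset Printing Implicit Defensive.

Import Order.TTheory GRing.Theory Num.Theory.
Import numFieldNormedType.Exports.

Local Open Scope classical_set_scope.
Local Open Scope ring_scope.

(** * Translation invariance and cubes *)

Section translation.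
Context {R : realType}.

(** The rates in the slicing are forced by three balances. The ratio [2 ^+ (3 * d + 1)] of the
    heights makes its p-th power gain exactly a factor 4, since p (3d+1) = 3d+3. The weight 4^j then
    cancels the decay of the cubes in the bad part, because 4^j r_j = r0. In the good part 4^j / m_j
    is a multiple of l_j^(1-d), that is, of l_j times the volume of the frequency cube of size 1 /
    l_j, and the extra l_j is what sums to |k|^-1. The bad part needs one slope per height, valid at
    the scale of that height, with slopes summing to at most d |Du|. In place of the coarea formula
    this uses that the L^1 modulus of translation is subadditive, so that its slopes at different
    scales can all be compared at one common small step. The variation is defined through C^1 fields
    only, hence the modulus is reached by duality with C^1 approximations of a sign. For a given n
    one v and one plan serve all heights, but they change with n; only the bound S^3 is common to
    all n, which is where the supremum over nu enters. *)

Lemma lebesgue_measure_translate (t : R) (A : set (measurableTypeR R)) : measurable A ->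
  lebesgue_measure [set x | A (x + t)] = lebesgue_measure A.
Proof.
have mt : measurable_fun [set: measurableTypeR R] (fun x : measurableTypeR R => x + t : measurableTypeR R).
  by apply: measurable_funD => //; exact: measurable_cst.
move=> mA; apply/esym.
pose m : {measure set (measurableTypeR R) -> \bar R} :=
  pushforward (@lebesgue_measure R) (fun x : measurableTypeR R => x + t : measurableTypeR R).
rewrite -[RHS]/(m mt A).
apply: (@lebesgue_measure_unique R (m mt)) => // X [[a b] /= _ <-].
rewrite /m /pushforward /=.
rewrite (_ : _ @^-1` _ = [set` `]a - t, b - t]]); last first.
  by apply/seteqP; split => x /=; rewrite !in_itv/= ltrBlDr lerBrDr.
rewrite !lebesgue_measure_itv/= !lte_fin ltrD2r.
by case: ifPn => // _; rewrite -!EFinB; congr EFin; lra.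
Qed.

Lemma ge0_integral_translate (t : R) (f : measurableTypeR R -> \bar R) :
  measurable_fun setT f -> (forall x, 0 <= f x)%E ->
  (\int[lebesgue_measure]_x f (x + t)%R = \int[lebesgue_measure]_x f x)%E.
Proof.
move=> mf f0.
pose phi (x : measurableTypeR R) : measurableTypeR R := x + t.
have mphi : measurable_fun setT phi.
  by apply: measurable_funD => //; exact: measurable_cst.
transitivity (\int[pushforward lebesgue_measure phi]_x f x)%E.
  by rewrite (ge0_integral_pushforward mphi).
by apply: eq_measure_integral => C mC _; exact: lebesgue_measure_translate.
Qed.

Lemma measurable_rV_add n (h : 'rV[R]_n) :
  measurable_fun [set: 'rV[R]_n] (fun x => x + h).
Proof.
apply: measurable_fun_rVP => i.
apply: (eq_measurable_fun (fun x : 'rV[R]_n => rV_coord i x + h ord0 i)) => [x _|].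
  by rewrite /rV_coord /= mxE.
by apply: measurable_funD; [exact: measurable_rV_coord|exact: measurable_cst].
Qed.

Lemma rV_consl n (p : R * 'rV[R]_n) (j : 'I_1) : rV_cons p ord0 (lshift n j) = p.1.
Proof. by rewrite [LHS](row_mxEl (const_mx p.1) p.2) mxE. Qed.

Lemma rV_consr n (p : R * 'rV[R]_n) (j : 'I_n) :
  rV_cons p ord0 (rshift 1 j) = p.2 ord0 j.
Proof. exact: (row_mxEr (const_mx p.1 : 'rV_1) p.2). Qed.

Lemma rV_consD n (p : R * 'rV[R]_n) (h : 'rV[R]_n.+1) :
  rV_cons p + h = rV_cons (p.1 + h ord0 ord0, p.2 + @rsubmx _ 1 1 n h).
Proof.
apply/rowP => i; rewrite mxE.
have [j ->|j ->] := split_ordP (i : 'I_(1 + n)).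
  by rewrite !rV_consl (_ : lshift n j = ord0)//; apply/val_inj; rewrite (ord1 j).
by rewrite !rV_consr !mxE.
Qed.

Lemma lebesgue_rV_translate n (h : 'rV[R]_n) (A : set 'rV[R]_n) : measurable A ->
  lebesgue_rV n [set x | A (x + h)] = lebesgue_rV n A.
Proof.
elim: n h A => [|n ih] h A mA.
  congr (lebesgue_rV 0 _); apply/seteqP; split => x /=;
  by rewrite (_ : x + h = x)//; apply/rowP => -[].
rewrite /= /lebesgue_rVS /pushforward /product_measure1.
pose B := @rV_cons R n @^-1` A.
have mB : measurable B.
  by rewrite -[B]setTI; exact: measurable_rV_cons.
pose h0 := h ord0 ord0; pose h' : 'rV[R]_n := @rsubmx _ 1 1 n h.
transitivity (\int[lebesgue_measure]_x lebesgue_rV n (xsection B ((x : R) + h0)%R))%E.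
  apply: eq_integral => t _ /=.
  rewrite -(ih h' (xsection B (t + h0))); last exact: measurable_xsection.
  congr (lebesgue_rV n _); apply/seteqP.
  by split => x /=; rewrite /xsection/= !inE /= rV_consD.
rewrite (@ge0_integral_translate h0 (fun x => lebesgue_rV n (xsection B x)))//.
exact: (measurable_fun_xsection (lebesgue_rV n) mB).
Qed.

End translation.
Section rV_measure.
Context {R : realType}.

Lemma ge0_integral_rV_translate n (h : 'rV[R]_n) (f : 'rV[R]_n -> \bar R) :
  measurable_fun setT f -> (forall x, 0 <= f x)%E ->
  (\int[lebesgue_rV n]_x f (x + h)%R = \int[lebesgue_rV n]_x f x)%E.
Proof.
move=> mf f0.
pose phi (x : 'rV[R]_n) := x + h.
have mphi : measurable_fun setT phi by exact: measurable_rV_add.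
transitivity (\int[pushforward (lebesgue_rV n) phi]_x f x)%E.
  by rewrite (ge0_integral_pushforward mphi).
by apply: eq_measure_integral => C mC _; exact: lebesgue_rV_translate.
Qed.

Lemma integrable_rV_translate n (h : 'rV[R]_n) (f : 'rV[R]_n -> \bar R) :
  (lebesgue_rV n).-integrable setT f ->
  (lebesgue_rV n).-integrable setT (fun x => f (x + h)).
Proof.
move=> /integrableP[mf foo]; apply/integrableP; split.
  by apply: (measurableT_comp mf); exact: measurable_rV_add.
rewrite (@ge0_integral_rV_translate n h (fun x => `|f x|%E))//.
exact: measurableT_comp.
Qed.

Lemma integral_rV_translate n (h : 'rV[R]_n) (f : 'rV[R]_n -> \bar R) :
  (lebesgue_rV n).-integrable setT f ->
  (\int[lebesgue_rV n]_x f (x + h)%R = \int[lebesgue_rV n]_x f x)%E.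
Proof.
move=> fi.
pose phi (x : 'rV[R]_n) := x + h.
have mphi : measurable_fun setT phi by exact: measurable_rV_add.
transitivity (\int[pushforward (lebesgue_rV n) phi]_x f x)%E.
  rewrite (integral_pushforward mphi)//; first exact: measurable_int fi.
  exact: integrable_rV_translate.
by apply: eq_measure_integral => C mC _; exact: lebesgue_rV_translate.
Qed.

(** Cubes rather than Euclidean balls, because their volume is an explicit power; boolean, so that
    [(close r x y)%:R] is directly a kernel under the integral. *)
Definition close n (r : R) (x y : 'rV[R]_n) :=
  [forall i, `|x ord0 i - y ord0 i| <= r].

Lemma closeP n (r : R) (x y : 'rV[R]_n) :
  reflect (forall i, `|x ord0 i - y ord0 i| <= r) (close r x y).
Proof. exact: forallP. Qed.

Lemma closeC n (r : R) (x y : 'rV[R]_n) : close r x y = close r y x.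
Proof. by apply/closeP/closeP => H i; rewrite distrC. Qed.

Lemma close_trans n (r s : R) (x y z : 'rV[R]_n) :
  close r x y -> close s y z -> close (r + s) x z.
Proof.
move=> /closeP H /closeP K; apply/closeP => i.
by rewrite (le_trans (ler_distD (y ord0 i) _ _))// lerD.
Qed.

Lemma close_le n (r s : R) (x y : 'rV[R]_n) : r <= s -> close r x y -> close s x y.
Proof. by move=> rs /closeP H; apply/closeP => i; rewrite (le_trans (H i)). Qed.

Lemma close_shift n (r : R) (x y : 'rV[R]_n) : close r (x + y) y = close r x 0.
Proof. by apply/closeP/closeP => H i; have := H i; rewrite !mxE addrK subr0. Qed.

Lemma measurable_close d (T : measurableType d) n (r : R) (f g : T -> 'rV[R]_n) :
  measurable_fun setT f -> measurable_fun setT g ->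
  measurable [set x | close r (f x) (g x)].
Proof.
move=> mf mg.
have -> : [set x | close r (f x) (g x)] =
  \bigcap_(i in [set: 'I_n]) [set x | `|f x ord0 i - g x ord0 i| <= r].
  by apply/seteqP; split => x /= => [/closeP H i _|H]; [exact: H|apply/closeP => i; exact: H].
apply: fin_bigcap_measurable => // i _.
have m1 : measurable_fun setT (fun x => `|f x ord0 i - g x ord0 i|).
  apply: measurableT_comp => //; apply: measurable_funB.
    exact: (measurableT_comp (measurable_rV_coord i) mf).
  exact: (measurableT_comp (measurable_rV_coord i) mg).
rewrite -[X in measurable X]setTI.
have := m1 measurableT _ (measurable_itv `]-oo, r]); rewrite preimage_itvNyc.
exact.
Qed.

Lemma lebesgue_rV_close n (r : R) (x : 'rV[R]_n) : 0 <= r ->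
  lebesgue_rV n [set y | close r y x] = ((2 * r) ^+ n)%:E.
Proof.
move=> r0.
have -> : [set y | close r y x] =
  [set y | forall i, [set` `[x ord0 i - r, x ord0 i + r]] (y ord0 i)].
  apply/seteqP; split => y /= => [/closeP H i|H].
    by have := H i; rewrite in_itv/= ler_distl.
  by apply/closeP => i; rewrite ler_distl; have := H i; rewrite in_itv.
rewrite (lebesgue_rV_box (fun i => measurable_itv _)).
rewrite (eq_bigr (fun=> (2 * r)%:E)) => [|i _].
  elim: n {x} => [|n ih]; first by rewrite big_ord0 expr0.
  by rewrite big_ord_recr/= ih -EFinM exprSr.
rewrite lebesgue_measure_itv/= lte_fin -EFinB ltrD2l; case: ifPn => [_|].
  by congr EFin; lra.
by rewrite -leNgt => r1; congr EFin; lra.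
Qed.

End rV_measure.

(** * Translates of a function of bounded variation *)

Section bump.
Context {R : realType}.

Definition pos2 (t : R) : R := Num.max t 0 ^+ 2.

(* A C^1 step from 0 on t <= 0 to 1 on t >= 1 whose derivative is piecewise linear,
   so that Taylor's formula holds with a quadratic remainder. *)
Definition sstep (t : R) : R := 2 * (pos2 t - 2 * pos2 (t - 2^-1) + pos2 (t - 1)).

Definition dsstep (t : R) : R :=
  4 * (Num.max t 0 - 2 * Num.max (t - 2^-1) 0 + Num.max (t - 1) 0).

Lemma maxr0P (t : R) : (0 <= t /\ Num.max t 0 = t) \/ (t <= 0 /\ Num.max t 0 = 0).
Proof.
have [t0|/ltW t0] := leP 0 t; [left|right]; split => //.
Qed.

Lemma pos2_taylor (t h : R) : `|pos2 (t + h) - pos2 t - h * (2 * Num.max t 0)| <= h ^+ 2.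
Proof.
rewrite /pos2 ler_norml.
have [[t0 ->]|[t0 ->]] := maxr0P t; have [[h0 ->]|[h0 ->]] := maxr0P (t + h);
  apply/andP; split; nra.
Qed.

(** The constant is 2 (1 + 2 + 1), from three applications of [pos2_taylor]. *)
Lemma sstep_taylor (t h : R) : `|sstep (t + h) - sstep t - h * dsstep t| <= 8 * h ^+ 2.
Proof.
have := pos2_taylor t h; have := pos2_taylor (t - 2^-1) h; have := pos2_taylor (t - 1) h.
rewrite /sstep /dsstep.
rewrite (_ : t - 1 + h = t + h - 1); last by rewrite addrAC.
rewrite (_ : t - 2^-1 + h = t + h - 2^-1); last by rewrite addrAC.
move: (pos2 _) (pos2 _) (pos2 _) (pos2 _) (pos2 _) (pos2 _) 
  (Num.max _ _) (Num.max _ _) (Num.max _ _) => a b c x y z u v w.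
by rewrite !ler_norml => /andP[? ?] /andP[? ?] /andP[? ?]; apply/andP; split; lra.
Qed.

Lemma sstep_ge1 (t : R) : 1 <= t -> sstep t = 1.
Proof.
move=> t1; rewrite /sstep /pos2.
have -> : Num.max t 0 = t by apply/max_idPl; lra.
have -> : Num.max (t - 2^-1) 0 = t - 2^-1 by apply/max_idPl; lra.
have -> : Num.max (t - 1) 0 = t - 1 by apply/max_idPl; lra.
by field.
Qed.

Lemma sstep_le0 (t : R) : t <= 0 -> sstep t = 0.
Proof.
move=> t0; rewrite /sstep /pos2.
have -> : Num.max t 0 = 0 by exact/max_idPr.
have -> : Num.max (t - 2^-1) 0 = 0 by apply/max_idPr; lra.
have -> : Num.max (t - 1) 0 = 0 by apply/max_idPr; lra.
lra.
Qed.

Lemma sstep_bounds (t : R) : 0 <= sstep t <= 1.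
Proof.
rewrite /sstep /pos2; apply/andP.
have [[h0 ->]|[h0 ->]] := maxr0P t; have [[h1 ->]|[h1 ->]] := maxr0P (t - 2^-1);
  have [[h2 ->]|[h2 ->]] := maxr0P (t - 1); split; nra.
Qed.

Lemma dsstep_le (t : R) : `|dsstep t| <= 2.
Proof.
rewrite ler_norml /dsstep; apply/andP.
have [[h0 ->]|[h0 ->]] := maxr0P t; have [[h1 ->]|[h1 ->]] := maxr0P (t - 2^-1);
  have [[h2 ->]|[h2 ->]] := maxr0P (t - 1); split; lra.
Qed.

Lemma continuous_max0 (c : R) : continuous (fun t : R => Num.max (t - c) 0).
Proof.
move=> t; apply: (@continuous_max _ R^o (fun t => t - c) (cst 0)); last exact: cvg_cst.
by apply: cvgB; [exact: cvg_id|exact: cvg_cst].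
Qed.

Lemma continuous_max00 : continuous (fun t : R => Num.max t 0).
Proof. by move=> t; apply: (@continuous_max _ R^o id (cst 0)); [exact: cvg_id|exact: cvg_cst]. Qed.

Lemma continuous_dsstep : continuous dsstep.
Proof.
move=> t; rewrite /dsstep.
apply: cvgM; first exact: cvg_cst.
apply: cvgD; last exact: continuous_max0.
apply: cvgB; first exact: continuous_max00.
apply: cvgM; first exact: cvg_cst.
exact: continuous_max0.
Qed.

Lemma continuous_sstep : continuous sstep.
Proof.
move=> t; rewrite /sstep /pos2.
apply: cvgM; first exact: cvg_cst.
apply: cvgD; last by apply: cvgM; exact: continuous_max0.
apply: cvgB; first by apply: cvgM; exact: continuous_max00.
apply: cvgM; first exact: cvg_cst.
by apply: cvgM; exact: continuous_max0.
Qed.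

End bump.

(** * Bounded C^1 test functions *)

Section tame.
Context {R : realType} {d : nat}.
Implicit Types phi : 'rV[R]_d -> R.

(** Bounds on [phi] and on its partial derivatives allow differentiation under the integral. Compact
    support is left out, so that constants, and with them [1 - phi], are included; multiplication by
    [cutoff] restores it. *)
Definition tame_with phi (D : 'I_d -> 'rV[R]_d -> R) :=
  [/\ forall i x, is_derive x (delta_mx ord0 i) phi (D i x),
      continuous phi, forall i, continuous (D i), measurable_fun setT phi &
      exists K : R, forall x, `|phi x| <= K /\ forall i, `|D i x| <= K].

Definition tame phi := exists D, tame_with phi D.

Lemma is_derive_taylor2 (f : 'rV[R]_d -> R) (x v : 'rV[R]_d) (l C : R) :
  (forall h : R, `|f (h *: v + x) - f x - h * l| <= C * h ^+ 2) ->
  is_derive x v f l.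
Proof.
move=> H.
have L : h^-1 *: ((f \o shift x) (h *: v) - f x) @[h --> 0^'] --> l.
  apply/cvgrPdist_le => e e0.
  have C0 : 0 <= C by have := H 1; rewrite expr1n mulr1; exact: le_trans.
  near=> h.
  have h0 : h != 0 by near: h; exact: nbhs_dnbhs_neq.
  (* [C] may be 0, hence the division by [C + 1]. *)
  have hC : `|h| <= e / (C + 1).
    near: h; apply: dnbhs0_le; rewrite divr_gt0//; lra.
  rewrite distrC /= /GRing.scale/=.
  rewrite (_ : h^-1 * _ - l = h^-1 * (f (h *: v + x) - f x - h * l)); last by field.
  rewrite normrM normfV ler_pdivrMl ?normr_gt0//.
  rewrite (le_trans (H h))// -(real_normK (num_real h)) expr2 mulrCA ler_wpM2l//.
  have : C * `|h| <= C * (e / (C + 1)) by exact: ler_wpM2l.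
  move=> /le_trans; apply.
  by rewrite mulrCA ger_pMr// ler_pdivrMr; lra.
apply: DeriveDef; first by apply/cvg_ex; exists l.
exact: (@cvg_lim _ (@norm_hausdorff R R^o) _ _ _ _ _ L).
Unshelve. all: by end_near. Qed.

Lemma tame_cst (c : R) : tame (fun=> c).
Proof.
exists (fun _ _ => 0); split => //.
- by move=> i x; exact: is_derive_cst.
- exact: cst_continuous.
- by move=> i; exact: cst_continuous.
- by exists `|c| => x; split => // i; rewrite normr0.
Qed.

Lemma tameB phi psi : tame phi -> tame psi -> tame (fun x => phi x - psi x).
Proof.
move=> [D [dD cphi cD mphi [K HK]]] [E [dE cpsi cE mpsi [M HM]]].
exists (fun i x => D i x - E i x); split.
- by move=> i x; exact: is_deriveB.
- by move=> x; exact: (cvgB (cphi x) (cpsi x)).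
- by move=> i x; exact: (cvgB (cD i x) (cE i x)).
- exact: (measurable_funB mphi mpsi).
- exists (K + M) => x; have [K1 K2] := HK x; have [M1 M2] := HM x.
  by split => [|i]; rewrite (le_trans (ler_normB _ _))// lerD.
Qed.

Lemma tameM phi psi : tame phi -> tame psi -> tame (fun x => phi x * psi x).
Proof.
move=> [D [dD cphi cD mphi [K HK]]] [E [dE cpsi cE mpsi [M HM]]].
exists (fun i x => phi x * E i x + psi x * D i x); split.
- by move=> i x; exact: is_deriveM.
- by move=> x; exact: (cvgM (cphi x) (cpsi x)).
- by move=> i x; exact: (cvgD (cvgM (cphi x) (cE i x)) (cvgM (cpsi x) (cD i x))).
- exact: (measurable_funM mphi mpsi).
- exists (K * M + M * K) => x; have [K1 K2] := HK x; have [M1 M2] := HM x.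
  have K0 : 0 <= K by exact: le_trans K1.
  have M0 : 0 <= M by exact: le_trans M1.
  split => [|i].
    by rewrite normrM (le_trans (ler_pM _ _ K1 M1))// lerDl mulr_ge0.
  by rewrite (le_trans (ler_normD _ _))// !normrM lerD// ler_pM.
Qed.

Lemma tame_sstep (k : 'I_d) (a b : R) : tame (fun x => sstep (a * x ord0 k + b)).
Proof.
have cc : continuous (fun x : 'rV[R]_d => a * x ord0 k + b).
  move=> x.
  exact: (cvgD (cvgM (cvg_cst a) (@coord_continuous _ 1 d ord0 k x)) (cvg_cst b)).
exists (fun i x => (i == k)%:R * a * dsstep (a * x ord0 k + b)); split.
- move=> i x; apply: (@is_derive_taylor2 _ _ _ _ (8 * a ^+ 2)) => h.
  rewrite !mxE eqxx /= (eq_sym k i).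
  have [_|_] := eqVneq i k; last first.
    by rewrite mulr0 add0r subrr !mul0r mulr0 subrr normr0 -mulrA -exprMn mulr_ge0 ?sqr_ge0.
  rewrite mulr1 mul1r mulrDr.
  have := sstep_taylor (a * x ord0 k + b) (a * h).
  rewrite (_ : a * x ord0 k + b + a * h = a * h + a * x ord0 k + b); last by ring.
  by rewrite exprMn !mulrA (mulrC a h).
- by move=> x; exact: (continuous_comp (cc x) (@continuous_sstep _ _)).
- move=> i x.
  apply: (cvgM (cvg_cst ((i == k)%:R * a)) (continuous_comp (cc x) (@continuous_dsstep _ _))).
- apply: (@measurableT_comp _ _ _ _ _ _ sstep _ (fun x : 'rV[R]_d => a * x ord0 k + b)).
    by apply: continuous_measurable_fun; exact: continuous_sstep.
  apply: measurable_funD => //; apply: measurable_funM => //.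
  exact: measurable_rV_coord.
- exists (1 + 2 * `|a|) => x; split => [|i].
    have /andP[s0 s1] := sstep_bounds (a * x ord0 k + b).
    by rewrite ger0_norm// (le_trans s1)// lerDl mulr_ge0.
  rewrite normrM normrM normr_nat.
  have [_|_] := eqVneq i k; last by rewrite !mul0r addr_ge0// mulr_ge0.
  rewrite mul1r (@le_trans _ _ (2 * `|a|))//; last by rewrite lerDr.
  by rewrite mulrC ler_wpM2r// dsstep_le.
Qed.

End tame.
Lemma EFin_Rintegral d0 (T : measurableType d0) (R : realType)
    (mu : {measure set T -> \bar R}) (D : set T) (f : T -> R) :
  measurable D -> mu.-integrable D (EFin \o f) ->
  (\int[mu]_(x in D) f x)%:E = (\int[mu]_(x in D) (f x)%:E)%E.
Proof. by move=> mD fi; rewrite /Rintegral fineK// integrable_fin_num. Qed.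

(** * The variation bounds integrals against translated test functions *)

Section bvdiff.
Context {R : realType} {d : nat}.
Implicit Types phi : 'rV[R]_d -> R.
Local Notation e_ k := (delta_mx ord0 k : 'rV[R]_d).
Local Notation L := (lebesgue_rV d).

Definition bounded_support phi := exists M : R, forall x, phi x != 0 -> close M x 0.

Lemma is_derive_line phi (x v : 'rV[R]_d) (t l : R) :
  is_derive (t *: v + x) v phi l -> is_derive t 1 (fun s : R => phi (s *: v + x)) l.
Proof.
move=> [dphi El].
have E : (fun h : R => h^-1 *: (((fun s : R => phi (s *: v + x)) \o shift t) (h *: 1) - phi (t *: v + x))) =
   (fun h : R => h^-1 *: ((phi \o shift (t *: v + x)) (h *: v) - phi (t *: v + x))).
  by apply/funext => h /=; rewrite scalerDl addrA [h *: 1]mulr1.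
apply: DeriveDef; first by rewrite /derivable E.
by rewrite /derive E.
Qed.

Lemma tame_translate phi D (h : 'rV[R]_d) : tame_with phi D ->
  tame_with (fun x => phi (h + x)) (fun i x => D i (h + x)).
Proof.
move=> [dD cphi cD mphi [K HK]]; split.
- move=> i x; have [dp ep] := dD i (h + x).
  have E : (fun s : R => s^-1 *: (((fun x => phi (h + x)) \o shift x) (s *: e_ i) - phi (h + x))) =
    (fun s : R => s^-1 *: ((phi \o shift (h + x)) (s *: e_ i) - phi (h + x))).
    by apply/funext => s /=; rewrite addrCA.
  by apply: DeriveDef; rewrite ?/derivable ?/derive E.
- move=> x; apply: (@continuous_comp _ _ _ (fun x => h + x) phi); last exact: cphi.
  exact: (cvgD (cvg_cst h) (@cvg_id _ (nbhs x))).
- move=> i x; apply: (@continuous_comp _ _ _ (fun x => h + x) (D i)); last exact: cD.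
  exact: (cvgD (cvg_cst h) (@cvg_id _ (nbhs x))).
- apply: (measurableT_comp mphi).
  rewrite (_ : +%R h = (fun x => x + h)); first exact: measurable_rV_add.
  by apply/funext => x; exact: addrC.
- by exists K => x; exact: HK.
Qed.

(** A partial derivative is the pointwise limit of difference quotients with steps 1/(n+1), each of
    them measurable. *)
Lemma tame_measurableD phi D k : tame_with phi D -> measurable_fun setT (D k).
Proof.
move=> [dD cphi cD mphi _].
pose h (n : nat) : R := n.+1%:R^-1.
pose q (n : nat) (x : 'rV[R]_d) : R := (h n)^-1 * (phi (x + h n *: e_ k) - phi x).
apply: (@measurable_fun_cvg _ _ _ _ q).
  move=> n; rewrite /q; apply: measurable_funM => //; apply: measurable_funB => //.
  by apply: (measurableT_comp mphi); exact: measurable_rV_add.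
move=> x _; have [dp ep] := dD k x.
have /cvg_ex[l Hl] := dp.
have El : l = D k x.
  by rewrite -ep; apply/esym; exact: (@cvg_lim _ (@norm_hausdorff R R^o) _ _ _ _ _ Hl).
rewrite -El.
move/cvgr_dnbhsP : Hl => /(_ h) H.
rewrite (_ : q ^~ x = fun n => (h n)^-1 *: ((phi \o shift x) (h n *: e_ k) - phi x)).
  apply: H; split; last exact: cvg_harmonic.
  by move=> n; rewrite /h invr_eq0 pnatr_eq0.
by apply/funext => n /=; rewrite /q (addrC x).
Qed.

Lemma bounded_support_compact (f : 'rV[R]_d -> 'rV[R]_d) (M : R) :
  (forall x, f x != 0 -> close M x 0) -> compact (closure [set x | f x != 0]).
Proof.
move=> H.
pose B := [set v : 'rV[R]_d | forall i, [set` `[-M, M]] (v ord0 i)].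
have cB : compact B by apply: (@rV_compact _ _ (fun=> [set` `[-M, M]])) => i; exact: segment_compact.
apply: (subclosed_compact _ cB); first exact: closed_closure.
have /closure_id -> : closed B by apply: compact_closed => //; exact: norm_hausdorff.
apply: closure_subset => x /= /H /closeP Hx i.
by have := Hx i; rewrite mxE subr0 ler_norml /= in_itv.
Qed.

Lemma enorm_delta (a : R) k : enorm (a *: e_ k) = `|a|.
Proof.
rewrite /enorm /dotp (bigD1 k)//= big1 => [|i ik]; last first.
  by rewrite !mxE eq_sym in ik *; rewrite eqxx (negbTE ik) mulr0 mul0r.
by rewrite addr0 !mxE !eqxx mulr1 -expr2 sqrtr_sqr.
Qed.

(** A field along one axis has a single partial derivative as its divergence and [|phi|] as its
    Euclidean norm. Such fields suffice, since translations are decomposed along the axes. *)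
Lemma test_field_delta phi D k : tame_with phi D -> (forall x, `|phi x| <= 1) ->
  bounded_support phi -> test_field (fun x => phi x *: e_ k) /\
  divergence (fun x => phi x *: e_ k) = D k.
Proof.
move=> [dD cphi cD mphi _] phi1 [M HM].
have E i : rV_coord i \o (fun x => phi x *: e_ k) = fun x => if i == k then phi x else 0.
  apply/funext => x /=; rewrite /rV_coord !mxE eqxx /=.
  by case: eqP => _; rewrite ?mulr1 ?mulr0.
have P i j x : is_derive x (e_ j) (rV_coord i \o (fun x => phi x *: e_ k)) (if i == k then D j x else 0).
  by rewrite E; case: (i == k); [exact: dD|exact: is_derive_cst].
have PE i j : partial j (rV_coord i \o (fun x => phi x *: e_ k)) = fun x => if i == k then D j x else 0.
  by apply/funext => x; exact: (@derive_val _ _ _ _ _ _ _ (P i j x)).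
split.
  split.
  - move=> i j; split => [x|]; first exact: (@ex_derive _ _ _ _ _ _ _ (P i j x)).
    by rewrite PE; case: (i == k); [exact: cD|exact: cst_continuous].
  - apply: (@bounded_support_compact _ M) => x; rewrite scaler_eq0 negb_or => /andP[+ _].
    exact: HM.
  - by move=> x; rewrite enorm_delta.
apply/funext => x; rewrite /divergence (bigD1 k)//= big1 => [|i ik]; last first.
  by rewrite PE (negbTE ik).
by rewrite PE eqxx addr0.
Qed.

Lemma test_bound (u : 'rV[R]_d -> R) (V : R) phi D k :
  (gradient_variation u <= V%:E)%E ->
  tame_with phi D -> (forall x, `|phi x| <= 1) -> bounded_support phi ->
  (\int[L]_x (u x * D k x)%:E <= V%:E)%E.
Proof.
move=> uV tphi phi1 sphi; apply: le_trans uV.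
have [Tphi <-] := @test_field_delta phi D k tphi phi1 sphi.
by apply: ereal_sup_ubound; exists (fun x => phi x *: e_ k).
Qed.

Lemma tame_integrable (u : 'rV[R]_d -> R) (f : 'rV[R]_d -> R) (K : R) :
  L.-integrable setT (EFin \o u) -> measurable_fun setT f -> (forall x, `|f x| <= K) ->
  L.-integrable setT (fun x => (u x * f x)%:E).
Proof.
move=> iu mf fK.
apply: (@le_integrable _ _ _ _ _ _ _ (fun x => (K * u x)%:E)) => //.
- apply/measurable_EFinP; apply: measurable_funM => //.
  by apply/measurable_EFinP; exact: measurable_int iu.
- move=> x _; rewrite !abse_EFin lee_fin !normrM mulrC ler_wpM2r//.
  by rewrite (le_trans (fK x))// ler_norm.
- exact: (integrableZl _ K iu).
Qed.

(** As a function of [t] the first integral has derivative at most [V], because a translate of [phi]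
    is again a test function; the mean value theorem concludes. *)
Lemma line_bound (u : 'rV[R]_d -> R) (V : R) phi k (t : R) :
  L.-integrable setT (EFin \o u) ->
  (gradient_variation u <= V%:E)%E -> 0 <= t ->
  tame phi -> (forall x, `|phi x| <= 1) -> bounded_support phi ->
  \int[L]_x (u x * phi (t *: e_ k + x)) - \int[L]_x (u x * phi x) <= V * t.
Proof.
move=> iu uV t0 [D tphi] phi1 [M HM].
have [dD cphi cD mphi [K HK]] := tphi.
pose f (s : R) (x : 'rV[R]_d) := u x * phi (s *: e_ k + x).
pose F (s : R) := \int[L]_x f s x.
have fi (s : R) : L.-integrable setT (EFin \o f s).
  apply: (@tame_integrable u _ 1) => //.
  by have [] := tame_translate (s *: e_ k) tphi.
have fd (s : R) x : is_derive s 1 (f ^~ x) (u x * D k (s *: e_ k + x)).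
  have H := is_derive_line (dD k (s *: e_ k + x)).
  exact: (is_deriveZ (u x) H).
have pE (s : R) x : partial1of2 f s x = u x * D k (s *: e_ k + x).
  by rewrite partial1of2E; exact: (@derive_val _ _ _ _ _ _ _ (fd s x)).
pose G x := K * `|u x|.
have K0 : 0 <= K by have [H _] := HK 0; exact: le_trans H.
have Gi : L.-integrable setT (EFin \o G).
  by apply: (integrableZl _ K (integrable_norm iu)).
have FD (s : R) : is_derive s 1 F (\int[L]_x (u x * D k (s *: e_ k + x))).
  have Is : `]s - 1, s + 1[%classic s by rewrite /= in_itv/=; apply/andP; split; lra.
  have H1 : forall x y, `]s - 1, s + 1[%classic x -> setT y -> derivable (f ^~ y) x 1.
    by move=> x y _ _; exact: (@ex_derive _ _ _ _ _ _ _ (fd x y)).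
  have H2 : forall x y, `]s - 1, s + 1[%classic x -> setT y -> `|partial1of2 f x y| <= G y.
    move=> x y _ _; rewrite pE normrM mulrC ler_wpM2r//.
    by have [_] := HK (x *: e_ k + y).
  have G0 : forall y, 0 <= G y by move=> y; rewrite mulr_ge0.
  apply: DeriveDef.
    exact: (@derivable_under_integral _ _ _ L f setT measurableT s _ _ Is (fun s _ => fi s) H1 G G0 Gi H2).
  rewrite -derive1E.
  rewrite (@differentiation_under_integral _ _ _ L f setT measurableT s _ _ Is (fun s _ => fi s) H1 G G0 Gi H2).
  by apply: eq_Rintegral => x _; rewrite pE.
have F' (s : R) : \int[L]_x (u x * D k (s *: e_ k + x)) <= V.
  rewrite -lee_fin EFin_Rintegral//; last first.
    apply: (@tame_integrable u _ K) => //.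
      exact: (tame_measurableD k (tame_translate (s *: e_ k) tphi)).
    by move=> x; have [_] := HK (s *: e_ k + x).
  apply: (@test_bound u V (fun x => phi (s *: e_ k + x)) (fun i x => D i (s *: e_ k + x))) => //.
    exact: tame_translate.
  exists (M + `|s|) => x /HM/closeP H; apply/closeP => i.
  have := H i; rewrite !mxE !subr0 => Hi.
  rewrite (_ : x ord0 i = (s * (e_ k) ord0 i + x ord0 i) - s * (e_ k) ord0 i); last by ring.
  rewrite (le_trans (ler_normB _ _))// lerD//; first by rewrite mxE.
  by rewrite mxE normrM ler_piMr// normr_nat; case: (_ && _).
have cF : {within `[0, t], continuous F}.
  apply: derivable_within_continuous => x _.
  exact: (@ex_derive _ _ _ _ _ _ _ (FD x)).
have [c _ FE] := MVT_segment t0 (fun x _ => FD x) cF.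
have -> : \int[L]_x (u x * phi (t *: e_ k + x)) = F t by [].
have -> : \int[L]_x (u x * phi x) = F 0.
  by apply: eq_Rintegral => x _; rewrite /f scale0r add0r.
by rewrite FE subr0 ler_wpM2r.
Qed.

End bvdiff.

(** * Approximation of indicators in L^1(|g| dx) *)

Section l1dual.
Context {R : realType} {d : nat}.
Implicit Types phi : 'rV[R]_d -> R.
Local Notation L := (lebesgue_rV d).
Variable g : 'rV[R]_d -> R.
Hypothesis ig : L.-integrable setT (EFin \o g).

Let dist (f h : 'rV[R]_d -> R) := (\int[L]_x (`|g x| * `|f x - h x|)%:E)%E.

Let mg : measurable_fun setT g.
Proof. by apply/measurable_EFinP; exact: measurable_int ig. Qed.

Let mdist (f h : 'rV[R]_d -> R) : measurable_fun setT f -> measurable_fun setT h ->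
  measurable_fun setT (fun x => (`|g x| * `|f x - h x|)%:E).
Proof.
move=> mf mh; apply/measurable_EFinP; apply: measurable_funM; first exact: measurableT_comp.
by apply: measurableT_comp => //; exact: measurable_funB.
Qed.

(** Dominated convergence with dominating function [|g|]; the pointwise limit is reached after
    finitely many steps. *)
Lemma L1_approx (f : nat -> 'rV[R]_d -> R) (h : 'rV[R]_d -> R) (e : R) : 0 < e ->
  (forall n, measurable_fun setT (f n)) -> measurable_fun setT h ->
  (forall n x, 0 <= f n x <= 1) -> (forall x, 0 <= h x <= 1) ->
  (forall x, exists N, forall n, (N <= n)%N -> f n x = h x) ->
  exists n, (\int[L]_x (`|g x| * `|f n x - h x|)%:E < e%:E)%E.
Proof.
move=> e0 mf mh f01 h01 fh.
pose F (n : nat) (x : 'rV[R]_d) : \bar R := (`|g x| * `|f n x - h x|)%:E.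
have cF x : setT x -> F n x @[n --> \oo] --> (cst 0 x : \bar R)%E.
  move=> _; have [N HN] := fh x; apply: (@cvg_near_cst _ _ _ _ \oo).
  by exists N => // n /= /HN; rewrite /F => ->; rewrite subrr normr0 mulr0.
have bF x n : setT x -> (`|F n x| <= `|g x|%:E)%E.
  move=> _; rewrite abse_EFin lee_fin normrM !normr_id ler_piMr//.
  have /andP[a0 a1] := f01 n x; have /andP[b0 b1] := h01 x.
  by rewrite ler_norml; apply/andP; split; lra.
have mc : measurable_fun setT (cst 0%E : 'rV[R]_d -> \bar R) by exact: measurable_cst.
have [_ _] := @dominated_convergence _ _ _ L setT measurableT F (cst 0%E) (fun x => (`|g x|)%:E)
  (fun n => mdist (mf n) mh) mc (aeW _ cF) (integrable_norm ig) (aeW _ bF).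
rewrite integral0 => H.
have /H : nbhs (0 : \bar R)%E [set x | (x < e%:E)%E].
  by apply: open_nbhs_nbhs; split; [exact: open_ereal_lt_ereal|rewrite /= lte_fin].
by move=> [n _ Hn]; exists n; exact: (Hn n (leqnn n)).
Qed.

(* The sets whose indicator is approximated by test functions in L^1(|g| dx) form a
   sigma-algebra containing the half-spaces. *)
Let appr (A : set 'rV[R]_d) := measurable A /\ forall e : R, 0 < e ->
  exists phi, [/\ tame phi, forall x, 0 <= phi x <= 1 & (dist phi \1_A < e%:E)%E].

Let indic01 (A : set 'rV[R]_d) (x : 'rV[R]_d) : 0 <= (\1_A x : R) <= 1.
Proof. by rewrite indicE; case: (_ \in _); rewrite ?lexx ?ler01. Qed.

Let tame_meas phi : tame phi -> measurable_fun setT phi.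
Proof. by move=> [D []]. Qed.

Let dist_triangle (f h k : 'rV[R]_d -> R) : measurable_fun setT f -> measurable_fun setT h ->
  measurable_fun setT k -> (dist f k <= dist f h + dist h k)%E.
Proof.
move=> mf mh mk; rewrite /dist -ge0_integralD//=.
- apply: ge0_le_integral => //=.
  + exact: mdist.
  + by apply: emeasurable_funD; exact: mdist.
  + by move=> x _; rewrite -EFinD lee_fin -mulrDr ler_wpM2l// ler_distD.
- exact: mdist.
- exact: mdist.
Qed.

Let appr_lim (F : nat -> set 'rV[R]_d) (A : set 'rV[R]_d) : measurable A ->
  (forall n, appr (F n)) ->
  (forall x, exists N, forall n, (N <= n)%N -> (\1_(F n) x : R) = \1_A x) -> appr A.
Proof.
move=> mA aF FA; split => // e e0.
have e20 : 0 < e / 2 by rewrite divr_gt0.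
have [n Hn] := @L1_approx (fun n => \1_(F n)) \1_A _ e20
  (fun n => measurable_indic (aF n).1) (measurable_indic mA)
  (fun n => indic01 (F n)) (indic01 A) FA.
have [phi [tphi phi01 Hphi]] := (aF n).2 _ e20.
exists phi; split => //.
apply: (@le_lt_trans _ _ (dist phi \1_(F n) + dist \1_(F n) \1_A)%E).
  apply: dist_triangle; [exact: tame_meas|exact: (measurable_indic (aF n).1)|exact: measurable_indic].
by rewrite [e]splitr EFinD lteD.
Qed.

Let appr_tame (f : nat -> 'rV[R]_d -> R) (A : set 'rV[R]_d) : measurable A ->
  (forall n, tame (f n)) -> (forall n x, 0 <= f n x <= 1) ->
  (forall x, exists N, forall n, (N <= n)%N -> f n x = \1_A x) -> appr A.
Proof.
move=> mA tf f01 fA; split => // e e0.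
have [n Hn] := @L1_approx f \1_A _ e0 (fun n => tame_meas (tf n)) (measurable_indic mA)
  f01 (indic01 A) fA.
by exists (f n).
Qed.

Let appr_setC (A : set 'rV[R]_d) : appr A -> appr (~` A).
Proof.
move=> [mA aA]; split => [|e /aA [phi [tphi phi01 H]]]; first exact: measurableC.
exists (fun x => 1 - phi x); split.
- by apply: tameB => //; exact: tame_cst.
- by move=> x; have /andP[? ?] := phi01 x; apply/andP; split; lra.
- rewrite (_ : dist _ _ = dist phi \1_A)//; apply: eq_integral => x _.
  congr ((_ * _)%:E); rewrite distrC !indicE in_setC.
  by case: (_ \in _) => /=; congr (`|_|); ring.
Qed.

(** For values in [0, 1], |phi psi - 1_A 1_B| <= |phi - 1_A| + |psi - 1_B|. *)
Let appr_setI (A B : set 'rV[R]_d) : appr A -> appr B -> appr (A `&` B).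
Proof.
move=> [mA aA] [mB aB]; split => [|e e0]; first exact: measurableI.
have e20 : 0 < e / 2 by rewrite divr_gt0.
have [phi [tphi phi01 Hphi]] := aA _ e20.
have [psi [tpsi psi01 Hpsi]] := aB _ e20.
exists (fun x => phi x * psi x); split.
- exact: tameM.
- move=> x; have /andP[? ?] := phi01 x; have /andP[? ?] := psi01 x.
  by rewrite mulr_ge0// mulr_ile1.
- apply: (@le_lt_trans _ _ (dist phi \1_A + dist psi \1_B)%E); last first.
    by rewrite [e]splitr EFinD lteD.
  rewrite /dist -ge0_integralD//=.
  + apply: ge0_le_integral => //=.
    * apply: mdist; last exact/measurable_indic/measurableI.
      by apply: measurable_funM; exact: tame_meas.
    * by apply: emeasurable_funD; apply: mdist; first [exact: tame_meas|exact: measurable_indic].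
    * move=> x _; rewrite -EFinD lee_fin -mulrDr ler_wpM2l//.
      have /andP[p0 p1] := phi01 x; have /andP[q0 q1] := psi01 x.
      rewrite !indicE in_setI; case: (x \in A); case: (x \in B) => /=.
      - rewrite (_ : phi x * psi x - 1 = (phi x - 1) * psi x + (psi x - 1)); last by ring.
        rewrite (le_trans (ler_normD _ _))// lerD2r normrM ler_piMr// ger0_norm//.
      - by rewrite subr0 ger0_norm ?mulr_ge0// ler_wpDl// ger0_norm subr0// ler_piMl.
      - by rewrite subr0 ger0_norm ?mulr_ge0// ler_wpDr// ger0_norm subr0// ler_piMr.
      - by rewrite subr0 ger0_norm ?mulr_ge0// ler_wpDr// ger0_norm subr0// ler_piMr.
  + by apply: mdist; [exact: tame_meas|exact: measurable_indic].
  + by apply: mdist; [exact: tame_meas|exact: measurable_indic].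
Qed.

Let appr_set0 : appr set0.
Proof.
apply: (@appr_tame (fun _ _ => 0)) => //.
- by move=> _; exact: tame_cst.
- by move=> _ _; rewrite lexx ler01.
- by move=> x; exists 0%N => n _; rewrite indic0.
Qed.

Let appr_bigcup (F : nat -> set 'rV[R]_d) : (forall n, appr (F n)) -> appr (\bigcup_n F n).
Proof.
move=> aF.
apply: (@appr_lim (fun n => \big[setU/set0]_(i < n) F i)).
- by apply: bigcupT_measurable => n; have [] := aF n.
- move=> n; elim/big_ind : _ => [|A B aA aB|i _]; [exact: appr_set0| |exact: aF].
  by rewrite -[_ `|` _]setCK setCU; apply/appr_setC/appr_setI; exact: appr_setC.
- move=> x; have [[N _ FNx]|nF] := pselect ((\bigcup_n F n) x).
    exists N.+1 => n Nn; rewrite !indicE !mem_set//; first by exists N.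
    by rewrite -bigcup_mkord; exists N.
  exists 0%N => n _; rewrite !indicE !memNset// -bigcup_mkord => -[k _ Fk].
  by apply: nF; exists k.
Qed.

Let appr_sigma : sigma_algebra setT appr.
Proof.
split; [exact: appr_set0| |exact: appr_bigcup].
by move=> A /appr_setC; rewrite setTD.
Qed.

(** The steps [sstep (n (x_k - a))] vanish for x_k <= a and equal 1 as soon as n >= 1 / (x_k -
    a). *)
Let appr_halfspace (k : 'I_d) (a : R) : appr [set x | a < x ord0 k].
Proof.
apply: (@appr_tame (fun n x => sstep (n%:R * x ord0 k + - (n%:R * a)))).
- have := @measurable_rV_coord _ R d k measurableT _ (measurable_itv `]a, +oo[).
  rewrite setTI; congr (measurable _); apply/seteqP; split => x /=; by rewrite in_itv/= andbT.
- by move=> n; exact: tame_sstep.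
- by move=> n x; exact: sstep_bounds.
- move=> x; have [ax|xa] := ltP a (x ord0 k); last first.
    exists 0%N => n _; rewrite indicE memNset/=; last by apply/negP; rewrite -leNgt.
    by rewrite sstep_le0// -mulrBr mulr_ge0_le0// subr_le0.
  exists (Num.truncn (x ord0 k - a)^-1).+1 => n Hn; rewrite indicE mem_set//=.
  rewrite sstep_ge1// -mulrBr -ler_pdivrMr ?subr_gt0// div1r.
  by rewrite (le_trans (ltW (truncnS_gt _)))// ler_nat.
Qed.

Lemma tame_approx (A : set 'rV[R]_d) (e : R) : measurable A -> 0 < e ->
  exists phi, [/\ tame phi, forall x, 0 <= phi x <= 1 &
    (\int[L]_x (`|g x| * `|phi x - \1_A x|)%:E < e%:E)%E].
Proof.
move=> mA e0; suff : appr A by move=> [_ /(_ _ e0)].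
apply: (smallest_sub appr_sigma _ mA) => B.
rewrite -bigcup_seq/= => -[k _ [Y mY <-]].
suff H : (@measurable _ R) `<=` [set Y | appr (rV_coord k @^-1` Y)].
  by rewrite setTI; exact: H.
have -> : @measurable _ R = <<s @RGenOInfty.G R >> := RGenOInfty.measurableE R.
apply: smallest_sub.
  split => [|Z aZ|F aF] /=.
  - by rewrite preimage_set0.
  - by rewrite setTD preimage_setC; exact: appr_setC.
  - by rewrite preimage_bigcup; exact: appr_bigcup.
move=> Z [a ->] /=; have := appr_halfspace k a; congr appr.
by apply/seteqP; split => x /=; rewrite in_itv/= andbT.
Qed.

End l1dual.

(** * L^1 modulus of translation along an axis *)

Section translation_estimate.
Context {R : realType} {d : nat}.
Local Notation L := (lebesgue_rV d).
Local Notation e_ k := (delta_mx ord0 k : 'rV[R]_d).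

Lemma tame_prod (phi : 'I_d -> 'rV[R]_d -> R) :
  (forall k, tame (phi k)) -> tame (fun x => \prod_k phi k x).
Proof.
move=> tphi.
have -> : (fun x => \prod_k phi k x) = \prod_k phi k.
  by apply/funext => x; elim/big_rec2 : _ => // k y f _ ->.
elim/big_ind : _ => [|f h tf th|k _]; last exact: tphi.
  exact: (tame_cst 1).
exact: (tameM tf th).
Qed.

(** In each coordinate the two steps give 1 for |x_k| <= n and 0 for |x_k| >= n + 1. *)
Definition cutoff (n : nat) (x : 'rV[R]_d) : R :=
  \prod_k (sstep (-1 * x ord0 k + n.+1%:R) * sstep (1 * x ord0 k + n.+1%:R)).

Lemma tame_cutoff n : tame (cutoff n).
Proof. by apply: tame_prod => k; apply: tameM; exact: tame_sstep. Qed.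

Lemma cutoff_bounds n x : 0 <= cutoff n x <= 1.
Proof.
rewrite /cutoff; elim/big_ind : _ => [|a b /andP[? ?] /andP[? ?]|k _].
- by rewrite ler01 lexx.
- by rewrite mulr_ge0// mulr_ile1.
- have /andP[? ?] := sstep_bounds (-1 * x ord0 k + n.+1%:R).
  have /andP[? ?] := sstep_bounds (1 * x ord0 k + n.+1%:R).
  by rewrite mulr_ge0// mulr_ile1.
Qed.

Lemma bounded_support_cutoff n : bounded_support (cutoff n).
Proof.
exists n.+1%:R => x /prodf_neq0 H; apply/closeP => k; rewrite mxE subr0.
have := H k isT; rewrite mulf_eq0 negb_or => /andP[H1 H2].
rewrite ler_norml; apply/andP; split; rewrite leNgt.
  by apply: contra H2 => xn; apply/eqP/sstep_le0; lra.
by apply: contra H1 => xn; apply/eqP/sstep_le0; lra.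
Qed.

Lemma cutoff_eventually1 x : exists N, forall n, (N <= n)%N -> cutoff n x = 1.
Proof.
have H k : exists N, forall n, (N <= n)%N -> `|x ord0 k| <= n%:R.
  exists (Num.truncn `|x ord0 k|).+1 => n Hn.
  by rewrite (le_trans (ltW (truncnS_gt _)))// ler_nat.
have [N HN] := choice H.
exists (\max_k N k)%N => n Nn; rewrite /cutoff big1// => k _.
have := HN k n (leq_trans (leq_bigmax k) Nn); rewrite ler_norml => /andP[? ?].
by rewrite !sstep_ge1 ?mulr1// -natr1; lra.
Qed.

Lemma unit_bounds : 0 <= (1 : R) <= 1.
Proof. by rewrite ler01 lexx. Qed.

(** The norm is nearly attained on a compactly supported tame approximation of the sign of [g]. *)
Lemma L1_duality (g : 'rV[R]_d -> R) (M : R) : L.-integrable setT (EFin \o g) ->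
  (forall phi, tame phi -> (forall x, `|phi x| <= 1) -> bounded_support phi ->
    \int[L]_x (g x * phi x) <= M) ->
  (\int[L]_x `|g x|%:E <= M%:E)%E.
Proof.
move=> ig H.
have mg : measurable_fun setT g by apply/measurable_EFinP; exact: measurable_int ig.
pose P := [set x | 0 < g x].
have mP : measurable P.
  have := mg measurableT _ (measurable_itv `]0, +oo[); rewrite setTI.
  by congr (measurable _); apply/seteqP; split => x /=; rewrite in_itv/= andbT.
rewrite -EFin_Rintegral//; last exact: integrable_norm.
rewrite lee_fin; apply/ler_addgt0Pr => e e0.
(* The error below is twice the first approximation error plus the second, that is, at most 3e/4. *)
have e40 : 0 < e / 4 by rewrite divr_gt0.
have [phi [tphi phi01 Hphi]] := tame_approx ig mP e40.
have tm (f : 'rV[R]_d -> R) : tame f -> measurable_fun setT f by move=> [D []].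
have m1 : measurable_fun [set: 'rV[R]_d] (fun=> 1 : R) by exact: measurable_cst.
have [N HN] := @L1_approx _ _ _ ig cutoff (fun=> 1) _ e40 (fun n => tm _ (tame_cutoff n))
  m1 cutoff_bounds (fun=> unit_bounds) cutoff_eventually1.
(* [2 phi - 1] approximates the sign, as [phi] approximates the indicator of [g > 0]; the value -1
   where [g = 0] does no harm. *)
pose psi x := (phi x + phi x - 1) * cutoff N x.
have tpsi : tame psi.
  apply: tameM; last exact: tame_cutoff.
  apply: (@tameB _ _ (fun x => phi x + phi x)); last exact: tame_cst.
  have -> : (fun x => phi x + phi x) = (fun x => phi x - (0 - phi x)).
    by apply/funext => x; rewrite sub0r opprK.
  by apply: tameB => //; apply: tameB => //; exact: tame_cst.
have psi1 x : `|psi x| <= 1.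
  have /andP[? ?] := phi01 x; have /andP[? ?] := cutoff_bounds N x.
  rewrite normrM mulr_ile1//; last by rewrite ger0_norm.
  by rewrite ler_norml; apply/andP; split; lra.
have bpsi : bounded_support psi.
  have [K HK] := bounded_support_cutoff N.
  by exists K => x; rewrite mulf_eq0 negb_or => /andP[_ /HK].
have I1 : L.-integrable setT (fun x => (`|g x| * `|phi x - \1_P x|)%:E).
  apply: (@tame_integrable _ _ (fun x => `|g x|) (fun x => `|phi x - \1_P x|) 1).
  - exact: (integrable_norm ig).
  - apply: measurableT_comp => //; apply: measurable_funB; first exact: tm.
    exact: measurable_indic.
  - move=> x; rewrite normr_id indicE; have /andP[? ?] := phi01 x.
    by case: (_ \in _) => /=; rewrite ler_norml; apply/andP; split; lra.
have I2 : L.-integrable setT (fun x => (`|g x| * `|cutoff N x - 1|)%:E).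
  apply: (@tame_integrable _ _ (fun x => `|g x|) (fun x => `|cutoff N x - 1|) 1).
  - exact: (integrable_norm ig).
  - apply: measurableT_comp => //; apply: measurable_funB; first exact: (tm _ (tame_cutoff N)).
    exact: m1.
  - move=> x; rewrite normr_id; have /andP[? ?] := cutoff_bounds N x.
    by rewrite ler_norml; apply/andP; split; lra.
have I3 : L.-integrable setT (fun x => (g x * psi x)%:E).
  by apply: (@tame_integrable _ _ g psi 1) => //; exact: tm.
pose A x := 2 * (`|g x| * `|phi x - \1_P x|).
pose B x := `|g x| * `|cutoff N x - 1|.
have IA : L.-integrable setT (EFin \o A) by exact: (integrableZl measurableT 2 I1).
have IAB : L.-integrable setT (EFin \o (fun x => A x + B x)).
  exact: (integrableD measurableT IA I2).
have IgAB : L.-integrable setT (EFin \o (fun x => g x * psi x + (A x + B x))).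
  exact: (integrableD measurableT I3 IAB).
(* Pointwise, |g| <= g psi + 2 |g| |phi - 1_P| + |g| |cutoff - 1|: for either sign of [g] the
   difference factors into nonnegative terms. *)
apply: (@le_trans _ _ (\int[L]_x (g x * psi x + (A x + B x)))).
  apply: le_Rintegral => //; first exact: (integrable_norm ig).
  move=> x _; rewrite /psi /A /B.
  have /andP[? ?] := phi01 x; have /andP[? ?] := cutoff_bounds N x.
  have -> : `|cutoff N x - 1| = 1 - cutoff N x by rewrite ler0_norm; lra.
  rewrite indicE; have [g0|g0] := ltP 0 (g x).
    rewrite mem_set//= (gtr0_norm g0) (_ : `|phi x - 1| = 1 - phi x); last by rewrite ler0_norm; lra.
    rewrite -subr_ge0 [leRHS](_ : _ = g x * (2 * (1 - phi x) * (1 - cutoff N x))); last by ring.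
    by rewrite !mulr_ge0//; lra.
  rewrite memNset/=; last by apply/negP; rewrite -leNgt.
  rewrite subr0 (ger0_norm (_ : 0 <= phi x))// (ler0_norm g0).
  rewrite -subr_ge0 [leRHS](_ : _ = - g x * (2 * phi x * (1 - cutoff N x))); last by ring.
  by rewrite !mulr_ge0//; lra.
rewrite (RintegralD measurableT I3 IAB) (RintegralD measurableT IA I2) (RintegralZl _ measurableT I1).
move: Hphi; rewrite -EFin_Rintegral// lte_fin => Hphi.
move: HN; rewrite -EFin_Rintegral// lte_fin => HN.
have := H _ tpsi psi1 bpsi; lra.
Qed.

Lemma integral_translate_le (u : 'rV[R]_d -> R) (V : R) k (t : R) :
  L.-integrable setT (EFin \o u) ->
  (gradient_variation u <= V%:E)%E -> 0 <= t ->
  (\int[L]_x `|u (x + t *: e_ k) - u x|%:E <= (V * t)%:E)%E.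
Proof.
move=> iu uV t0.
have mu : measurable_fun setT u by apply/measurable_EFinP; exact: measurable_int iu.
have ius h : L.-integrable setT (EFin \o (fun x => u (x + h))).
  exact: (integrable_rV_translate h iu).
(* The backward translate has the same L^1 distance from [u], and moving it onto [phi] gives the
   forward shift that [line_bound] controls. *)
pose g x := u (x - t *: e_ k) - u x.
have ig : L.-integrable setT (EFin \o g) by exact: (integrableB measurableT (ius _) iu).
have mN : measurable_fun setT (fun x => `|g x|%:E) by apply: measurable_int (integrable_norm ig).
have -> : (\int[L]_x `|u (x + t *: e_ k) - u x|%:E = \int[L]_x `|g x|%:E)%E.
  rewrite -(@ge0_integral_rV_translate _ _ (t *: e_ k) (fun x => `|g x|%:E))//.
  by apply: eq_integral => x _; rewrite /g addrK distrC.
apply: L1_duality => // phi tphi phi1 sphi.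
have mphi : measurable_fun setT phi by have [D []] := tphi.
have i1 : L.-integrable setT (fun x => (u (x - t *: e_ k) * phi x)%:E).
  exact: (tame_integrable (ius (- (t *: e_ k))) mphi phi1).
have i2 : L.-integrable setT (fun x => (u x * phi x)%:E).
  exact: (tame_integrable iu mphi phi1).
rewrite (_ : (fun x => g x * phi x) = fun x => u (x - t *: e_ k) * phi x - u x * phi x); last first.
  by apply/funext => x; rewrite mulrBl.
rewrite RintegralB//.
have -> : \int[L]_x (u (x - t *: e_ k) * phi x) = \int[L]_x (u x * phi (t *: e_ k + x)).
  rewrite /Rintegral -(integral_rV_translate (t *: e_ k) i1); congr fine.
  by apply: eq_integral => x _; rewrite addrK (addrC x).
exact: line_bound.
Qed.

End translation_estimate.

(** * Variation between consecutive heights *)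

Section slopes.
Context {R : realType}.

Lemma subadditive_mul (w : R -> R) (h : R) (n : nat) : 0 <= h -> w 0 <= 0 ->
  (forall s t : R, 0 <= s -> 0 <= t -> w (s + t) <= w s + w t) ->
  w (n%:R * h) <= n%:R * w h.
Proof.
move=> h0 w0 sub; elim: n => [|n ih]; first by rewrite !mul0r.
rewrite -natr1 !mulrDl !mul1r (le_trans (sub _ _ _ h0)) ?mulr_ge0//.
by rewrite lerD2r.
Qed.

(* Splitting each t j into steps of one common small length h compares the slopes at
   different points. *)
Lemma sum_slopes_le (J : nat) (w : nat -> R -> R) (V : R) (t : nat -> R) : 0 <= V ->
  (forall j (s : R), 0 <= s -> 0 <= w j s) ->
  (forall j (s s' : R), 0 <= s -> 0 <= s' -> w j (s + s') <= w j s + w j s') ->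
  (forall s : R, 0 <= s -> \sum_(j < J) w j s <= V * s) ->
  (forall j, 0 < t j) -> \sum_(j < J) w j (t j) / t j <= V.
Proof.
move=> V0 w0 sub sumw t0.
have wV (j : 'I_J) s : 0 <= s -> w j s <= V * s.
  move=> s0; apply: le_trans (sumw _ s0); rewrite (bigD1 j)//= lerDl.
  by apply: sumr_ge0 => i _; exact: w0.
have w00 (j : 'I_J) : w j 0 <= 0 by rewrite (le_trans (wV j _ _))// mulr0.
pose T := \sum_(j < J) (t j)^-1.
have T0 : 0 <= T by apply: sumr_ge0 => j _; rewrite invr_ge0 ltW.
have H (h : R) : 0 < h -> \sum_(j < J) w j (t j) / t j <= V + h * (V * T).
  move=> h0.
  have : \sum_(j < J) w j (t j) / t j <= \sum_(j < J) (w j h / h + h * V * (t j)^-1).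
    apply: ler_sum => j _.
    (* [n] steps of length [h] leave a remainder of length at most [h], whose cost [V * h] vanishes
       with [h]. *)
    pose n := Num.truncn (t j / h).
    have /truncn_itv/andP[n1 n2] : 0 <= t j / h by rewrite divr_ge0// ltW.
    move: n1 n2; rewrite -/n ler_pdivlMr// ltr_pdivrMr// => n1 n2.
    have s0 : 0 <= t j - n%:R * h by rewrite subr_ge0.
    have s1 : t j - n%:R * h <= h by move: n2; rewrite -natr1 mulrDl mul1r => ?; lra.
    rewrite ler_pdivrMr// mulrDl -(mulrA (h * V)) mulVf ?mulr1 ?gt_eqF//.
    have := sub j (n%:R * h) (t j - n%:R * h) (mulr_ge0 (ler0n _ _) (ltW h0)) s0.
    rewrite addrC subrK => /le_trans; apply; apply: lerD.
      rewrite (le_trans (subadditive_mul n (ltW h0) (w00 j) (sub j)))//.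
      rewrite (mulrC _ (w j h)) -mulrA ler_wpM2l ?w0 ?(ltW h0)//.
      by rewrite mulrC ler_pdivlMr.
    rewrite (le_trans (wV _ _ s0))// mulrC ler_wpM2r//.
  rewrite big_split/= -mulr_suml -mulr_sumr => /le_trans; apply.
  rewrite -/T mulrA lerD2r ler_pdivrMr//; apply: sumw; exact: ltW.
apply/ler_addgt0Pr => e e0.
pose h := e / (V * T + 1).
have VT : 0 <= V * T by rewrite mulr_ge0.
have h0 : 0 < h by rewrite divr_gt0//; lra.
apply: (le_trans (H _ h0)); rewrite lerD2l /h mulrAC ler_pdivrMr; last lra.
by rewrite ler_wpM2l ?(ltW e0)//; lra.
Qed.

Lemma divS_mulrn_le (e : R) (n : nat) : 0 < e -> (e / n.+1%:R) *+ n <= e.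
Proof.
move=> e0; rewrite -mulr_natr mulrAC ler_pdivrMr//.
by rewrite ler_wpM2l ?(ltW e0)// ler_nat.
Qed.

(** [W j] is the largest slope of [w j]. Near-maximal slopes occur at points that depend on [j], and
    [sum_slopes_le] is what bounds their sum all the same. *)
Lemma slopes (J : nat) (w : nat -> R -> R) (V : R) : 0 <= V ->
  (forall j (s : R), 0 <= s -> 0 <= w j s) ->
  (forall j (s s' : R), 0 <= s -> 0 <= s' -> w j (s + s') <= w j s + w j s') ->
  (forall s : R, 0 <= s -> \sum_(j < J) w j s <= V * s) ->
  exists W : nat -> R, [/\ forall j, 0 <= W j,
    forall j (s : R), (j < J)%N -> 0 <= s -> w j s <= W j * s &
    \sum_(j < J) W j <= V].
Proof.
move=> V0 w0 sub sumw.
have wV j s : (j < J)%N -> 0 <= s -> w j s <= V * s.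
  move=> jJ s0; apply: le_trans (sumw _ s0).
  rewrite (bigD1 (Ordinal jJ))//= lerDl.
  by apply: sumr_ge0 => i _; exact: w0.
pose E j := [set w j s / s | s in [set s : R | 0 < s]].
(* Beyond [J] no bound on [w j] is known; the value 0 only keeps [W] nonnegative. *)
pose W j := if (j < J)%N then sup (E j) else 0.
have ubE j : (j < J)%N -> has_sup (E j).
  move=> jJ; split; first by exists (w j 1 / 1); exists 1 => //=.
  exists V => _ [s /= s0 <-]; rewrite ler_pdivrMr//; apply: wV => //; exact: ltW.
have WE j s : (j < J)%N -> 0 < s -> w j s / s <= W j.
  move=> jJ s0; rewrite /W jJ; apply: sup_upper_bound; first exact: ubE.
  by exists s.
exists W; split.
- move=> j; rewrite /W; case: ifPn => // jJ.
  have := WE j 1 jJ ltr01; rewrite /W jJ; apply: le_trans.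
  by rewrite divr_ge0// w0.
- move=> j s jJ; rewrite le_eqVlt => /orP[/eqP <-|s0].
    by rewrite mulr0 (le_trans (wV _ _ _ _))// mulr0.
  by rewrite -ler_pdivrMr//; exact: WE.
- apply/ler_addgt0Pr => e e0.
  have eJ : 0 < e / J.+1%:R by rewrite divr_gt0.
  have H j : exists s, 0 < s /\ ((j < J)%N -> W j - e / J.+1%:R <= w j s / s).
    have [jJ|jJ] := boolP (j < J)%N; last by exists 1.
    have [_ [s /= s0 <-] H] := sup_adherent eJ (ubE _ jJ).
    by exists s; split => // _; rewrite /W jJ ltW.
  have [t Ht] := choice H.
  have := sum_slopes_le V0 w0 sub sumw (fun j => (Ht j).1).
  rewrite -(lerD2r e) => /(le_trans _); apply.
  apply: (@le_trans _ _ (\sum_(j < J) (w j (t j) / t j + e / J.+1%:R))).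
    by apply: ler_sum => j _; rewrite -lerBlDr; exact: (Ht j).2.
  rewrite big_split/= lerD2l sumr_const card_ord; exact: divS_mulrn_le.
Qed.

End slopes.

Section clamp.
Context {R : realType}.

Definition clamp (a b s : R) := Num.min (Num.max s a) b.

Lemma clampP (a b s : R) : a <= b ->
  [\/ s <= a /\ clamp a b s = a, a <= s <= b /\ clamp a b s = s | b <= s /\ clamp a b s = b].
Proof.
move=> ab; rewrite /clamp; have [sa|/ltW sa] := leP s a.
  by constructor 1; split => //; exact/min_idPl.
have [sb|/ltW sb] := leP s b; last by constructor 3.
by constructor 2; split => //; rewrite sa.
Qed.

Lemma clamp_mono (a b s t : R) : a <= b -> s <= t -> clamp a b s <= clamp a b t.
Proof.
move=> ab st; have [[? ->]|[/andP[? ?] ->]|[? ->]] := clampP s ab;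
have [[? ->]|[/andP[? ?] ->]|[? ->]] := clampP t ab; lra.
Qed.

Lemma clamp_add (a b c s : R) : a <= b -> b <= c ->
  clamp a b s + clamp b c s = clamp a c s + b.
Proof.
move=> ab bc; have ac := le_trans ab bc.
have [[? ->]|[/andP[? ?] ->]|[? ->]] := clampP s ab;
have [[? ->]|[/andP[? ?] ->]|[? ->]] := clampP s ac;
have [[? ->]|[/andP[? ?] ->]|[? ->]] := clampP s bc; lra.
Qed.

Lemma clamp_lip (a b s t : R) : a <= b -> s <= t -> clamp a b t - clamp a b s <= t - s.
Proof.
move=> ab st; have [[? ->]|[/andP[? ?] ->]|[? ->]] := clampP s ab;
have [[? ->]|[/andP[? ?] ->]|[? ->]] := clampP t ab; lra.
Qed.

(** All increments have the sign of [s - t], so the sum telescopes by [clamp_add] to the increment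
    of the clamp between the extreme heights, which is 1-Lipschitz. *)
Lemma sum_clamp_le (mu : nat -> R) (J : nat) (s t : R) :
  (forall j, mu j <= mu j.+1) ->
  \sum_(j < J) `|clamp (mu j) (mu j.+1) s - clamp (mu j) (mu j.+1) t| <= `|s - t|.
Proof.
move=> mumono; wlog st : s t / s <= t => [H|].
  have [|/ltW] := leP s t; first exact: H.
  by move=> /H; rewrite distrC; under eq_bigr do rewrite distrC.
have mu0 n : mu 0 <= mu n by elim: n => // n ih; exact: le_trans (mumono n).
rewrite (eq_bigr (fun j : 'I_J => clamp (mu j) (mu j.+1) t - clamp (mu j) (mu j.+1) s)) => [|j _]; last first.
  by rewrite distrC ger0_norm// subr_ge0 clamp_mono.
have -> : \sum_(j < J) (clamp (mu j) (mu j.+1) t - clamp (mu j) (mu j.+1) s) =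
    clamp (mu 0) (mu J) t - clamp (mu 0) (mu J) s.
  elim: J => [|J ih].
    rewrite big_ord0; have [[? ->]|[/andP[? ?] ->]|[? ->]] := clampP s (lexx (mu 0));
    by have [[? ->]|[/andP[? ?] ->]|[? ->]] := clampP t (lexx (mu 0)); lra.
  rewrite big_ord_recr/= ih.
  have := clamp_add t (mu0 J) (mumono J); have := clamp_add s (mu0 J) (mumono J); lra.
by rewrite distrC ger0_norm ?subr_ge0// clamp_lip.
Qed.

End clamp.

Section increments.
Context {R : realType} {d : nat}.
Local Notation L := (lebesgue_rV d).
Local Notation e_ k := (delta_mx ord0 k : 'rV[R]_d).
Implicit Types (f u : 'rV[R]_d -> R) (h : 'rV[R]_d).

Definition incr f h : \bar R := (\int[L]_x `|f (x + h)%R - f x|%:E)%E.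

Lemma measurable_incr f h h' : measurable_fun setT f ->
  measurable_fun setT (fun x : 'rV[R]_d => `|f (x + h) - f (x + h')|%:E).
Proof.
move=> mf; apply/measurable_EFinP; apply: measurableT_comp => //.
by apply: measurable_funB; apply: (measurableT_comp mf); exact: measurable_rV_add.
Qed.

Lemma measurable_incr0 f h : measurable_fun setT f ->
  measurable_fun setT (fun x : 'rV[R]_d => `|f (x + h) - f x|%:E).
Proof.
move=> mf; have := measurable_incr h 0 mf.
by congr measurable_fun; apply/funext => x; rewrite addr0.
Qed.

Lemma incr_ge0 f h : (0 <= incr f h)%E.
Proof. by apply: integral_ge0 => x _; rewrite lee_fin. Qed.

Lemma incr0 f : incr f 0 = 0%E.
Proof.
rewrite /incr (eq_integral (fun=> 0%E)) ?integral0// => x _.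
by rewrite addr0 subrr normr0.
Qed.

Lemma incrN f h : measurable_fun setT f -> incr f (- h) = incr f h.
Proof.
move=> mf; rewrite /incr.
rewrite -(@ge0_integral_rV_translate _ _ h (fun x => `|f (x - h)%R - f x|%:E))//.
  by apply: eq_integral => x _; rewrite addrK distrC.
exact: measurable_incr0.
Qed.

Lemma incrD f h h' : measurable_fun setT f -> (incr f (h + h') <= incr f h + incr f h')%E.
Proof.
move=> mf; rewrite [X in (_ <= X + _)%E]/incr.
rewrite -(@ge0_integral_rV_translate _ _ h' (fun x => `|f (x + h)%R - f x|%:E))//; last exact: measurable_incr0.
rewrite -ge0_integralD//; last 2 first.
- by under eq_fun do rewrite -addrA; exact: measurable_incr.
- exact: measurable_incr0.
apply: ge0_le_integral => //.
- exact: measurable_incr0.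
- apply: emeasurable_funD; last exact: measurable_incr0.
  by under eq_fun do rewrite -addrA; exact: measurable_incr.
- move=> x _; rewrite -EFinD lee_fin (_ : x + (h + h') = x + h' + h) ?ler_distD//.
  by rewrite -addrA (addrC h').
Qed.

Lemma incr_sum f (v : 'I_d -> 'rV[R]_d) : measurable_fun setT f ->
  (incr f (\sum_k v k)%R <= \sum_k incr f (v k))%E.
Proof.
move=> mf; elim/big_ind2 : _ => [|x x' y y' xx' yy'|k _]; last by [].
  by rewrite incr0.
by rewrite (le_trans (incrD _ _ mf))// leeD.
Qed.

Lemma clamp_dist_le (a b s t : R) : a <= b -> `|clamp a b s - clamp a b t| <= `|s - t|.
Proof.
move=> ab; wlog st : s t / t <= s => [H|].
  have [ts|/ltW st] := leP t s; first exact: H.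
  by rewrite distrC (distrC s); exact: H.
by rewrite !ger0_norm ?subr_ge0 ?clamp_lip ?clamp_mono.
Qed.

Lemma measurable_clamp (a b : R) u : measurable_fun setT u ->
  measurable_fun setT (fun x => clamp a b (u x)).
Proof.
move=> mu; apply: measurable_minr; last exact: measurable_cst.
by apply: measurable_maxr => //; exact: measurable_cst.
Qed.

(** A substitute for the coarea formula: the variations of the truncations of [u] add up. [W j]
    holds for every [r], so each height may use its own scale. The factor [d] counts the axes along
    which [z] is decomposed. *)
Lemma bv_levels u (V : R) (J : nat) (mu : nat -> R) :
  L.-integrable setT (EFin \o u) -> (gradient_variation u <= V%:E)%E ->
  (forall j, mu j <= mu j.+1) ->
  exists W : nat -> R, [/\ forall j, 0 <= W j,
    forall j (r : R) z, (j < J)%N -> 0 <= r -> close r z 0 ->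
      (incr (fun x => clamp (mu j) (mu j.+1) (u x)) z <= (W j * r)%:E)%E &
    \sum_(j < J) W j <= d%:R * V].
Proof.
move=> iu uV mumono.
have mu' : measurable_fun setT u by apply/measurable_EFinP; exact: measurable_int iu.
pose f j x := clamp (mu j) (mu j.+1) (u x).
have mf j : measurable_fun setT (f j) by exact: measurable_clamp.
have iV k (t : R) : 0 <= t -> (incr u (t *: e_ k) <= (V * t)%:E)%E.
  exact: integral_translate_le.
have fV j k (t : R) : 0 <= t -> (incr (f j) (t *: e_ k) <= (V * t)%:E)%E.
  move=> t0; apply: le_trans (iV k _ t0); apply: ge0_le_integral => //.
  - exact: measurable_incr0.
  - exact: measurable_incr0.
  - by move=> x _; rewrite lee_fin clamp_dist_le.
have ffin j k (t : R) : 0 <= t -> incr (f j) (t *: e_ k) \is a fin_num.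
  by move=> t0; rewrite ge0_fin_numE ?incr_ge0// (le_lt_trans (fV _ _ _ t0))// ltry.
have H (k : 'I_d) : exists W : nat -> R, [/\ forall j, 0 <= W j,
    forall j (s : R), (j < J)%N -> 0 <= s -> fine (incr (f j) (s *: e_ k)) <= W j * s &
    \sum_(j < J) W j <= V].
  apply: (@slopes _ J (fun j s => fine (incr (f j) (s *: e_ k)))).
  - have := iV k 1 ler01; rewrite mulr1 => /(le_trans (incr_ge0 _ _)).
    by rewrite lee_fin.
  - by move=> j s s0; rewrite fine_ge0// incr_ge0.
  - move=> j s s' s0 s0'; rewrite -fineD ?ffin// fine_le ?ffin ?addr_ge0//.
      by rewrite fin_numD !ffin.
    by rewrite scalerDl incrD.
  - move=> s s0; rewrite -lee_fin -sumEFin.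
    under eq_bigr do rewrite fineK ?ffin//.
    apply: le_trans (iV k _ s0).
    rewrite /incr -ge0_integral_sum//; last by move=> j; exact: measurable_incr0.
    apply: ge0_le_integral => //.
    + by move=> x _; apply: sume_ge0.
    + by apply: emeasurable_sum => j; exact: measurable_incr0.
    + exact: measurable_incr0.
    + by move=> x _; rewrite sumEFin lee_fin sum_clamp_le.
have [W HW] := choice H.
exists (fun j => \sum_k W k j); split.
- by move=> j; apply: sumr_ge0 => k _; have [] := HW k.
- move=> j r z jJ r0 /closeP zr.
  have -> : z = \sum_k z ord0 k *: e_ k by exact: row_sum_delta.
  rewrite (le_trans (incr_sum _ (mf j)))// mulr_suml -sumEFin.
  apply: lee_sum => k _; have [W0 Wk _] := HW k.
  have := zr k; rewrite mxE subr0 => zk.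
  (* The slopes are known for steps in the positive direction only. *)
  have -> : incr (f j) (z ord0 k *: e_ k) = incr (f j) (`|z ord0 k| *: e_ k).
    have [z0|z0] := leP 0 (z ord0 k); first by rewrite ger0_norm.
    by rewrite ltr0_norm// scaleNr incrN.
  rewrite -(fineK (ffin j k `|z ord0 k| _))// lee_fin.
  by rewrite (le_trans (Wk _ _ jJ _))// ler_wpM2l.
- rewrite exchange_big/= mulr_natl -[X in _ *+ X]card_ord -sumr_const.
  by apply: ler_sum => k _; have [] := HW k.
Qed.

End increments.
Section boolR.
Context {R : realType} {d0 : measure_display} {T : measurableType d0}.
Implicit Types P : T -> bool.

Lemma boolRE P : (fun x => (P x)%:R : R) = \1_[set x | P x].
Proof.
apply/funext => x; rewrite indicE; have [Px|Px] := boolP (P x); first by rewrite mem_set.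
by rewrite memNset//; exact/negP.
Qed.

Lemma measurable_boolR P : measurable [set x | P x] ->
  measurable_fun setT (fun x => (P x)%:R : R).
Proof. by move=> mP; rewrite boolRE; exact: measurable_indic. Qed.

Lemma integral_boolR (m : {measure set T -> \bar R}) P : measurable [set x | P x] ->
  (\int[m]_x ((P x)%:R : R)%:E)%E = m [set x | P x].
Proof.
move=> mP; rewrite -[LHS]/(\int[m]_x (((fun x => (P x)%:R) : T -> R) x)%:E)%E boolRE.
by rewrite integral_indic// setIT.
Qed.

Lemma measurable_fun_lt_cst (f : T -> R) (a : R) : measurable_fun setT f ->
  measurable [set x | a < f x].
Proof.
move=> mf; have := mf measurableT _ (measurable_itv `]a, +oo[); rewrite setTI.
by congr measurable; apply/seteqP; split => x /=; rewrite in_itv/= andbT.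
Qed.

Lemma measurable_fun_le_cst (f : T -> R) (a : R) : measurable_fun setT f ->
  measurable [set x | f x <= a].
Proof.
move=> mf; have := mf measurableT _ (measurable_itv `]-oo, a]); rewrite setTI.
by congr measurable; apply/seteqP; split => x /=; rewrite in_itv/=.
Qed.

Lemma measurable_rVD n (f g : T -> 'rV[R]_n) : measurable_fun setT f ->
  measurable_fun setT g -> measurable_fun setT (fun x => f x + g x).
Proof.
move=> mf mg; apply: measurable_fun_rVP => i.
apply: (eq_measurable_fun (fun x : T => f x ord0 i + g x ord0 i)) => [x _|].
  by rewrite /rV_coord /= mxE.
apply: measurable_funD.
  exact: (measurableT_comp (measurable_rV_coord i) mf).
exact: (measurableT_comp (measurable_rV_coord i) mg).
Qed.

End boolR.

Lemma clamp_le (R : realType) (a b s : R) : s <= a -> a <= b -> clamp a b s = a.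
Proof. by move=> sa ab; rewrite /clamp (max_idPr sa) (min_idPl ab). Qed.

Lemma clamp_ge (R : realType) (a b s : R) : b <= s -> clamp a b s = b.
Proof. by move=> bs; apply/min_idPr; rewrite le_max bs. Qed.

(** * Bad and good points *)

Section levels.
Context {R : realType} {d : nat}.
Local Notation L := (lebesgue_rV d).
Implicit Types (u : 'rV[R]_d -> R).

Lemma integral_close (r : R) (x : 'rV[R]_d) : 0 <= r ->
  (\int[L]_y ((close r y x)%:R : R)%:E)%E = ((2 * r) ^+ d)%:E.
Proof.
move=> r0; rewrite integral_boolR; first exact: lebesgue_rV_close.
by apply: measurable_close => //; exact: measurable_cst.
Qed.

Variables (u : 'rV[R]_d -> R) (a b r : R).
Hypotheses (mu : measurable_fun setT u) (ab : a < b) (r0 : 0 < r).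

Definition low_part (x : 'rV[R]_d) : \bar R :=
  (\int[L]_z ((close r z 0 && (u (x + z)%R <= a))%:R : R)%:E)%E.

Definition bad x := (b < u x) && (((2 * r) ^+ d / 2)%:E <= low_part x)%E.

Definition good x := (b < u x) && (low_part x < ((2 * r) ^+ d / 2)%:E)%E.

Let cube0 : 0 < (2 * r) ^+ d.
Proof. by rewrite exprn_gt0// mulr_gt0. Qed.

Lemma measurable_low_set : measurable
  [set p : 'rV[R]_d * 'rV[R]_d | close r p.2 0 && (u (p.1 + p.2) <= a)].
Proof.
have -> : [set p : 'rV[R]_d * 'rV[R]_d | close r p.2 0 && (u (p.1 + p.2) <= a)] =
   [set p | close r p.2 0] `&` [set p | u (p.1 + p.2) <= a].
  by apply/seteqP; split => p /= => [/andP[]|[-> ->]].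
apply: measurableI.
  by apply: measurable_close; [exact: measurable_snd|exact: measurable_cst].
apply: measurable_fun_le_cst; apply: (measurableT_comp mu).
by apply: measurable_rVD; [exact: measurable_fst|exact: measurable_snd].
Qed.

Lemma measurable_low_part : measurable_fun setT low_part.
Proof.
pose F (p : 'rV[R]_d * 'rV[R]_d) := ((close r p.2 0 && (u (p.1 + p.2) <= a))%:R : R)%:E.
have mF : measurable_fun setT F.
  by apply/measurable_EFinP; apply: measurable_boolR; exact: measurable_low_set.
have F0 p : (0 <= F p)%E by rewrite lee_fin.
exact: (measurable_fun_fubini_tonelli_F (m2 := L) F mF F0).
Qed.

Lemma measurable_bad : measurable [set x | bad x].
Proof.
have -> : [set x | bad x] = [set x | b < u x] `&` [set x | (((2 * r) ^+ d / 2)%:E <= low_part x)%E].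
  by apply/seteqP; split => x /= => [/andP[]|[? ?]]//; apply/andP.
apply: measurableI; first exact: measurable_fun_lt_cst.
by rewrite -[X in measurable X]setTI; apply: emeasurable_fun_c_infty => //; exact: measurable_low_part.
Qed.

Lemma measurable_good : measurable [set x | good x].
Proof.
have -> : [set x | good x] = [set x | b < u x] `&` [set x | (low_part x < ((2 * r) ^+ d / 2)%:E)%E].
  by apply/seteqP; split => x /= => [/andP[]|[? ?]]//; apply/andP.
apply: measurableI; first exact: measurable_fun_lt_cst.
by rewrite -[X in measurable X]setTI; apply: emeasurable_fun_infty_o => //; exact: measurable_low_part.
Qed.

Lemma bad_or_good x : b < u x = bad x || good x.
Proof. by rewrite /bad /good; case: (b < u x) => //=; rewrite leNgt orNb. Qed.

Lemma measurable_shift x : measurable_fun setT (fun z : 'rV[R]_d => u (x + z)).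
Proof.
apply: (measurableT_comp mu); apply: measurable_rVD; first exact: measurable_cst.
exact: measurable_id.
Qed.

Lemma measurable_low_section x : measurable [set z | close r z 0 && (u (x + z) <= a)].
Proof.
have -> : [set z | close r z 0 && (u (x + z) <= a)] =
   [set z | close r z 0] `&` [set z | u (x + z) <= a].
  by apply/seteqP; split => p /= => [/andP[]|[-> ->]].
apply: measurableI.
  by apply: measurable_close => //; exact: measurable_cst.
by apply: measurable_fun_le_cst; exact: measurable_shift.
Qed.

Lemma measurable_close0 x : measurable [set z : 'rV[R]_d | close r z x].
Proof. by apply: measurable_close => //; exact: measurable_cst. Qed.

(** Integrate |f(x + z) - f(x)|, f the clamped [u], over all x and over z in the cube. Integrating
    in x first gives the upper bound by [HW]. At a bad x the integrand equals [b - a] on at least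
    half of the cube, which gives the lower one. *)
Lemma measure_bad_le (W : R) : 0 <= W ->
  (forall z, close r z 0 -> incr (fun x => clamp a b (u x)) z <= (W * r)%:E)%E ->
  ((b - a)%:E * L [set x | bad x] <= (2 * W * r)%:E)%E.
Proof.
move=> W0 HW; pose f x := clamp a b (u x).
have mf : measurable_fun setT f by exact: measurable_clamp.
pose F (p : 'rV[R]_d * 'rV[R]_d) : \bar R := ((close r p.2 0)%:R * `|f (p.1 + p.2)%R - f p.1|)%:E.
have mF : measurable_fun setT F.
  apply/measurable_EFinP; apply: measurable_funM.
    apply: measurable_boolR; apply: measurable_close; first exact: measurable_snd.
    exact: measurable_cst.
  apply: measurableT_comp => //; apply: measurable_funB.
    by apply: (measurableT_comp mf); apply: measurable_rVD; [exact: measurable_fst|exact: measurable_snd].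
  by apply: (measurableT_comp mf); exact: measurable_fst.
have F0 p : (0 <= F p)%E by rewrite lee_fin mulr_ge0.
have mclose : measurable_fun setT (fun z : 'rV[R]_d => ((close r z 0)%:R : R)).
  by apply: measurable_boolR; exact: measurable_close0.
have up : (\int[L]_x \int[L]_z F (x, z) <= (W * r * (2 * r) ^+ d)%:E)%E.
  rewrite (fubini_tonelli F)//.
  apply: (@le_trans _ _ (\int[L]_z ((W * r)%:E * ((close r z 0)%:R : R)%:E))%E).
    apply: ge0_le_integral => //.
    - by move=> z _; apply: integral_ge0.
    - exact: measurable_fun_fubini_tonelli_G.
    - by apply/measurable_EFinP; apply: measurable_funM.
    - move=> z _; rewrite /F /=; have [cz|_] := boolP (close r z 0).
        rewrite mule1; under eq_integral do rewrite mul1r; exact: HW.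
      by rewrite mule0; under eq_integral do rewrite mul0r; rewrite integral0.
  rewrite ge0_integralZl//; last 2 first.
  - exact/measurable_EFinP.
  - by rewrite lee_fin mulr_ge0// ltW.
  by rewrite integral_close ?(ltW r0)// -EFinM.
have lo : (((b - a) * ((2 * r) ^+ d / 2))%:E * L [set x | bad x] <= \int[L]_x \int[L]_z F (x, z))%E.
  rewrite -integral_boolR; last exact: measurable_bad.
  have c0 : 0 <= (b - a) * ((2 * r) ^+ d / 2) by rewrite mulr_ge0 ?divr_ge0 ?subr_ge0 1?ltW.
  have mb : measurable_fun setT (fun x => ((bad x)%:R : R)%:E).
    by apply/measurable_EFinP; apply: measurable_boolR; exact: measurable_bad.
  rewrite -ge0_integralZl//.
  apply: ge0_le_integral => //.
  - by move=> x _; rewrite mule_ge0// lee_fin.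
  - exact: measurable_funeM.
  - exact: measurable_fun_fubini_tonelli_F.
  - move=> x _; have [|_] := boolP (bad x); last first.
      by rewrite mule0; apply: integral_ge0.
    move=> /andP[bu lx]; rewrite mule1 EFinM.
    apply: (@le_trans _ _ ((b - a)%:E * low_part x)%E).
      by rewrite lee_wpmul2l// lee_fin subr_ge0 ltW.
    rewrite /low_part -ge0_integralZl//; last 2 first.
    - by apply/measurable_EFinP; apply: measurable_boolR; exact: measurable_low_section.
    - by rewrite lee_fin subr_ge0 ltW.
    apply: ge0_le_integral => //.
    + by move=> z _; rewrite mule_ge0// lee_fin subr_ge0 ltW.
    + apply: measurable_funeM.
      by apply/measurable_EFinP; apply: measurable_boolR; exact: measurable_low_section.
    + by apply: (measurableT_comp mF).
    + move=> z _; rewrite /F /= -EFinM lee_fin.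
      case: (close r z 0); last by rewrite mulr0 mul0r.
      rewrite /= mul1r; have [uza|_] := boolP (u (x + z) <= a); last by rewrite mulr0.
      rewrite mulr1 /f.
      by rewrite (clamp_le uza (ltW ab)) (clamp_ge a (ltW bu)) distrC ler_norm.
have := le_trans lo up.
rewrite (_ : W * r * (2 * r) ^+ d = ((2 * r) ^+ d / 2) * (2 * W * r)); last by field.
rewrite (mulrC (b - a)) !EFinM -muleA lee_pmul2l// ?lte_fin ?divr_gt0//.
Qed.

(** At a good point [u] exceeds [a] on at least half of the cube. *)
Lemma good_mass_ge x : 0 <= a -> (forall x, 0 <= u x) -> good x ->
  ((a * ((2 * r) ^+ d / 2))%:E <= \int[L]_y ((close r y x)%:R * u y)%:E)%E.
Proof.
move=> a0 u0 /andP[_ lx].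
rewrite -(@ge0_integral_rV_translate _ _ x (fun y => ((close r y x)%:R * u y)%:E)); last 2 first.
- apply/measurable_EFinP; apply: measurable_funM => //.
  by apply: measurable_boolR; exact: measurable_close0.
- by move=> y; rewrite lee_fin mulr_ge0.
have mclose : measurable_fun setT (fun z : 'rV[R]_d => ((close r z 0)%:R : R)).
  by apply: measurable_boolR; exact: measurable_close0.
have mlow' : measurable_fun setT (fun z => ((close r z 0 && (u (x + z) <= a))%:R : R)).
  by apply: measurable_boolR; exact: measurable_low_section.
have E : ((2 * r) ^+ d)%:E = (low_part x + \int[L]_z ((close r z 0 && (a < u (x + z)%R))%:R : R)%:E)%E.
  rewrite -(@integral_close r 0 (ltW r0)) /low_part -ge0_integralD//.
  - apply: eq_integral => z _; rewrite -EFinD -natrD; congr (_%:R%:E).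
    by rewrite ltNge; case: (close r z 0); case: (_ <= _).
  - exact/measurable_EFinP.
  - apply/measurable_EFinP; apply: measurable_boolR.
    rewrite (_ : [set _ | _] = [set z | close r z 0] `&` [set z | a < u (x + z)]).
      by apply: measurableI; [exact: measurable_close0|apply: measurable_fun_lt_cst; exact: measurable_shift].
    by apply/seteqP; split => p /= => [/andP[]|[-> ->]].
have H : (((2 * r) ^+ d / 2)%:E <= \int[L]_z ((close r z 0 && (a < u (x + z)%R))%:R : R)%:E)%E.
  rewrite leNgt; apply/negP => lt; have := lteD lx lt.
  by rewrite -E -EFinD -splitr ltxx.
rewrite EFinM; apply: (@le_trans _ _ (a%:E * \int[L]_z ((close r z 0 && (a < u (x + z)%R))%:R : R)%:E)%E).
  by rewrite lee_wpmul2l.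
have mup : measurable_fun setT (fun z => ((close r z 0 && (a < u (x + z)))%:R : R)%:E).
  apply/measurable_EFinP; apply: measurable_boolR.
  rewrite (_ : [set _ | _] = [set z | close r z 0] `&` [set z | a < u (x + z)]).
    by apply: measurableI; [exact: measurable_close0|apply: measurable_fun_lt_cst; exact: measurable_shift].
  by apply/seteqP; split => p /= => [/andP[]|[-> ->]].
rewrite -ge0_integralZl//; apply: ge0_le_integral => //.
- by move=> z _; rewrite mule_ge0.
- exact: measurable_funeM.
- apply/measurable_EFinP; apply: measurable_funM.
    apply: measurable_boolR; apply: measurable_close; last exact: measurable_cst.
    exact: measurable_rV_add.
  by apply: (measurableT_comp mu); exact: measurable_rV_add.
- move=> z _; rewrite -EFinM lee_fin close_shift addrC.
  case: (close r z 0) => /=; last by rewrite mulr0 mul0r.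
  by rewrite mul1r; case: ltP => [/ltW|]; rewrite ?mulr1 ?mulr0.
Qed.

End levels.

(** * Transport *)

Section averages.
Context {R : realType} {d : nat} {d0 : measure_display} {T : measurableType d0}.
Variable rho : {sigma_finite_measure set T -> \bar R}.
Local Notation L := (lebesgue_rV d).
Variables (l : R) (p : T -> 'rV[R]_d) (w : T -> R).
Hypotheses (l0 : 0 <= l) (mp : measurable_fun setT p) (mw : measurable_fun setT w)
  (w0 : forall t, 0 <= w t).

Let F (q : 'rV[R]_d * T) : \bar R := ((close l (p q.2) q.1)%:R * w q.2)%:E.

Let mF : measurable_fun setT F.
Proof.
apply/measurable_EFinP; apply: measurable_funM.
  apply: measurable_boolR; apply: measurable_close; last exact: measurable_fst.
  by apply: (measurableT_comp mp); exact: measurable_snd.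
by apply: (measurableT_comp mw); exact: measurable_snd.
Qed.

Let F0 q : (0 <= F q)%E. Proof. by rewrite lee_fin mulr_ge0. Qed.

Lemma measurable_average :
  measurable_fun setT (fun z => \int[rho]_t ((close l (p t) z)%:R * w t)%:E)%E.
Proof. exact: (measurable_fun_fubini_tonelli_F (m2 := rho) F mF F0). Qed.

(** Tonelli: every point is seen from centres z filling a cube of volume (2l)^d. *)
Lemma integral_average :
  (\int[L]_z \int[rho]_t ((close l (p t) z)%:R * w t)%:E =
   ((2 * l) ^+ d)%:E * \int[rho]_t (w t)%:E)%E.
Proof.
rewrite -[LHS]/(\int[L]_z \int[rho]_t F (z, t))%E (fubini_tonelli F mF F0).
rewrite -ge0_integralZl//; last 3 first.
- exact/measurable_EFinP.
- by move=> t _; rewrite lee_fin.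
- by rewrite lee_fin exprn_ge0// mulr_ge0.
apply: eq_integral => t _; rewrite /F /=.
under eq_integral do rewrite closeC mulrC EFinM.
rewrite ge0_integralZl ?integral_close ?lee_fin//; first by rewrite muleC.
by apply/measurable_EFinP; apply: measurable_boolR; exact: measurable_close0.
Qed.

End averages.

Section lebesgue_rV2.
Context {R : realType} (d : nat).
Local Notation L := (@lebesgue_rV R d).

Lemma sigma_finite_rV2 : sigma_finite setT (L \x L)%E.
Proof.
exists (fun n => [set x | close n%:R x 0] `*` [set x | close n%:R x 0]).
  apply/seteqP; split => // -[x y] _.
  have bnd (z : 'rV[R]_d) : exists N, forall n, (N <= n)%N -> close n%:R z 0.
    exists (Num.truncn `|z|).+1 => n Nn; apply/closeP => i; rewrite mxE subr0.
    apply: (@le_trans _ _ `|z|); last first.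
      by rewrite (le_trans (ltW (truncnS_gt _)))// ler_nat.
    by rewrite /Num.norm/= mx_normrE; apply/bigmax_geP; right; exists (ord0, i).
  have [N HN] := bnd x; have [M HM] := bnd y.
  by exists (maxn N M) => //; split; [apply/HN/leq_maxl|apply/HM/leq_maxr].
move=> n; split; first by apply: measurableX; exact: measurable_close0.
rewrite product_measure1E; [|exact: measurable_close0..].
have foo : (L [set x | close n%:R x 0] < +oo)%E by rewrite lebesgue_rV_close// ltry.
by apply: lte_mul_pinfty => //; rewrite ge0_fin_numE//; exact: foo.
Qed.

(* The canonical structure that the library attaches to [\x] is the one of
   products of subprobabilities, so this one has to be packed by hand. *)
Definition lebesgue_rV2 : {sigma_finite_measure set ('rV[R]_d * 'rV[R]_d)%type -> \bar R} :=
  HB.pack_for (SigmaFiniteMeasure.type ('rV[R]_d * 'rV[R]_d)%type R)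
    (L \x L)%E (Measure_isSigmaFinite.Build _ _ _ _ sigma_finite_rV2).

End lebesgue_rV2.

Section transport.
Context {R : realType} {d : nat}.
Local Notation L := (lebesgue_rV d).
Local Notation L2 := (lebesgue_rV2 d).
Local Notation V := 'rV[R]_d.
Local Notation VV := ('rV[R]_d * 'rV[R]_d)%type.

(** Either [U <= 2 T], and then m A <= m U <= 2 m T; or U <= 2 w, and then m A <= U^2 <= 4 w^2. *)
Lemma square_dichotomy (m A U T w : R) : 0 <= m -> 0 <= T -> 0 <= A -> m <= U -> A <= U ->
  U <= T + w -> m * A <= 2 * m * T + 4 * (w * w).
Proof.
move=> m0 T0 A0 mU AU UTw.
have mA : m * A <= m * U by exact: ler_wpM2l.
have [UT|TU] := leP U (2 * T).
  have : m * U <= m * (2 * T) by exact: ler_wpM2l.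
  have := sqr_ge0 w; rewrite expr2; lra.
have U2 : U <= 2 * w by lra.
have U0 : 0 <= U by lra.
have : m * U <= U * U by exact: ler_wpM2r.
have : U * U <= (2 * w) * (2 * w) by apply: ler_pM.
have := mulr_ge0 m0 T0.
rewrite (_ : 4 * (w * w) = 2 * w * (2 * w)); last by ring.
lra.
Qed.

Lemma transport_cst (k m c : R) : 2 * m * (k * c) = c * (2 * k * m).
Proof. ring. Qed.

Variables (u v : V -> R) (ppi : {finite_measure set VV -> \bar R}).
Hypotheses (iu : L.-integrable setT (EFin \o u)) (u0 : forall x, 0 <= u x)
  (mv : measurable_fun setT v) (v0 : forall x, 0 <= v x) (cuv : couplings u v ppi).

Variables (G : V -> bool) (m r l : R).
Hypotheses (mG : measurable [set x | G x]) (r0 : 0 < r) (rl : r <= l) (m0 : 0 <= m).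
Hypothesis Gmass : forall x, G x -> (m%:E <= \int[L]_y ((close r y x)%:R * u y)%:E)%E.

Let mu : measurable_fun setT u.
Proof. by apply/measurable_EFinP; exact: measurable_int iu. Qed.

Let l0 : 0 < l. Proof. exact: lt_le_trans rl. Qed.

Let far : set VV := [set p | ~~ close l p.1 p.2].

Let mfar : measurable far.
Proof.
rewrite (_ : far = ~` [set p | close l p.1 p.2]).
  apply: measurableC; apply: measurable_close; [exact: measurable_fst|exact: measurable_snd].
by apply/seteqP; split => p /= /negP.
Qed.

(* Integrating over the centre z of a cube turns the local dichotomy into a bound
   without any choice of disjoint cubes. *)
Let Az z := (\int[L]_x ((close l x z)%:R * ((G x)%:R * u x))%:E)%E.
Let Tz z := (\int[ppi]_p ((close (2 * l) p.1 z)%:R * (~~ close l p.1 p.2)%:R : R)%:E)%E.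
(** The radii: a cube of size r <= l around a point of the l-cube lies in the 2l-cube; mass of the
    2l-cube moved by at most l lands in the 3l-cube; two points of the 3l-cube are 6l-close. *)
Let Bz z := (\int[L2]_p ((close (3 * l) p.1 z)%:R * ((close (6 * l) p.1 p.2)%:R * (v p.1 * v p.2)))%:E)%E.

Let mfar' : measurable_fun setT (fun p : VV => (~~ close l p.1 p.2)%:R : R).
Proof. exact: measurable_boolR. Qed.

Let mGu : measurable_fun setT (fun x => (G x)%:R * u x).
Proof. by apply: measurable_funM => //; exact: measurable_boolR. Qed.

Let mvv : measurable_fun setT
  (fun p : VV => (close (6 * l) p.1 p.2)%:R * (v p.1 * v p.2) : R).
Proof.
apply: measurable_funM.
  by apply: measurable_boolR; apply: measurable_close; [exact: measurable_fst|exact: measurable_snd].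
apply: measurable_funM; [apply: (measurableT_comp mv)|apply: (measurableT_comp mv)].
  exact: measurable_fst.
exact: measurable_snd.
Qed.

Let integral_close_set (f : V -> R) s z : measurable_fun setT f -> (forall x, 0 <= f x) ->
  (\int[L]_(x in [set x | close s x z]) (f x)%:E = \int[L]_x ((close s x z)%:R * f x)%:E)%E.
Proof.
move=> mf f0; rewrite integral_mkcond; apply: eq_integral => x _.
rewrite patchE; have [cx|cx] := boolP (close s x z); first by rewrite mem_set// mul1r.
by rewrite memNset ?mul0r//; exact/negP.
Qed.

Let mclose s z : measurable_fun setT (fun x : V => (close s x z)%:R : R).
Proof. by apply: measurable_boolR; exact: measurable_close0. Qed.

(** What starts in the 2l-cube is either moved farther than l or arrives in the 3l-cube. *)
Let ball_coupling z :
  (\int[L]_x ((close (2 * l) x z)%:R * u x)%:E <=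
   Tz z + \int[L]_y ((close (3 * l) y z)%:R * v y)%:E)%E.
Proof.
rewrite -!integral_close_set//.
have [<- _] := cuv (measurable_close0 (2 * l) z).
have [_ <-] := cuv (measurable_close0 (3 * l) z).
have mT : measurable [set p : VV | close (2 * l) p.1 z && ~~ close l p.1 p.2].
  rewrite (_ : [set _ | _] = ([set p : VV | close (2 * l) p.1 z] `&` far)).
    apply: measurableI => //; apply: measurable_close; first exact: measurable_fst.
    exact: measurable_cst.
  by apply/seteqP; split => p /= => [/andP[]|[-> ->]].
have -> : Tz z = ppi [set p | close (2 * l) p.1 z && ~~ close l p.1 p.2].
  rewrite -integral_boolR//; apply: eq_integral => p _.
  by congr EFin; case: (close _ _ _); rewrite ?mul1r ?mul0r.
have mB : measurable ([set: V] `*` [set x : V | close (3 * l) x z]).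
  by apply: measurableX => //; exact: measurable_close0.
apply: le_trans (measureU2 ppi mT mB); apply: le_measure; rewrite ?inE.
- by apply: measurableX => //; exact: measurable_close0.
- exact: measurableU.
- move=> p [/= c2 _]; have [c1|c1] := boolP (close l p.1 p.2); last by left; apply/andP.
  right; split => //=; rewrite (_ : 3 * l = l + 2 * l); last by ring.
  by apply: close_trans c2; rewrite closeC.
Qed.

Let Bz_ge z : ((\int[L]_y ((close (3 * l) y z)%:R * v y)%:E) *
  (\int[L]_y ((close (3 * l) y z)%:R * v y)%:E) <= Bz z)%E.
Proof.
set I := (\int[L]_y _)%E.
have mc : measurable_fun setT (fun y => ((close (3 * l) y z)%:R * v y)%:E).
  by apply/measurable_EFinP; exact: measurable_funM.
have c0 y : (0 <= ((close (3 * l) y z)%:R * v y)%:E)%E by rewrite lee_fin mulr_ge0.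
have I0 : (0 <= I)%E by apply: integral_ge0 => y _.
pose F (p : VV) : \bar R :=
  ((close (3 * l) p.1 z)%:R * ((close (6 * l) p.1 p.2)%:R * (v p.1 * v p.2)))%:E.
have mF : measurable_fun setT F.
  apply/measurable_EFinP; apply: measurable_funM => //.
  exact: (measurableT_comp (mclose _ _) measurable_fst).
have F0 p : (0 <= F p)%E by rewrite lee_fin !mulr_ge0.
rewrite /Bz (fubini_tonelli1 F mF F0) /fubini_F.
rewrite {2}/I -ge0_integralZl//.
apply: ge0_le_integral => //.
- by move=> y _; rewrite mule_ge0.
- exact: measurable_funeM.
- exact: measurable_fun_fubini_tonelli_F.
- move=> y _; rewrite muleC -ge0_integralZl//.
  apply: ge0_le_integral => //.
  + by move=> y' _; rewrite mule_ge0.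
  + exact: measurable_funeM.
  + exact: (measurableT_comp mF).
  + move=> y' _; rewrite /F /= -EFinM lee_fin.
    have [cy|cy] := boolP (close (3 * l) y z); last by rewrite !mul0r.
    have [cy'|cy'] := boolP (close (3 * l) y' z); last by rewrite mul0r mulr0 mul1r mulr_ge0// mulr_ge0.
    rewrite (_ : close (6 * l) y y') ?mul1r//.
    rewrite (_ : 6 * l = 3 * l + 3 * l); last by ring.
    by apply: close_trans cy _; rewrite closeC.
Qed.

Let ffin (f : V -> R) s z : L.-integrable setT (EFin \o f) -> (forall x, 0 <= f x) ->
  (\int[L]_y ((close s y z)%:R * f y)%:E)%E \is a fin_num.
Proof.
move=> fi f0; apply: integrable_fin_num => //.
apply: (le_integrable measurableT _ _ fi).
  apply/measurable_EFinP; apply: measurable_funM => //.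
  by apply/measurable_EFinP; exact: measurable_int fi.
move=> x _; rewrite !abse_EFin lee_fin normrM ler_piMl// normr_nat.
by case: (close _ _ _).
Qed.

Let iv : L.-integrable setT (EFin \o v).
Proof.
apply/integrableP; split; first exact/measurable_EFinP.
under eq_integral do rewrite abse_EFin ger0_norm//.
have [_] := cuv (@measurableT _ V); rewrite setXTT => <-.
by have [+ _] := cuv (@measurableT _ V); rewrite setXTT => ->; rewrite ltey_eq integrable_fin_num.
Qed.

Let pointwise z : (m%:E * Az z <= (2 * m)%:E * Tz z + 4%:E * Bz z)%E.
Proof.
have T0 : (0 <= Tz z)%E by apply: integral_ge0 => p _; rewrite lee_fin mulr_ge0.
have B0 : (0 <= Bz z)%E by apply: integral_ge0 => p _; rewrite lee_fin !mulr_ge0.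
have A0 : (0 <= Az z)%E by apply: integral_ge0 => p _; rewrite lee_fin !mulr_ge0.
have RHS0 : (0 <= (2 * m)%:E * Tz z + 4%:E * Bz z)%E.
  by rewrite adde_ge0// mule_ge0// lee_fin mulr_ge0.
(* Without a good point in the l-cube, [Az z] vanishes. A single one already gives [m <= U], because
   its r-cube lies in the 2l-cube. *)
have [[x0 [cx0 Gx0]]|nG] := pselect (exists x, close l x z /\ G x); last first.
  rewrite (_ : Az z = 0%E) ?mule0//; rewrite /Az.
  under eq_integral => x _.
    rewrite (_ : (close l x z)%:R * ((G x)%:R * u x) = 0); first over.
    have [cx|_] := boolP (close l x z); last by rewrite mul0r.
    have [Gx|_] := boolP (G x); last by rewrite mul0r mulr0.
    by exfalso; apply: nG; exists x.
  by rewrite integral0.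
set U := (\int[L]_x ((close (2 * l) x z)%:R * u x)%:E)%E.
set w := (\int[L]_y ((close (3 * l) y z)%:R * v y)%:E)%E.
have Ufin : U \is a fin_num by exact: ffin.
have wfin : w \is a fin_num by exact: ffin.
have AU : (Az z <= U)%E.
  apply: ge0_le_integral => //.
  - by move=> x _; rewrite lee_fin !mulr_ge0.
  - by apply/measurable_EFinP; exact: measurable_funM.
  - by apply/measurable_EFinP; exact: measurable_funM.
  - move=> x _; rewrite lee_fin; have [cx|_] := boolP (close l x z); last by rewrite mul0r mulr_ge0.
    rewrite (@close_le _ _ l (2 * l))//; last by move: l0; lra.
    by rewrite !mul1r ler_piMl//; case: (G x).
have Afin : Az z \is a fin_num.
  by rewrite ge0_fin_numE// (le_lt_trans AU)// ltey_eq Ufin.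
have mU : (m%:E <= U)%E.
  apply: (le_trans (Gmass Gx0)); apply: ge0_le_integral => //.
  - by move=> x _; rewrite lee_fin !mulr_ge0.
  - by apply/measurable_EFinP; exact: measurable_funM.
  - by apply/measurable_EFinP; exact: measurable_funM.
  - move=> x _; rewrite lee_fin; have [cx|_] := boolP (close r x x0); last by rewrite mul0r mulr_ge0.
    rewrite (_ : close (2 * l) x z)//.
    apply: (close_le _ (close_trans cx cx0)); move: rl; lra.
have Tfin : Tz z \is a fin_num.
  rewrite ge0_fin_numE//; apply: (@le_lt_trans _ _ (ppi setT)); last by rewrite ltey_eq fin_num_measure.
  rewrite -[leRHS]mul1e -integral_cst//; apply: ge0_le_integral => //.
  - apply/measurable_EFinP; apply: measurable_funM => //.
    exact: (measurableT_comp (mclose _ _) measurable_fst).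
  - by move=> p _; rewrite lee_fin; case: (close _ _ _); case: (close _ _ _); rewrite ?mulr1 ?mulr0.
apply: (@le_trans _ _ ((2 * m)%:E * Tz z + 4%:E * (w * w))%E); last first.
  by rewrite leeD2l// lee_wpmul2l// Bz_ge.
have := ball_coupling z; rewrite -/U -/w.
move: A0 T0 AU mU; rewrite -(fineK Ufin) -(fineK wfin) -(fineK Tfin) -(fineK Afin).
rewrite -!EFinM -!EFinD !lee_fin => A0 T0 AU mU UTw.
exact: (square_dichotomy m0 T0 A0 mU AU UTw).
Qed.

(** [pointwise] integrated over all centres. The factors [2 ^+ d] and [3 ^+ d] are the volumes of
    the 2l- and 3l-cubes relative to the l-cube. *)
Lemma transport_le :
  (m%:E * \int[L]_x ((G x)%:R * u x)%:E <=
   (2 * 2 ^+ d * m)%:E * ppi far +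
   (4 * 3 ^+ d)%:E * \int[L2]_p ((close (6 * l) p.1 p.2)%:R * (v p.1 * v p.2))%:E)%E.
Proof.
have c0 : 0 < (2 * l) ^+ d by rewrite exprn_gt0// mulr_gt0.
rewrite -(@lee_pmul2l _ ((2 * l) ^+ d)%:E) ?lte_fin//.
have mA : measurable_fun setT Az.
  by apply: (@measurable_average _ _ _ _ L) => // x; rewrite mulr_ge0.
have mT : measurable_fun setT Tz.
  by apply: (@measurable_average _ _ _ _ ppi) => //; exact: measurable_fst.
have mB : measurable_fun setT Bz.
  apply: (@measurable_average _ _ _ _ L2) => //.
  all: try exact: measurable_fst.
  by move=> p; rewrite !mulr_ge0.
have A0 z : (0 <= Az z)%E by apply: integral_ge0 => x _; rewrite lee_fin !mulr_ge0.
have T0 z : (0 <= Tz z)%E by apply: integral_ge0 => x _; rewrite lee_fin !mulr_ge0.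
have B0 z : (0 <= Bz z)%E by apply: integral_ge0 => x _; rewrite lee_fin !mulr_ge0.
have eA : (\int[L]_z Az z = ((2 * l) ^+ d)%:E * \int[L]_x ((G x)%:R * u x)%:E)%E.
  apply: (@integral_average _ _ _ _ L) => //; first exact: ltW.
  by move=> x; rewrite mulr_ge0.
have eT : (\int[L]_z Tz z = ((2 * (2 * l)) ^+ d)%:E * ppi far)%E.
  rewrite -integral_boolR//; apply: (@integral_average _ _ _ _ ppi) => //.
    by rewrite mulr_ge0// ltW.
have eB : (\int[L]_z Bz z = ((2 * (3 * l)) ^+ d)%:E *
    \int[L2]_p ((close (6 * l) p.1 p.2)%:R * (v p.1 * v p.2))%:E)%E.
  apply: (@integral_average _ _ _ _ L2) => //.
  all: try exact: measurable_fst.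
  - by rewrite mulr_ge0// ltW.
  - by move=> p; rewrite !mulr_ge0.
rewrite muleCA -eA -ge0_integralZl//.
apply: (@le_trans _ _ (\int[L]_z ((2 * m)%:E * Tz z + 4%:E * Bz z))%E).
  apply: ge0_le_integral => //.
  - by move=> z _; rewrite mule_ge0.
  - exact: measurable_funeM.
  - by apply: emeasurable_funD; exact: measurable_funeM.
rewrite ge0_integralD//; last 4 first.
- by move=> z _; rewrite mule_ge0// lee_fin mulr_ge0.
- exact: measurable_funeM.
- by move=> z _; rewrite mule_ge0.
- exact: measurable_funeM.
rewrite !ge0_integralZl ?lee_fin ?mulr_ge0// eT eB.
set P := ppi far; set I := (\int[_]_p _)%E.
have I0 : (0 <= I)%E by apply: integral_ge0 => p _; rewrite lee_fin !mulr_ge0.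
have P0 : (0 <= P)%E by exact: measure_ge0.
move: P I P0 I0 => P I P0 I0.
rewrite (_ : (2 * (2 * l)) ^+ d = 2 ^+ d * (2 * l) ^+ d); last by rewrite exprMn.
rewrite (_ : (2 * (3 * l)) ^+ d = 3 ^+ d * (2 * l) ^+ d); last by rewrite -exprMn; congr (_ ^+ _); ring.
move: c0 => /ltW; move: ((2 * l) ^+ d) => c c0.
rewrite ge0_muleDr ?mule_ge0 ?lee_fin ?mulr_ge0 ?exprn_ge0//.
rewrite !muleA -!EFinM (transport_cst (2 ^+ d)) (mulrC 4) -mulrA (mulrC (3 ^+ d)) -mulrA.
by rewrite (mulrC (3 ^+ d)).
Qed.

End transport.

(** * Fourier side *)

Section trig.
Context {R : realType}.

Lemma measurable_fun_cos d0 (T : measurableType d0) (f : T -> R) : measurable_fun setT f ->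
  measurable_fun setT (fun x => cos (f x)).
Proof. exact: (measurableT_comp (continuous_measurable_fun (@continuous_cos R))). Qed.

Lemma measurable_fun_sin d0 (T : measurableType d0) (f : T -> R) : measurable_fun setT f ->
  measurable_fun setT (fun x => sin (f x)).
Proof. exact: (measurableT_comp (continuous_measurable_fun (@continuous_sin R))). Qed.

Lemma cos_ge_cos1 (x : R) : `|x| <= 1 -> cos 1 <= cos x.
Proof.
move=> x1; have -> : cos x = cos `|x|.
  by have [x0|x0] := leP 0 x; [rewrite ger0_norm|rewrite ltr0_norm// cosN].
have p1 : (1 : R) <= pi by rewrite (le_trans _ (pi_ge2 R))// ler1n.
move: x1; rewrite le_eqVlt => /predU1P[->//|x1]; apply: ltW.
by rewrite ltr_cos// in_itv/= ?ler01// normr_ge0 (le_trans (ltW x1)).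
Qed.

End trig.

Section gram.
Context {R : realType} {d0 : measure_display} {T : measurableType d0}.
Variables (m : {measure set T -> \bar R}) (f : T -> R).
Hypotheses (fi : m.-integrable setT (EFin \o f)).

Lemma integrable_unit (g : T -> R) : measurable_fun setT g -> (forall x, `|g x| <= 1) ->
  m.-integrable setT (EFin \o (fun x => f x * g x)).
Proof.
move=> mg g1; apply: (le_integrable measurableT _ _ fi).
  apply/measurable_EFinP; apply: measurable_funM => //.
  by apply/measurable_EFinP; exact: measurable_int fi.
by move=> x _; rewrite lee_fin/= normrM ler_piMr.
Qed.

Variable rho : T -> R.
Hypothesis mrho : measurable_fun setT rho.

Let C := \int[m]_x (f x * cos (rho x)).
Let S := \int[m]_x (f x * sin (rho x)).

Let ic : m.-integrable setT (EFin \o (fun x => f x * cos (rho x))).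
Proof. by apply: integrable_unit; [exact: measurable_fun_cos|move=> x; exact: cos_max]. Qed.

Let is_ : m.-integrable setT (EFin \o (fun x => f x * sin (rho x))).
Proof. by apply: integrable_unit; [exact: measurable_fun_sin|move=> x; exact: sin_max]. Qed.

(* The summand 1 makes the integrand nonnegative, so that only Tonelli's theorem is
   needed below. *)
Lemma trig_gram :
  (\int[m]_a \int[m]_b (f a * f b * (1 + cos (rho a - rho b)))%:E =
   ((\int[m]_x f x) ^+ 2 + (C ^+ 2 + S ^+ 2))%:E)%E.
Proof.
set M := \int[m]_x f x.
have comb (k1 k2 k3 : R) : (\int[m]_x (k1 * f x + (k2 * (f x * cos (rho x)) + k3 * (f x * sin (rho x))))%:E =
  (k1 * M + (k2 * C + k3 * S))%:E)%E.
  have i1 : m.-integrable setT (EFin \o (fun x => k1 * f x)) by exact: (integrableZl measurableT k1 fi).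
  have i2 : m.-integrable setT (EFin \o (fun x => k2 * (f x * cos (rho x)))).
    by exact: (integrableZl measurableT k2 ic).
  have i3 : m.-integrable setT (EFin \o (fun x => k3 * (f x * sin (rho x)))).
    by exact: (integrableZl measurableT k3 is_).
  have i23 : m.-integrable setT
      (EFin \o (fun x => k2 * (f x * cos (rho x)) + k3 * (f x * sin (rho x)))).
    by exact: (integrableD measurableT i2 i3).
  rewrite -EFin_Rintegral//; last exact: (integrableD measurableT i1 i23).
  by rewrite RintegralD// RintegralD// !RintegralZl.
transitivity (\int[m]_a (M * f a + (C * (f a * cos (rho a)) + S * (f a * sin (rho a))))%:E)%E.
  apply: eq_integral => a _.
  rewrite -[RHS]/((_ + (_ + _))%:E)%E.
  have -> : M * f a + (C * (f a * cos (rho a)) + S * (f a * sin (rho a))) =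
     f a * M + ((f a * cos (rho a)) * C + (f a * sin (rho a)) * S) by ring.
  rewrite -comb; apply: eq_integral => b _; congr EFin; rewrite cosB; ring.
by rewrite comb !expr2.
Qed.

End gram.

Section frequency.
Context {R : realType} {d : nat}.
Local Notation L := (lebesgue_rV d).
Local Notation L2 := (lebesgue_rV2 d).
Local Notation VV := ('rV[R]_d * 'rV[R]_d)%type.
Implicit Types (k x y z : 'rV[R]_d) (v : 'rV[R]_d -> R).

Lemma measurable_dotp d0 (T : measurableType d0) (f g : T -> 'rV[R]_d) :
  measurable_fun setT f -> measurable_fun setT g ->
  measurable_fun setT (fun t => dotp (f t) (g t)).
Proof.
move=> mf mg; apply: measurable_sum => i; apply: measurable_funM.
  exact: (measurableT_comp (measurable_rV_coord i) mf).
exact: (measurableT_comp (measurable_rV_coord i) mg).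
Qed.

Lemma measurable_rVB d0 (T : measurableType d0) (f g : T -> 'rV[R]_d) :
  measurable_fun setT f -> measurable_fun setT g ->
  measurable_fun setT (fun t => f t - g t).
Proof.
move=> mf mg; apply: measurable_fun_rVP => i.
apply: (eq_measurable_fun (fun x : T => f x ord0 i - g x ord0 i)) => [x _|].
  by rewrite /= /rV_coord !mxE.
apply: measurable_funB.
  exact: (measurableT_comp (measurable_rV_coord i) mf).
exact: (measurableT_comp (measurable_rV_coord i) mg).
Qed.

Lemma dotpBr k x y : dotp k (x - y) = dotp k x - dotp k y.
Proof. by rewrite /dotp -sumrB; apply: eq_bigr => i _; rewrite !mxE mulrBr. Qed.

Lemma dotpC k x : dotp k x = dotp x k.
Proof. by apply: eq_bigr => i _; rewrite mulrC. Qed.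

Lemma dotp_le (a b : R) k x : close a k 0 -> close b x 0 ->
  `|dotp k x| <= d%:R * (a * b).
Proof.
move=> /closeP ka /closeP xb; rewrite (le_trans (ler_norm_sum _ _ _))//.
rewrite mulr_natl -[d in _ *+ d]card_ord -sumr_const; apply: ler_sum => i _.
have := ka i; have := xb i; rewrite !mxE !subr0 => xi ki.
by rewrite normrM ler_pM.
Qed.

(* |v^(k)|^2 without the normalising power of 2 pi. *)
Definition freq v k : R :=
  (\int[L]_x (v x * cos (dotp k x))) ^+ 2 + (\int[L]_x (v x * sin (dotp k x))) ^+ 2.

Lemma freq_ge0 v k : 0 <= freq v k.
Proof. by rewrite addr_ge0 ?sqr_ge0. Qed.

Section fixed.
Variable v : 'rV[R]_d -> R.
Hypotheses (iv : L.-integrable setT (EFin \o v)) (v0 : forall x, 0 <= v x).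

Let mv : measurable_fun setT v.
Proof. by apply/measurable_EFinP; exact: measurable_int iv. Qed.

Let M := \int[L]_x v x.

Let Phi (q : 'rV[R]_d * VV) : \bar R :=
  (v q.2.1 * v q.2.2 * (1 + cos (dotp q.1 (q.2.1 - q.2.2))))%:E.

Let Phi0 q : (0 <= Phi q)%E.
Proof. by rewrite lee_fin !mulr_ge0. Qed.

Let mPhi : measurable_fun setT Phi.
Proof.
have m21 : measurable_fun [set: 'rV[R]_d * VV] (fun q => q.2.1).
  exact: (measurableT_comp measurable_fst measurable_snd).
have m22 : measurable_fun [set: 'rV[R]_d * VV] (fun q => q.2.2).
  exact: (measurableT_comp measurable_snd measurable_snd).
apply/measurable_EFinP; apply: measurable_funM.
  by apply: measurable_funM; exact: (measurableT_comp mv).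
apply: measurable_funD => //; apply: measurable_fun_cos; apply: measurable_dotp.
  exact: measurable_fst.
exact: measurable_rVB.
Qed.

Lemma measurable_pair_cos k : measurable_fun setT
  (fun p : VV => (v p.1 * v p.2 * (1 + cos (dotp k (p.1 - p.2))))%:E).
Proof.
pose F (p : VV) : \bar R := Phi (k, p).
have mF : measurable_fun setT F by exact: (measurableT_comp mPhi).
exact: mF.
Qed.

Lemma freq_gram k :
  (\int[L2]_p (v p.1 * v p.2 * (1 + cos (dotp k (p.1 - p.2))))%:E =
   (M ^+ 2 + freq v k)%:E)%E.
Proof.
pose F (p : VV) : \bar R := Phi (k, p).
have mF : measurable_fun setT F by exact: (measurableT_comp mPhi).
have F0 p : (0 <= F p)%E by exact: Phi0.
rewrite -[LHS]/(\int[L2]_p F p)%E (fubini_tonelli1 F mF F0) /fubini_F.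
rewrite -(trig_gram iv (rho := dotp k)); last first.
  by apply: measurable_dotp; [exact: measurable_cst|exact: measurable_id].
by apply: eq_integral => a _; apply: eq_integral => b _; rewrite /F /Phi /= dotpBr.
Qed.

(** By [freq_gram], up to the constant [M ^+ 2] it is the integral of a nonnegative measurable
    function of two variables, so Tonelli applies. *)
Lemma measurable_freq : measurable_fun setT (freq v).
Proof.
have m1 : measurable_fun setT (fun k => (M ^+ 2 + freq v k)%:E).
  under eq_fun do rewrite -freq_gram.
  exact: (measurable_fun_fubini_tonelli_F (m2 := L2) Phi mPhi Phi0).
have m2 : measurable_fun setT (fun k => M ^+ 2 + freq v k) by exact/measurable_EFinP.
have := measurable_funB m2 (@measurable_cst _ _ _ _ setT (M ^+ 2)).
by apply: eq_measurable_fun => k _ /=; rewrite addrC addKr.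
Qed.

End fixed.

Section cube.
Variables (v : 'rV[R]_d -> R) (q : R).
Hypotheses (iv : L.-integrable setT (EFin \o v)) (v0 : forall x, 0 <= v x).

Let mv : measurable_fun setT v.
Proof. by apply/measurable_EFinP; exact: measurable_int iv. Qed.

Let M := \int[L]_x v x.

Hypothesis q0 : 0 < q.
Let Q (s : 'rV[R]_d) : R := (close q s 0)%:R.
Let w : R := (2 * q) ^+ d.

Let w0 : 0 < w. Proof. by rewrite exprn_gt0// mulr_gt0. Qed.

Let mQ : measurable_fun setT Q.
Proof. by apply: measurable_boolR; exact: measurable_close0. Qed.

Let integral_Q : (\int[L]_s (Q s)%:E = w%:E)%E.
Proof. exact: integral_close (ltW q0). Qed.

Let iQ : L.-integrable setT (EFin \o Q).
Proof.
apply/integrableP; split; first exact/measurable_EFinP.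
under eq_integral do rewrite /= ger0_norm//.
by rewrite integral_Q ltry.
Qed.

Let rint_Q : \int[L]_s Q s = w.
Proof. by rewrite /Rintegral integral_Q. Qed.

Let sum_close (s t : 'rV[R]_d) : close q s 0 -> close q t 0 -> close (2 * q) (s - t) 0.
Proof.
move=> /closeP sq /closeP tq; apply/closeP => i.
have := sq i; have := tq i; rewrite !mxE !subr0 => ti si.
by rewrite (le_trans (ler_normB _ _))// mulr_natl mulr2n lerD.
Qed.

Let box_gram z :
  (\int[L2]_s (Q s.1 * Q s.2 * (1 + cos (dotp (s.1 - s.2) z)))%:E =
   (w ^+ 2 + freq Q z)%:E)%E.
Proof.
rewrite -rint_Q -freq_gram//; apply: eq_integral => s _.
by rewrite dotpC.
Qed.

(** For s in the cube the phase is at most d q (d q)^-1 <= 1 in absolute value, so the cosine is at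
    least [cos 1]; the sine part is dropped. If d = 0 the inverse is 0 and the bound persists. *)
Let freq_box z : close (d%:R * q)^-1 z 0 -> (cos 1 * w) ^+ 2 <= freq Q z.
Proof.
move=> zq; have d0 : d%:R * (q * (d%:R * q)^-1) <= 1 :> R.
  by rewrite mulrA; have [->|nz] := eqVneq (d%:R * q) 0; rewrite ?mul0r// divff.
rewrite (@le_trans _ _ ((\int[L]_s (Q s * cos (dotp z s))) ^+ 2))//; last by rewrite lerDl sqr_ge0.
have ic : L.-integrable setT (EFin \o (fun s => Q s * cos (dotp z s))).
  apply: integrable_unit => // [|s]; last exact: cos_max.
  by apply: measurable_fun_cos; apply: measurable_dotp; [exact: measurable_cst|exact: measurable_id].
have c1 := ltW (cos1_gt0 R).
suff le1 : cos 1 * w <= \int[L]_s (Q s * cos (dotp z s)).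
  by rewrite lerXn2r ?nnegrE// ?mulr_ge0// ?(ltW w0)// (le_trans _ le1)// mulr_ge0// ltW.
rewrite -rint_Q -RintegralZl//; apply: le_Rintegral => //.
  exact: (integrableZl measurableT (cos 1) iQ).
move=> s _; rewrite mulrC /Q; case: (boolP (close q s 0)) => sq; last by rewrite !mul0r.
rewrite !mul1r cos_ge_cos1// dotpC (le_trans (dotp_le sq zq))//.
Qed.

(** To be integrated in both orders: over the frequencies [a.1] first it yields the kernel [freq Q]
    between two points, over the points [a.2] first it yields [freq v] at a difference of two
    frequencies. *)
Let Xi (a : VV * VV) : \bar R :=
  (Q a.1.1 * Q a.1.2 * (v a.2.1 * v a.2.2) * (1 + cos (dotp (a.1.1 - a.1.2) (a.2.1 - a.2.2))))%:E.

Let Xi0 a : (0 <= Xi a)%E.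
Proof. by rewrite lee_fin !mulr_ge0. Qed.

Let mXi : measurable_fun setT Xi.
Proof.
have m11 : measurable_fun [set: VV * VV] (fun q => q.1.1).
  exact: (measurableT_comp measurable_fst measurable_fst).
have m12 : measurable_fun [set: VV * VV] (fun q => q.1.2).
  exact: (measurableT_comp measurable_snd measurable_fst).
have m21 : measurable_fun [set: VV * VV] (fun q => q.2.1).
  exact: (measurableT_comp measurable_fst measurable_snd).
have m22 : measurable_fun [set: VV * VV] (fun q => q.2.2).
  exact: (measurableT_comp measurable_snd measurable_snd).
apply/measurable_EFinP; apply: measurable_funM.
  apply: measurable_funM; apply: measurable_funM.
  - exact: (measurableT_comp mQ).
  - exact: (measurableT_comp mQ).
  - exact: (measurableT_comp mv).
  - exact: (measurableT_comp mv).
apply: measurable_funD => //; apply: measurable_fun_cos; apply: measurable_dotp.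
  exact: measurable_rVB.
exact: measurable_rVB.
Qed.

Let mass : (\int[L2]_p (v p.1 * v p.2)%:E = (M ^+ 2)%:E)%E.
Proof.
pose F (p : VV) := (v p.1 * v p.2)%:E.
have mF : measurable_fun setT F.
  by apply/measurable_EFinP; apply: measurable_funM; apply: (measurableT_comp mv);
    [exact: measurable_fst|exact: measurable_snd].
have F0 p : (0 <= F p)%E by rewrite lee_fin mulr_ge0.
rewrite -[LHS]/(\int[L2]_p F p)%E (fubini_tonelli1 F mF F0) /fubini_F.
transitivity (\int[L]_x (M * v x)%:E)%E.
  apply: eq_integral => x _; rewrite mulrC.
  rewrite -[RHS]/((_ * _)%:E)%E -RintegralZl// EFin_Rintegral//.
  exact: (integrableZl measurableT (v x) iv).
rewrite -EFin_Rintegral//; last exact: (integrableZl measurableT M iv).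
by rewrite RintegralZl// expr2.
Qed.

Let lower : ((w ^+ 2 * M ^+ 2)%:E + ((cos 1 * w) ^+ 2)%:E *
    \int[L2]_p ((close (d%:R * q)^-1 p.1 p.2)%:R * (v p.1 * v p.2))%:E <=
  \int[L2]_p \int[L2]_s Xi (s, p))%E.
Proof.
have mvv : measurable_fun [set: VV] (fun p => v p.1 * v p.2).
  by apply: measurable_funM; apply: (measurableT_comp mv);
    [exact: measurable_fst|exact: measurable_snd].
have mc : measurable_fun [set: VV] (fun p => (close (d%:R * q)^-1 p.1 p.2)%:R * (v p.1 * v p.2)).
  apply: measurable_funM => //; apply: measurable_boolR.
  by apply: measurable_close; [exact: measurable_fst|exact: measurable_snd].
rewrite EFinM -mass -!ge0_integralZl//; last 6 first.
- exact/measurable_EFinP.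
- by move=> p _; rewrite lee_fin !mulr_ge0.
- by rewrite lee_fin sqr_ge0.
- exact/measurable_EFinP.
- by move=> p _; rewrite lee_fin !mulr_ge0.
- by rewrite lee_fin sqr_ge0.
rewrite -ge0_integralD//; last 4 first.
- by move=> p _; rewrite mule_ge0 ?lee_fin ?sqr_ge0 ?mulr_ge0.
- by apply: measurable_funeM; exact/measurable_EFinP.
- by move=> p _; rewrite mule_ge0 ?lee_fin ?sqr_ge0 ?mulr_ge0.
- by apply: measurable_funeM; exact/measurable_EFinP.
apply: ge0_le_integral => //.
- by move=> p _; rewrite adde_ge0// mule_ge0 ?lee_fin ?sqr_ge0 ?mulr_ge0.
- by apply: emeasurable_funD; apply: measurable_funeM; exact/measurable_EFinP.
- exact: (measurable_fun_fubini_tonelli_G (m1 := L2) Xi mXi Xi0).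
move=> p _; rewrite (_ : (\int[L2]_s Xi (s, p) =
    (v p.1 * v p.2)%:E * (w ^+ 2 + freq Q (p.1 - p.2))%:E)%E); last first.
  rewrite -box_gram -ge0_integralZl//; last 3 first.
  - apply/measurable_EFinP; apply: measurable_funM.
      by apply: measurable_funM; apply: (measurableT_comp mQ);
        [exact: measurable_fst|exact: measurable_snd].
    apply: measurable_funD => //; apply: measurable_fun_cos; apply: measurable_dotp => //.
    by apply: measurable_rVB; [exact: measurable_fst|exact: measurable_snd].
  - by move=> s _; rewrite lee_fin !mulr_ge0.
  - by rewrite lee_fin mulr_ge0.
  by apply: eq_integral => s _; rewrite /Xi -EFinM /=; congr EFin; ring.
rewrite -!EFinM lee_fin.
have vv0 : 0 <= v p.1 * v p.2 by rewrite mulr_ge0.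
rewrite mulrDr (mulrC (w ^+ 2)) lerD2l.
have [cp|cp] := boolP (close _ p.1 p.2); last by rewrite mul0r mulr0 mulr_ge0// freq_ge0.
rewrite mul1r mulrC ler_wpM2l// freq_box//.
by rewrite -(close_shift _ _ p.2) subrK.
Qed.

(** For s and t in the cube, s - t lies in the cube of twice the size. With t fixed, s - t ranges
    over part of that cube, and the remaining integral over t contributes one factor [w]. *)
Let upper : (\int[L2]_s \int[L2]_p Xi (s, p) <= (w ^+ 2 * M ^+ 2)%:E +
  w%:E * \int[L]_k ((close (2 * q) k 0)%:R * freq v k)%:E)%E.
Proof.
have mQQ : measurable_fun [set: VV] (fun s => Q s.1 * Q s.2).
  by apply: measurable_funM; apply: (measurableT_comp mQ);
    [exact: measurable_fst|exact: measurable_snd].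
have mfr := measurable_freq iv v0.
pose F (s : VV) := (Q s.1 * Q s.2 * freq v (s.1 - s.2))%:E.
have mF : measurable_fun setT F.
  apply/measurable_EFinP; apply: measurable_funM => //.
  apply: (measurableT_comp mfr).
  by apply: measurable_rVB; [exact: measurable_fst|exact: measurable_snd].
have F0 p : (0 <= F p)%E by rewrite lee_fin !mulr_ge0// freq_ge0.
rewrite (_ : (\int[L2]_s \int[L2]_p Xi (s, p) =
    \int[L2]_s ((M ^+ 2)%:E * (Q s.1 * Q s.2)%:E + F s))%E); last first.
  apply: eq_integral => s _.
  rewrite -!EFinM -EFinD.
  rewrite (_ : _ + _ = Q s.1 * Q s.2 * (M ^+ 2 + freq v (s.1 - s.2))); last by ring.
  rewrite EFinM -(freq_gram iv v0) -ge0_integralZl//; last 3 first.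
  - exact: measurable_pair_cos.
  - by move=> p _; rewrite lee_fin !mulr_ge0.
  - by rewrite lee_fin mulr_ge0.
  by apply: eq_integral => p _; rewrite /Xi /= -EFinM; congr EFin; ring.
rewrite ge0_integralD//; last 2 first.
- by move=> p _; rewrite mule_ge0 ?lee_fin ?sqr_ge0 ?mulr_ge0.
- by apply: measurable_funeM; exact/measurable_EFinP.
rewrite ge0_integralZl//; last 3 first.
- exact/measurable_EFinP.
- by move=> p _; rewrite lee_fin mulr_ge0.
- by rewrite lee_fin sqr_ge0.
have -> : (\int[L2]_s (Q s.1 * Q s.2)%:E = (w ^+ 2)%:E)%E.
  pose F' (p : VV) := (Q p.1 * Q p.2)%:E.
  have mF' : measurable_fun setT F' by exact/measurable_EFinP.
  have F0' p : (0 <= F' p)%E by rewrite lee_fin mulr_ge0.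
  rewrite -[LHS]/(\int[L2]_p F' p)%E (fubini_tonelli1 F' mF' F0') /fubini_F.
  transitivity (\int[L]_s (w%:E * (Q s)%:E))%E.
    apply: eq_integral => s _; rewrite -integral_Q muleC -ge0_integralZl ?lee_fin//; last 2 first.
    - exact/measurable_EFinP.
    - by move=> t _; rewrite lee_fin.
  rewrite ge0_integralZl ?lee_fin ?(ltW w0)// ?integral_Q -?EFinM ?expr2//.
    exact/measurable_EFinP.
  by move=> t _; rewrite lee_fin.
rewrite -EFinM mulrC; apply: leeD => //.
rewrite (fubini_tonelli2 F mF F0) /fubini_G -integral_Q.
set K := (\int[_]_k (_ * _)%:E)%E.
have K0 : (0 <= K)%E by apply: integral_ge0 => k _; rewrite lee_fin mulr_ge0// freq_ge0.
rewrite -ge0_integralZr//; last 2 first.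
- exact/measurable_EFinP.
- by move=> t _; rewrite lee_fin.
apply: ge0_le_integral => //.
- by move=> t _; apply: integral_ge0 => s _.
- exact: (measurable_fun_fubini_tonelli_G (m1 := L) F mF F0).
- apply: emeasurable_funM; [exact/measurable_EFinP|exact: measurable_cst].
move=> t _.
have mK : measurable_fun setT (fun k => ((close (2 * q) k 0)%:R * freq v k)%:E).
  apply/measurable_EFinP; apply: measurable_funM => //.
  by apply: measurable_boolR; exact: measurable_close0.
rewrite /K -(@ge0_integral_rV_translate _ _ (- t) (fun k => ((close (2 * q) k 0)%:R * freq v k)%:E))//; last first.
  by move=> k; rewrite lee_fin mulr_ge0// freq_ge0.
have mKt : measurable_fun setT (fun k => ((close (2 * q) (k - t) 0)%:R * freq v (k - t))%:E).
  exact: (measurableT_comp mK (measurable_rV_add (- t))).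
have Kt0 k : (0 <= ((close (2 * q) (k - t)%R 0)%:R * freq v (k - t)%R)%:E)%E.
  by rewrite lee_fin mulr_ge0// freq_ge0.
have Qt0 : (0 <= (Q t)%:E)%E by rewrite lee_fin.
rewrite -ge0_integralZl//.
apply: ge0_le_integral => //.
- exact: (measurableT_comp mF).
- exact: measurable_funeM.
move=> s _; rewrite /F /= -EFinM lee_fin /Q.
have [sq|sq] := boolP (close q s 0); last by rewrite !mul0r !mulr_ge0// freq_ge0.
have [tq|tq] := boolP (close q t 0); last by rewrite mulr0 !mul0r.
by rewrite sum_close// !mul1r.
Qed.

(* The average of [freq v (s - t)] over s and t in the cube is an integral of v (x) v
   against the nonnegative kernel [freq Q (x - y)], which is bounded below near the
   diagonal. *)
Lemma close_pairs_le_freq :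
  (((cos 1) ^+ 2 * w)%:E *
    \int[L2]_p ((close (d%:R * q)^-1 p.1 p.2)%:R * (v p.1 * v p.2))%:E <=
   \int[L]_k ((close (2 * q) k 0)%:R * freq v k)%:E)%E.
Proof.
have := lower; rewrite -(fubini_tonelli Xi mXi Xi0) => /le_trans/(_ upper).
(* The summand 1 in front of the cosine contributed [w ^+ 2 * M ^+ 2] to both sides, which is finite
   and cancels; so does one factor [w]. *)
rewrite leeD2lE// exprMn expr2 -(expr2 (cos 1)) (mulrA _ w w) (mulrC _ w) EFinM -muleA.
by rewrite lee_pmul2l// lte_fin.
Qed.

End cube.
End frequency.

Section dyadic.
Context {R : realType}.

Lemma geometric_sum_le (b l t c : R) J : 2 <= b -> 0 <= l -> 0 <= t -> 0 <= c ->
  \sum_(j < J) (l * b ^+ j) * (l * b ^+ j * t <= c)%R%:R * t <= 2 * c.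
Proof.
move=> b2 l0 t0 c0; have b0 : 0 <= b by rewrite (le_trans _ b2).
have top n : \sum_(j < n) (l * b ^+ j) * (l * b ^+ j * t <= c)%R%:R * t <= l * b ^+ n * t.
  elim: n => [|n ih]; first by rewrite big_ord0 !mulr_ge0.
  rewrite big_ord_recr/= exprSr.
  have p0 : 0 <= l * b ^+ n * t by rewrite !mulr_ge0// exprn_ge0.
  rewrite (_ : l * (b ^+ n * b) * t = b * (l * b ^+ n * t)); last by ring.
  apply: (@le_trans _ _ (2 * (l * b ^+ n * t))); last exact: ler_wpM2r.
  rewrite mulr_natl mulr2n lerD//.
  by case: (_ <= c); rewrite ?mulr1// mulr0 mul0r.
elim: J => [|J ih]; first by rewrite big_ord0 mulr_ge0.
have [tc|tc] := boolP (l * b ^+ J * t <= c); last first.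
  by rewrite big_ord_recr/= (negbTE tc) mulr0 mul0r addr0.
by rewrite big_ord_recr/= tc mulr1 (le_trans (lerD (top J) (lexx _)))// mulr_natl mulr2n lerD.
Qed.

End dyadic.

Section hdot.
Context {R : realType} {d : nat}.
Local Notation L := (lebesgue_rV d).
Local Notation L2 := (lebesgue_rV2 d).
Implicit Types (k x y z : 'rV[R]_d) (v : 'rV[R]_d -> R).

Lemma dotp_ge0 x : 0 <= dotp x x.
Proof. by apply: sumr_ge0 => i _; rewrite -expr2 sqr_ge0. Qed.

Lemma enorm_ge0 x : 0 <= enorm x.
Proof. exact: sqrtr_ge0. Qed.

Lemma enorm_sqr x : enorm x ^+ 2 = dotp x x.
Proof. by rewrite sqr_sqrtr// dotp_ge0. Qed.

Lemma enorm_gt0 x : x != 0 -> 0 < enorm x.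
Proof.
apply: contraNT; rewrite sqrtr_gt0 -leNgt => x0; apply/eqP/rowP => i; rewrite mxE.
have : dotp x x == 0 by rewrite eq_le x0 dotp_ge0.
rewrite psumr_eq0 => [/allP/(_ i (mem_index_enum _))|j _]; last by rewrite -expr2 sqr_ge0.
by rewrite -expr2 sqrf_eq0 => /eqP.
Qed.

Lemma enorm_le (a : R) x : 0 <= a -> close a x 0 -> enorm x <= d%:R * a.
Proof.
move=> a0 xa; rewrite -(@ler_pXn2r _ 2)// ?nnegrE ?enorm_ge0 ?mulr_ge0// enorm_sqr.
rewrite (le_trans (ler_norm _))// (le_trans (dotp_le xa xa))//.
rewrite exprMn -expr2 ler_wpM2r ?sqr_ge0// -natrX ler_nat.
by case: (d) => // n; rewrite leq_pmull.
Qed.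

Lemma measurable_enorm_inv : measurable_fun setT (fun k => (enorm k)^-1).
Proof.
have m : measurable_fun setT (fun k => dotp k k `^ (- 2^-1)).
  apply: (measurableT_comp (measurable_powR (- 2^-1))).
  exact: measurable_dotp.
apply: eq_measurable_fun m => k _.
by rewrite powRN powR12_sqrt// dotp_ge0.
Qed.

Lemma fourier_freq v k :
  freq v k = (2 * pi) ^+ d * Normc.normc (fourier v k) ^+ 2.
Proof.
rewrite /fourier /Normc.normc sqr_sqrtr ?addr_ge0 ?sqr_ge0//.
rewrite /freq; set A := \int[_]_x _; set B := \int[_]_x (_ * sin _).
rewrite sqrrN (exprMn 2 _ A) (exprMn 2 _ B) -mulrDr mulrA -[LHS]mul1r; congr (_ * _).
have p0 : 0 < 2 * pi :> R by rewrite mulr_gt0// pi_gt0.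
rewrite -[X in _ * X]powR_mulrn ?powR_ge0// -powRrM mulNr divfK// powRN powR_mulrn ?(ltW p0)//.
by rewrite divff// gt_eqF// exprn_gt0.
Qed.

(** [(3 d) ^+ d] comes from the volume of the frequency cube, [(2 pi) ^+ d] from the normalisation
    of the Fourier transform, [cos 1 ^+ 2] from the lower bound on the kernel. *)
Definition C_freq : R := (3 * d%:R * (2 * pi)) ^+ d / cos 1 ^+ 2.

(** Each interaction is an integral of [freq v] over a cube of size ~ 1 / l_j. At a fixed k only the
    l_j below ~ 1 / |k| count, and they grow geometrically, so that their sum is at most 1 / |k|. *)
Lemma sum_close_pairs_le v (l : R) J : (0 < d)%N -> 0 < l ->
  L.-integrable setT (EFin \o v) -> (forall x, 0 <= v x) ->
  (\sum_(j < J) ((l * 2 ^+ j) / (l * 2 ^+ j) ^+ d)%:E *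
     \int[L2]_p ((close (6 * (l * 2 ^+ j)) p.1 p.2)%:R * (v p.1 * v p.2))%:E <=
   C_freq%:E * hdot_mhalf_sq v)%E.
Proof.
move=> d0 l0 iv v0; pose lj (j : 'I_J) := l * 2 ^+ j.
have lj0 j : 0 < lj j by rewrite mulr_gt0// exprn_gt0.
have dR0 : 0 < d%:R :> R by rewrite ltr0n.
pose g (j : 'I_J) k := (close (3 * d%:R * lj j)^-1 k 0)%:R * freq v k.
have mg j : measurable_fun setT (EFin \o g j).
  apply/measurable_EFinP; apply: measurable_funM; last exact: measurable_freq.
  by apply: measurable_boolR; exact: measurable_close0.
have g0 j k : (0 <= (g j k)%:E)%E by rewrite lee_fin mulr_ge0// freq_ge0.
pose B := (3 * d%:R) ^+ d / cos 1 ^+ 2 : R.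
have c0 := cos1_gt0 R.
have B0 : 0 <= B by rewrite divr_ge0 ?sqr_ge0// exprn_ge0// mulr_ge0.
have step j : ((lj j / lj j ^+ d)%:E *
     \int[L2]_p ((close (6 * lj j) p.1 p.2)%:R * (v p.1 * v p.2))%:E <=
     B%:E * \int[L]_k ((lj j)%:E * (g j k)%:E))%E.
  (* This [q] makes the radius (d q)^-1 of [close_pairs_le_freq] equal to 6 l_j. *)
  have q0 : 0 < (6 * d%:R * lj j)^-1 by rewrite invr_gt0 !mulr_gt0.
  have := close_pairs_le_freq iv v0 q0.
  have -> : (d%:R * (6 * d%:R * lj j)^-1)^-1 = 6 * lj j.
    by field; rewrite !gt_eqF.
  have -> : 2 * (6 * d%:R * lj j)^-1 = (3 * d%:R * lj j)^-1.
    by field; rewrite !gt_eqF.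
  move=> H; rewrite ge0_integralZl ?lee_fin ?(ltW (lj0 j))//; last exact: mg.
  have k0 : 0 <= B * lj j by rewrite mulr_ge0// ltW.
  rewrite muleA -EFinM; apply: le_trans (lee_wpmul2l _ H); last by rewrite lee_fin.
  rewrite muleA -EFinM (_ : _ / _ = B * lj j * (cos 1 ^+ 2 * (3 * d%:R * lj j)^-1 ^+ d))//.
  rewrite /B exprVn [(3 * d%:R * lj j) ^+ d]exprMn.
  have : lj j ^+ d != 0 by rewrite expf_neq0// gt_eqF.
  have : (3 * d%:R) ^+ d != 0 :> R by rewrite expf_neq0// gt_eqF// mulr_gt0.
  have : cos 1 != 0 :> R by rewrite gt_eqF.
  move: (lj j ^+ d) ((3 * d%:R) ^+ d : R) (cos 1 : R) (lj j) => Y X c y; clear.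
  by move=> *; field; apply/and3P.
apply: (@le_trans _ _ (\sum_(j < J) B%:E * \int[L]_k ((lj j)%:E * (g j k)%:E))%E).
  by apply: lee_sum => j _; exact: step.
rewrite -ge0_sume_distrr => [|j _]; last first.
  by apply: integral_ge0 => k _; rewrite mule_ge0// lee_fin ltW.
rewrite -ge0_integral_sum//; last 2 first.
- by move=> j; exact: (measurable_funeM _ (mg j)).
- by move=> j k _; rewrite mule_ge0// lee_fin ltW.
have mh : measurable_fun setT (fun k => ((enorm k)^-1 * freq v k)%:E).
  apply/measurable_EFinP; apply: measurable_funM; first exact: measurable_enorm_inv.
  exact: measurable_freq.
have h0 k : (0 <= ((enorm k)^-1 * freq v k)%:E)%E.
  by rewrite lee_fin mulr_ge0 ?freq_ge0// invr_ge0 enorm_ge0.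
apply: (@le_trans _ _ (B%:E * \int[L]_k ((enorm k)^-1 * freq v k)%:E)%E); last first.
  have p0 : 0 < (2 * pi) ^+ d :> R by rewrite exprn_gt0// mulr_gt0// pi_gt0.
  have -> : hdot_mhalf_sq v =
      (((2 * pi) ^- d)%:E * \int[L]_k ((enorm k)^-1 * freq v k)%:E)%E.
    rewrite -ge0_integralZl//; last by rewrite lee_fin invr_ge0 ltW.
    apply: eq_integral => k _; rewrite -EFinM fourier_freq; congr EFin.
    by rewrite [RHS]mulrCA mulKf// gt_eqF.
  rewrite muleA -EFinM (_ : C_freq * _ = B)//.
  by rewrite /C_freq (exprMn d (3 * d%:R)) (mulrAC _ _ (cos 1 ^+ 2)^-1) mulfK// gt_eqF.
apply: lee_wpmul2l; first by rewrite lee_fin.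
apply: ae_ge0_le_integral => //.
- by move=> k _; apply: sume_ge0 => j _; rewrite mule_ge0// lee_fin ltW.
- by apply: emeasurable_sum => j; exact: (measurable_funeM _ (mg j)).
(* At k = 0 the inverse norm is 0 while [freq v] need not vanish; the origin is null since d > 0. *)
have n0 : L.-negligible [set 0 : 'rV[R]_d].
  exists [set y | close 0 y 0]; split; first exact: measurable_close0.
    by rewrite lebesgue_rV_close// mulr0 expr0n eqn0Ngt d0.
  by move=> y /= ->; apply/closeP => i; rewrite subrr normr0.
apply: negligibleS n0 => k /= H; apply: contrapT => /eqP k0; apply: H => _.
under eq_bigr do rewrite -EFinM.
rewrite sumEFin lee_fin.
have t0 := enorm_gt0 k0.
rewrite -(ler_pM2r t0) mulrAC mulVf ?gt_eqF// mul1r mulr_suml.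
have F0 := freq_ge0 v k.
(* The cube of size 1 / (3 d l_j) lies in the ball where l_j |k| <= 1/3, and the geometric sum is
   then at most 2/3. *)
apply: (@le_trans _ _ (\sum_(j < J) (lj j * (lj j * enorm k <= 3^-1)%R%:R * enorm k) * freq v k)).
  apply: ler_sum => j _; rewrite /g.
  have [cj|cj] := boolP (close (3 * d%:R * lj j)^-1 k 0); last first.
    by rewrite mul0r mulr0 mul0r !mulr_ge0// ltW.
  rewrite (_ : lj j * enorm k <= 3^-1); first by rewrite mulr1 mul1r mulrAC.
  have a0 : 0 <= (3 * d%:R * lj j)^-1 by rewrite invr_ge0 !mulr_ge0// ltW.
  have := enorm_le a0 cj; rewrite -(ler_pM2l (lj0 j)) => /le_trans; apply.
  by rewrite le_eqVlt; apply/orP; left; apply/eqP; field; rewrite !gt_eqF.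
rewrite -mulr_suml ler_piMl// (le_trans (geometric_sum_le _ _ (ltW l0) (ltW t0) _))//; lra.
Qed.

End hdot.

(** * Summation over the heights *)

Section level_sum.
Context {R : realType} {d : nat}.
Local Notation L := (lebesgue_rV d).
Local Notation L2 := (lebesgue_rV2 d).
Local Notation V := 'rV[R]_d.
Local Notation VV := ('rV[R]_d * 'rV[R]_d)%type.

Lemma close_enorm (a : R) (x y : V) : enorm (x - y) <= a -> close a x y.
Proof.
move=> h; apply/closeP => i; apply: le_trans h.
rewrite -(@ler_pXn2r _ 2)// ?nnegrE ?enorm_ge0// enorm_sqr real_normK ?num_real//.
rewrite /dotp (bigD1 i)//= !mxE -expr2 lerDl; apply: sumr_ge0 => j _.
by rewrite -expr2 sqr_ge0.
Qed.

Lemma measurable_enorm : measurable_fun setT (fun p : VV => enorm (p.1 - p.2) ^+ 2).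
Proof.
have mB : measurable_fun setT (fun p : VV => p.1 - p.2).
  by apply: measurable_rVB; [exact: measurable_fst|exact: measurable_snd].
by apply: eq_measurable_fun (measurable_dotp mB mB) => p _; rewrite enorm_sqr.
Qed.

Lemma measurable_far (l : R) : measurable [set p : VV | ~~ close l p.1 p.2].
Proof.
rewrite (_ : [set _ | _] = ~` [set p : VV | close l p.1 p.2]).
  apply: measurableC; apply: measurable_close; [exact: measurable_fst|exact: measurable_snd].
by apply/seteqP; split => p /= /negP.
Qed.

(** A pair that is not l 2^j-close has squared Euclidean distance above l^2 4^j, so at each pair the
    weights form a geometric sum stopped at that distance. *)
Lemma sum_far_le (ppi : {measure set VV -> \bar R}) (l : R) J : 0 < l ->
  (\sum_(j < J) (4 ^+ j)%:E * ppi [set p | ~~ close (l * 2 ^+ j) p.1 p.2] <=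
   (2 * l ^- 2)%:E * \int[ppi]_p (enorm (p.1 - p.2) ^+ 2)%:E)%E.
Proof.
move=> l0; have p0 (j : 'I_J) : 0 <= 4 ^+ j :> R by rewrite exprn_ge0.
pose f (j : 'I_J) (p : VV) : R := (~~ close (l * 2 ^+ j) p.1 p.2)%:R.
have mf j : measurable_fun setT (EFin \o f j).
  apply/measurable_EFinP; apply: measurable_boolR; exact: measurable_far.
have f0 j p : (0 <= (f j p)%:E)%E by rewrite lee_fin.
have l2 : 0 <= 2 * l ^- 2 by rewrite mulr_ge0// invr_ge0 exprn_ge0// ltW.
rewrite (eq_bigr (fun j : 'I_J => \int[ppi]_p ((4 ^+ j)%:E * (f j p)%:E)))%E; last first.
  move=> j _; rewrite ge0_integralZl ?lee_fin//; last exact: mf.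
  by rewrite /f integral_boolR//; exact: measurable_far.
rewrite -ge0_integral_sum//; last 2 first.
- by move=> j; exact: (measurable_funeM _ (mf j)).
- by move=> j p _; rewrite mule_ge0// lee_fin.
have me : measurable_fun setT (fun p : VV => (enorm (p.1 - p.2) ^+ 2)%:E).
  by apply/measurable_EFinP; exact: measurable_enorm.
rewrite -ge0_integralZl//; last by move=> p _; rewrite lee_fin sqr_ge0.
apply: ge0_le_integral => //.
- by move=> p _; apply: sume_ge0 => j _; rewrite mule_ge0// lee_fin.
- by apply: emeasurable_sum => j; exact: (measurable_funeM _ (mf j)).
- exact: measurable_funeM.
move=> p _; under eq_bigr do rewrite -EFinM.
rewrite sumEFin -EFinM lee_fin.
set t := enorm (p.1 - p.2) ^+ 2.
have t0 : 0 <= t by rewrite sqr_ge0.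
rewrite mulrAC ler_pdivlMr ?exprn_gt0// mulr_suml.
have b4 : (2 : R) <= 4 by rewrite ler_nat.
apply: le_trans (geometric_sum_le J b4 (sqr_ge0 l) ler01 t0).
apply: ler_sum => j _; rewrite /f !mulr1 mulrAC (mulrC _ (l ^+ 2)).
have q0 : 0 <= l ^+ 2 * 4 ^+ j by rewrite mulr_ge0 ?sqr_ge0.
apply: ler_wpM2l => //.
case: (boolP (close _ _ _)) => // /negP nc; rewrite (_ : _ <= t)//.
rewrite leNgt; apply/negP => ht; apply: nc; apply: close_enorm.
rewrite -(@ler_pXn2r _ 2)// ?nnegrE ?enorm_ge0 ?mulr_ge0 ?exprn_ge0 ?(ltW l0)//.
by rewrite exprMn -exprM mulnC exprM (_ : 2 ^+ 2 = 4) ?(ltW ht)// -natrX.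
Qed.

(** The three summands come from the bad points, the transport cost and the interactions. *)
Definition C_level : R :=
  2 * d%:R + 8 * 2 ^+ d + 8 * 3 ^+ d * (@C_freq R d).

(** On the left, 4^j over the mass m_j carried by a cube around a good point; on the right, a
    multiple of l_j^(1-d), the weight in [sum_close_pairs_le]. The exponent [3 * d + 1] makes the
    powers of 2^j agree. *)
Lemma mass_ratio (mu0 r0 : R) (j : nat) : mu0 != 0 -> r0 != 0 ->
  4 ^+ j / (mu0 * (2 ^+ (3 * d + 1)) ^+ j * ((2 * (r0 / 4 ^+ j)) ^+ d / 2)) =
  2 / 2 ^+ d * (mu0 * r0)^-1 * (r0 * 2 ^+ j / (r0 * 2 ^+ j) ^+ d).
Proof.
move=> m0 r0'.
have four : (4 : R) = 2 ^+ 2 by rewrite -natrX.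
have -> : 4 ^+ j = (2 ^+ j) ^+ 2 :> R by rewrite four -!exprM mulnC.
have -> : (2 ^+ (3 * d + 1)) ^+ j = ((2 ^+ j) ^+ d) ^+ 3 * 2 ^+ j :> R.
  by rewrite -!exprM -exprD; congr (2 ^+ _); ring.
rewrite !(exprMn d) exprVn -[((2 ^+ j) ^+ 2) ^+ d]exprM (mulnC 2) exprM.
have : 2 ^+ j != 0 :> R by rewrite expf_neq0.
have : (2 ^+ j) ^+ d != 0 :> R by rewrite !expf_neq0.
have : 2 ^+ d != 0 :> R by rewrite expf_neq0.
have : r0 ^+ d != 0 by rewrite expf_neq0.
move: (r0 ^+ d) (2 ^+ d : R) ((2 ^+ j) ^+ d : R) (2 ^+ j : R) => E D P p E0 D0 P0 p0.
by field; rewrite m0 r0' E0 D0 P0 p0.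
Qed.

Lemma C_freq_ge0 : 0 <= @C_freq R d.
Proof. by rewrite divr_ge0 ?sqr_ge0// exprn_ge0// !mulr_ge0// pi_ge0. Qed.

Lemma C_level_gt0 : (0 < d)%N -> 0 < C_level.
Proof.
move=> d0; rewrite /C_level -addrA ltr_wpDr ?mulr_gt0 ?ltr0n// addr_ge0// mulr_ge0 ?exprn_ge0//.
exact: C_freq_ge0.
Qed.

Variables (u v : V -> R) (ppi : {finite_measure set VV -> \bar R}) (BV mu0 r0 : R).
Hypotheses (d0 : (0 < d)%N) (iu : L.-integrable setT (EFin \o u)) (u0 : forall x, 0 <= u x)
  (uV : (gradient_variation u <= BV%:E)%E)
  (iv : L.-integrable setT (EFin \o v)) (v0 : forall x, 0 <= v x)
  (cuv : couplings u v ppi) (mu0_gt0 : 0 < mu0) (r0_gt0 : 0 < r0).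

Definition height (j : nat) : R := mu0 * (2 ^+ (3 * d + 1)) ^+ j.

Lemma height_gt0 j : 0 < height j.
Proof. by rewrite mulr_gt0// !exprn_gt0. Qed.

Lemma height_gap j : 2 * height j <= height j.+1.
Proof.
rewrite /height exprS mulrCA ler_pM2l// ler_wpM2r// ?exprn_ge0//.
by rewrite addn1 exprS ler_peMr// exprn_ege1// ler1n.
Qed.

Let mu' : measurable_fun setT u.
Proof. by apply/measurable_EFinP; exact: measurable_int iu. Qed.

Let mv : measurable_fun setT v.
Proof. by apply/measurable_EFinP; exact: measurable_int iv. Qed.

Let r j : R := r0 / 4 ^+ j.
Let l j : R := r0 * 2 ^+ j.

Let r_gt0 j : 0 < r j. Proof. by rewrite divr_gt0// exprn_gt0. Qed.
Let l_gt0 j : 0 < l j. Proof. by rewrite mulr_gt0// exprn_gt0. Qed.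

Let rl j : r j <= l j.
Proof.
rewrite ler_pM2l// (@le_trans _ _ 1)//; last by rewrite exprn_ege1// ler1n.
by rewrite invf_le1 ?exprn_gt0// exprn_ege1// ler1n.
Qed.

Let isbad j := bad u (height j) (height j.+1) (r j).
Let isgood j := good u (height j) (height j.+1) (r j).

Let gap j : height j < height j.+1.
Proof. by have := height_gap j; have := height_gt0 j; lra. Qed.

Let mbad j : measurable [set x | isbad j x].
Proof. exact: measurable_bad. Qed.

Let mgood j : measurable [set x | isgood j x].
Proof. exact: measurable_good. Qed.

(** [4 ^+ j] cancels the denominator of [r j], and the gap between consecutive heights is at least
    [height j]. *)
Let bad_part (W : R) j : 0 <= W ->
  (forall z, close (r j) z 0 ->
     incr (fun x => clamp (height j) (height j.+1) (u x)) z <= (W * r j)%:E)%E ->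
  ((4 ^+ j * height j)%:E * L [set x | isbad j x] <= (2 * r0 * W)%:E)%E.
Proof.
move=> W0 HW; have p0 : 0 <= 4 ^+ j :> R by rewrite exprn_ge0.
have := measure_bad_le mu' (gap j) (r_gt0 j) W0 HW.
move=> /(lee_wpmul2l (_ : 0 <= (4 ^+ j)%:E)%E) -/(_ p0); rewrite muleA -!EFinM.
rewrite (_ : 4 ^+ j * (2 * W * r j) = 2 * r0 * W); last first.
  by rewrite /r; field; rewrite expf_neq0.
apply: le_trans; apply: lee_wpmul2r => //; rewrite lee_fin ler_wpM2l//.
by have := height_gap j; lra.
Qed.

Let far j := ppi [set p | ~~ close (l j) p.1 p.2].
Let pairs j := (\int[L2]_p ((close (6 * l j) p.1 p.2)%:R * (v p.1 * v p.2))%:E)%E.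

(** [transport_le] multiplied by 4^j / m_j, together with [u > height j] at good points. *)
Let good_part j :
  ((4 ^+ j * height j)%:E * L [set x | isgood j x] <=
   (4 * 2 ^+ d)%:E * ((4 ^+ j)%:E * far j) +
   (8 * 3 ^+ d * (mu0 * r0)^-1)%:E * ((l j / l j ^+ d)%:E * pairs j))%E.
Proof.
have p0 : 0 < 4 ^+ j :> R by rewrite exprn_gt0.
pose m := height j * ((2 * r j) ^+ d / 2).
have m0 : 0 < m by rewrite mulr_gt0 ?height_gt0// divr_gt0// exprn_gt0// mulr_gt0.
have Gmass x : isgood j x -> (m%:E <= \int[L]_y ((close (r j) y x)%:R * u y)%:E)%E.
  by move=> gx; apply: (good_mass_ge mu' (r_gt0 j) _ u0 gx); rewrite ltW// height_gt0.
have := transport_le iu u0 mv v0 cuv (mgood j) (r_gt0 j) (rl j) (ltW m0) Gmass.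
have k0 : 0 <= 4 ^+ j / m by rewrite divr_ge0// ltW.
move=> /(lee_wpmul2l (_ : 0 <= (4 ^+ j / m)%:E)%E) -/(_ k0).
rewrite muleA -EFinM divfK ?gt_eqF//.
have far0 : (0 <= far j)%E by exact: measure_ge0.
have pairs0 : (0 <= pairs j)%E by apply: integral_ge0 => p _; rewrite lee_fin !mulr_ge0.
have d30 : 0 <= 4 * 3 ^+ d :> R by rewrite mulr_ge0// exprn_ge0.
have d20 : 0 <= 2 * 2 ^+ d * m :> R by rewrite mulr_ge0 ?(ltW m0)// mulr_ge0// exprn_ge0.
rewrite -/(far j) -/(pairs j).
have far1 : (0 <= (2 * 2 ^+ d * m)%:E * far j)%E by rewrite mule_ge0.
have pairs1 : (0 <= (4 * 3 ^+ d)%:E * pairs j)%E by rewrite mule_ge0.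
rewrite (ge0_muleDr _ far1 pairs1) !muleA -!EFinM.
have -> : 4 ^+ j / m * (2 * 2 ^+ d * m) = 2 * 2 ^+ d * 4 ^+ j.
  by field; rewrite gt_eqF.
have -> : 4 ^+ j / m * (4 * 3 ^+ d) =
    8 * 3 ^+ d / 2 ^+ d * (mu0 * r0)^-1 * (l j / l j ^+ d).
  by rewrite mass_ratio ?gt_eqF// /l; ring.
have h0 := ltW (height_gt0 j).
move=> H; apply: (@le_trans _ _ ((4 ^+ j)%:E * \int[L]_x ((isgood j x)%:R * u x)%:E)%E).
  rewrite EFinM -muleA; apply: lee_wpmul2l; first by rewrite lee_fin ltW.
  rewrite -(integral_boolR L (mgood j)) -ge0_integralZl ?lee_fin//; last first.
    by apply/measurable_EFinP; exact: measurable_boolR.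
  apply: ge0_le_integral => //.
  - by move=> x _; rewrite mule_ge0 ?lee_fin.
  - apply: measurable_funeM; apply/measurable_EFinP; exact: measurable_boolR.
  - by apply/measurable_EFinP; apply: measurable_funM => //; exact: measurable_boolR.
  move=> x _; rewrite -EFinM lee_fin; case: (boolP (isgood j x)) => gx; last by rewrite mulr0 mul0r.
  by rewrite mulr1 mul1r; move: gx => /andP[/ltW/(le_trans (ltW (gap j)))].
(* Constants are rounded up: 2 becomes 4, and division by [2 ^+ d] is dropped. *)
apply: le_trans H _; apply: leeD; apply: lee_wpmul2r => //; rewrite lee_fin.
  by rewrite ler_wpM2r ?(ltW p0)// ler_wpM2r ?exprn_ge0// ler_nat.
have q0 : 0 <= (mu0 * r0)^-1 * (l j / l j ^+ d).
  by rewrite !mulr_ge0 ?invr_ge0 ?mulr_ge0 ?exprn_ge0// ?ltW// ?exprn_gt0.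
rewrite -[X in X <= _]mulrA -[X in _ <= X]mulrA; apply: ler_wpM2r => //.
have c2 : 0 <= 8 * 3 ^+ d :> R by rewrite mulr_ge0// exprn_ge0.
by rewrite ler_piMr// invf_le1 ?exprn_gt0// exprn_ege1// ler1n.
Qed.

Lemma level_sum_le J :
  (\sum_(j < J) (4 ^+ j * height j)%:E * L [set x | (height j.+1 < u x)%R] <=
   C_level%:E * ((r0 * BV)%:E +
     ((r0 ^- 2)%:E * \int[ppi]_p (enorm (p.1 - p.2) ^+ 2)%:E +
      ((mu0 * r0)^-1)%:E * hdot_mhalf_sq v)))%E.
Proof.
have hmono j : height j <= height j.+1 by exact: ltW.
have [W [W0 HW sumW]] := bv_levels J iu uV hmono.
have far0 j : (0 <= far j)%E by exact: measure_ge0.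
have pairs0 j : (0 <= pairs j)%E by apply: integral_ge0 => p _; rewrite lee_fin !mulr_ge0.
have lE j : 0 <= l j / l j ^+ d by rewrite divr_ge0 ?exprn_ge0 ?(ltW (l_gt0 j)).
have E0 : (0 <= \int[ppi]_p (enorm (p.1 - p.2)%R ^+ 2)%:E)%E.
  by apply: integral_ge0 => p _; rewrite lee_fin sqr_ge0.
have H0 : (0 <= hdot_mhalf_sq v)%E.
  by apply: integral_ge0 => k _; rewrite lee_fin mulr_ge0 ?sqr_ge0// invr_ge0 enorm_ge0.
have mr0 : 0 <= (mu0 * r0)^-1 by rewrite invr_ge0 mulr_ge0// ltW.
have r2 : 0 <= r0 ^- 2 by rewrite invr_ge0 exprn_ge0// ltW.
have V0 : 0 <= BV.
  have : 0 <= d%:R * BV by apply: le_trans sumW; apply: sumr_ge0.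
  by rewrite pmulr_rge0// ltr0n.
apply: (@le_trans _ _ (\sum_(j < J) ((2 * r0 * W j)%:E +
   ((4 * 2 ^+ d)%:E * ((4 ^+ j)%:E * far j) +
   (8 * 3 ^+ d * (mu0 * r0)^-1)%:E * ((l j / l j ^+ d)%:E * pairs j))))%E).
  apply: lee_sum => j _.
  have p0 : 0 <= 4 ^+ j * height j by rewrite mulr_ge0 ?exprn_ge0// ltW// height_gt0.
  apply: (@le_trans _ _ ((4 ^+ j * height j)%:E * (L [set x | isbad j x] + L [set x | isgood j x]))%E).
    apply: lee_wpmul2l => //.
    apply: le_trans (measureU2 L (mbad j) (mgood j)); apply: le_measure; rewrite ?inE.
    - exact: measurable_fun_lt_cst.
    - exact: measurableU.
    - by move=> x /=; rewrite (bad_or_good u (height j) _ (r j)) => /orP[]; [left|right].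
  rewrite ge0_muleDr//; apply: leeD; last exact: good_part.
  by apply: bad_part => // z; apply: HW => //; exact: ltW.
rewrite !big_split/= sumEFin -!ge0_sume_distrr; last 2 first.
- by move=> j _; rewrite mule_ge0// lee_fin lE.
- by move=> j _; rewrite mule_ge0// lee_fin exprn_ge0.
have c1 : 0 <= 4 * 2 ^+ d :> R by rewrite mulr_ge0// exprn_ge0.
have c2 : 0 <= 8 * 3 ^+ d :> R by rewrite mulr_ge0// exprn_ge0.
have cf := C_freq_ge0.
have c3 : 0 <= 8 * 3 ^+ d * @C_freq R d by rewrite mulr_ge0.
have c4 : 0 <= 8 * 2 ^+ d :> R by rewrite mulr_ge0// exprn_ge0.
have c5 : 0 <= 2 * d%:R :> R by rewrite mulr_ge0.
have C1 : 2 * d%:R <= C_level by rewrite /C_level -addrA lerDl addr_ge0.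
have C2 : 8 * 2 ^+ d <= C_level by rewrite /C_level addrAC lerDr addr_ge0.
have C3 : 8 * 3 ^+ d * @C_freq R d <= C_level by rewrite /C_level lerDr addr_ge0.
have rV0 : (0 <= (r0 * BV)%:E)%E by rewrite lee_fin mulr_ge0// ltW.
have rE0 : (0 <= (r0 ^- 2)%:E * \int[ppi]_p (enorm (p.1 - p.2)%R ^+ 2)%:E)%E by rewrite mule_ge0.
have rH0 : (0 <= ((mu0 * r0)^-1)%:E * hdot_mhalf_sq v)%E by rewrite mule_ge0.
rewrite ge0_muleDr ?adde_ge0// ge0_muleDr//; apply: leeD; [|apply: leeD].
- apply: (@le_trans _ _ ((2 * d%:R)%:E * (r0 * BV)%:E)%E); last exact: lee_wpmul2r.
  rewrite -EFinM lee_fin -mulr_sumr (_ : 2 * d%:R * (r0 * BV) = 2 * r0 * (d%:R * BV)); last by ring.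
  by rewrite ler_wpM2l// mulr_ge0// ltW.
- apply: (@le_trans _ _ ((8 * 2 ^+ d)%:E * ((r0 ^- 2)%:E * \int[ppi]_p (enorm (p.1 - p.2)%R ^+ 2)%:E))%E);
    last exact: lee_wpmul2r.
  have := sum_far_le ppi J r0_gt0 =>
     /(lee_wpmul2l (_ : 0 <= (4 * 2 ^+ d)%:E)%E) -/(_ c1) /le_trans; apply.
  rewrite !muleA -!EFinM (_ : 4 * 2 ^+ d * (2 * r0 ^- 2) = 8 * 2 ^+ d * r0 ^- 2)//; ring.
- apply: (@le_trans _ _ ((8 * 3 ^+ d * @C_freq R d)%:E * (((mu0 * r0)^-1)%:E * hdot_mhalf_sq v))%E);
    last exact: lee_wpmul2r.
  have c6 : 0 <= 8 * 3 ^+ d * (mu0 * r0)^-1 by rewrite mulr_ge0.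
  have := sum_close_pairs_le J d0 r0_gt0 iv v0 =>
    /(lee_wpmul2l (_ : 0 <= (8 * 3 ^+ d * (mu0 * r0)^-1)%:E)%E) -/(_ c6) /le_trans; apply.
  rewrite !muleA -!EFinM mulrAC//.
Qed.

End level_sum.

(** * Scaling and conclusion *)

Section near_minimizers.
Context {R : realType} {d : nat}.
Local Notation L := (lebesgue_rV d).
Local Notation VV := ('rV[R]_d * 'rV[R]_d)%type.
Implicit Types u v : 'rV[R]_d -> R.

Lemma hdot_ge0 v : (0 <= hdot_mhalf_sq v)%E.
Proof.
by apply: integral_ge0 => k _; rewrite lee_fin mulr_ge0 ?sqr_ge0// invr_ge0 enorm_ge0.
Qed.

Lemma wasserstein_ge0 u v : (0 <= wasserstein2_sq u v)%E.
Proof.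
by apply: le_ereal_inf_tmp => _ [ppi _ <-]; apply: integral_ge0 => p _; rewrite lee_fin sqr_ge0.
Qed.

Lemma sup_inf_ge0 u : (0 <= sup_inf u)%E.
Proof.
apply: le_trans (ereal_sup_ubound _); last first.
  by exists 1; [exact: ltr01|reflexivity].
by apply: le_ereal_inf_tmp => _ [v _ <-]; exact: poweR_ge0.
Qed.

(** The strict inequality leaves room to choose first a near-optimal [v] and then a near-optimal
    plan, while the cube root is undone by monotonicity. *)
Lemma sup_inf_attained u (S nu : R) : 0 < S -> 0 < nu -> (sup_inf u < S%:E)%E ->
  exists v (ppi : {measure set VV -> \bar R}), [/\ admissible u v, couplings u v ppi &
    ((nu `^ (2 / (d + 1)%:R))%:E * \int[ppi]_z (enorm (z.1 - z.2) ^+ 2)%:E +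
     (nu `^ (- ((d - 1)%:R / (d + 1)%:R)))%:E * hdot_mhalf_sq v < (S ^+ 3)%:E)%E].
Proof.
move=> S0 nu0 hS.
set a := nu `^ _; set b := nu `^ _.
have a0 : 0 < a by exact: powR_gt0.
have b0 : 0 < b by exact: powR_gt0.
have h : (ereal_inf [set ((a%:E * wasserstein2_sq u v + b%:E * hdot_mhalf_sq v) `^ (3^-1))%E
    | v in admissible u] < S%:E)%E.
  by apply: le_lt_trans hS; apply: ereal_sup_ubound; exists nu.
have [_ [v av <-] hy] := ereal_inf_lt h.
have W0 := wasserstein_ge0 u v; have H0 := hdot_ge0 v.
have aW0 : (0 <= a%:E * wasserstein2_sq u v)%E by rewrite mule_ge0// lee_fin ltW.
have bH0 : (0 <= b%:E * hdot_mhalf_sq v)%E by rewrite mule_ge0// lee_fin ltW.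
have E3 : (a%:E * wasserstein2_sq u v + b%:E * hdot_mhalf_sq v < (S ^+ 3)%:E)%E.
  rewrite ltNge; apply/negP => h3; move: hy; rewrite ltNge => /negP; apply.
  have -> : S%:E = ((S ^+ 3)%:E `^ 3^-1)%E.
    by rewrite poweR_EFin -powR_mulrn ?ltW// -powRrM divff// powRr1// ltW.
  by apply: gt0_ler_poweR => //; rewrite in_itv/= leey andbT ?adde_ge0// lee_fin exprn_ge0// ltW.
(* Finiteness lets this term be subtracted, which turns the bound into a strict one on the
   Wasserstein infimum alone. *)
have Hfin : hdot_mhalf_sq v \is a fin_num.
  rewrite ge0_fin_numE// ltNge leye_eq; apply/negP => /eqP Hoo.
  move: E3; rewrite Hoo gt0_muley ?lte_fin// addey; first by rewrite ltNge leey.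
  by rewrite gt_eqF// (lt_le_trans _ aW0)// ltNyr.
move: E3; rewrite -(fineK Hfin); set x := fine _ => E3.
have : (wasserstein2_sq u v < ((S ^+ 3 - b * x) / a)%:E)%E.
  rewrite -(@lte_pmul2l _ a%:E)// -EFinM mulrCA divff ?gt_eqF// mulr1 EFinB.
  by rewrite lteBrDr.
move=> /ereal_inf_lt[_ [ppi cp <-] hW]; exists v, ppi; split => //.
rewrite -(fineK Hfin) -/x -EFinM -lteBrDr// -EFinB.
have -> : S ^+ 3 - b * x = a * ((S ^+ 3 - b * x) / a) by rewrite mulrCA divff ?gt_eqF// mulr1.
by rewrite EFinM lte_pmul2l// lte_fin.
Qed.

End near_minimizers.

Section finite_of.
Context {R : realType} {d0 : measure_display} {T : measurableType d0}.
Variables (m : {measure set T -> \bar R}) (moo : fin_num_fun m).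

(** The proof of finiteness is an argument so that the finite-measure structure declared on this
    copy of [m] can refer to it. *)
Definition finite_of (_ : fin_num_fun m) : set T -> \bar R := m.

HB.instance Definition _ := Measure.on (finite_of moo).
HB.instance Definition _ := @Measure_isFinite.Build _ _ _ (finite_of moo) moo.

Definition finite_measure_of : {finite_measure set T -> \bar R} := finite_of moo.

End finite_of.

Lemma coupling_finite (R : realType) (d : nat) (u v : 'rV[R]_d -> R)
    (ppi : {measure set ('rV[R]_d * 'rV[R]_d)%type -> \bar R}) :
  (lebesgue_rV d).-integrable setT (EFin \o u) -> (forall x, 0 <= u x) ->
  couplings u v ppi -> fin_num_fun ppi.
Proof.
move=> iu u0 cp; apply: lty_fin_num_fun.
have -> : [set: 'rV[R]_d * 'rV[R]_d] = [set: 'rV[R]_d] `*` setT by rewrite setXTT.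
rewrite (cp setT measurableT).1.
have /integrableP[_] := iu; congr (_ < _)%E.
by apply: eq_integral => x _; rewrite /= ger0_norm.
Qed.

(** * Exponents of the scaling *)

Section scaling.
Context {R : realType}.

(** The two exponents of nu differ by 1. Hence the functional is a multiple of W_2^2 + H / nu, H the
    squared Sobolev norm, and so is r0^-2 W_2^2 + (mu0 r0)^-1 H when nu = mu0 / r0. *)
Lemma powR_ratio (d : nat) (nu : R) : (0 < d)%N -> 0 < nu ->
  nu `^ (- ((d - 1)%:R / (d + 1)%:R)) = nu `^ (2 / (d + 1)%:R) / nu.
Proof.
move=> d0 nu0; rewrite -[X in _ = _ / X](powRr1 (ltW nu0)).
rewrite -powRB ?(gt_eqF nu0) ?implybT//; congr (_ `^ _).
rewrite natrB// natrD; field.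
by rewrite natr1 pnatr_eq0.
Qed.

(** Used with b = 8^n, since nu = mu0 / r0 = (a 8^(n(d+1)))^-1. *)
Lemma powR_scale (d : nat) (a b : R) : 0 < a -> 0 < b ->
  (a * b ^+ (d + 1))^-1 `^ (2 / (d + 1)%:R) = (a `^ (2 / (d + 1)%:R) * b ^+ 2)^-1.
Proof.
move=> a0 b0; have p0 : 0 < a * b ^+ (d + 1) by rewrite mulr_gt0// exprn_gt0.
rewrite -(powR_inv1 (ltW p0)) -powRrM mulN1r powRN; congr (_^-1).
rewrite powRM ?exprn_ge0 ?ltW//; congr (_ * _).
rewrite -!powR_mulrn ?(ltW b0)// -powRrM mulrCA divff ?mulr1// pnatr_eq0 addn1.
Qed.

Lemma powR_exponent (d : nat) (a : R) : 0 < a ->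
  a ^- 2 * a `^ (2 / (d + 1)%:R) = a `^ (- ((2 * d)%:R / (d + 1)%:R)).
Proof.
move=> a0; rewrite -(powR_mulrn 2 (ltW a0)) -powRN.
rewrite -powRD ?(gt_eqF a0) ?implybT//; congr (_ `^ _).
rewrite natrM natrD; field.
by rewrite natr1 pnatr_eq0.
Qed.

End scaling.

Section rescaled.
Context {R : realType} {d : nat}.
Local Notation L := (lebesgue_rV d).
Local Notation base := (2 ^+ (3 * d + 1) : R).
Variables (u : 'rV[R]_d -> R) (BV S a : R).
Hypotheses (d0 : (0 < d)%N) (iu : L.-integrable setT (EFin \o u)) (u0 : forall x, 0 <= u x)
  (uV : (gradient_variation u <= BV%:E)%E) (S0 : 0 < S) (uS : (sup_inf u < S%:E)%E)
  (a0 : 0 < a).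

Definition budget : R :=
  @C_level R d * (a * BV + a `^ (- ((2 * d)%:R / (d + 1)%:R)) * S ^+ 3).

(** With these mu0 and r0 both terms of the bound grow like 4^n, the factor by which the weights are
    divided, so that [budget] is independent of [n] and [J]. *)
Lemma level_sum_rescaled n J :
  (\sum_(j < J) (4 ^+ j / 4 ^+ n * height (d := d) (base ^- n) j)%:E *
     L [set x | (height (d := d) (base ^- n) j.+1 < u x)%R] <= budget%:E)%E.
Proof.
pose r0 := a * 4 ^+ n; pose mu0 := base ^- n; pose nu := mu0 / r0.
have p4 : 0 < 4 ^+ n :> R by rewrite exprn_gt0.
have r00 : 0 < r0 by rewrite mulr_gt0.
have mu00 : 0 < mu0 by rewrite invr_gt0 !exprn_gt0.
have nu0 : 0 < nu by rewrite divr_gt0.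
have [v [ppi [[mv v0 massv] cp hlt]]] := sup_inf_attained S0 nu0 uS.
have iv : L.-integrable setT (EFin \o v).
  apply/integrableP; split; first exact/measurable_EFinP.
  have /integrableP[_] := iu; congr (_ < _)%E.
  transitivity (\int[L]_x (u x)%:E)%E.
    by apply: eq_integral => x _; rewrite /= ger0_norm.
  by rewrite -massv; apply: eq_integral => x _; rewrite /= ger0_norm.
have cp' : couplings u v (finite_measure_of (coupling_finite iu u0 cp)) by exact: cp.
have := level_sum_le d0 iu u0 uV iv v0 cp' mu00 r00 J.
rewrite [X in ((r0 ^- 2)%:E * X)%E](_ : _ = \int[ppi]_p (enorm (p.1 - p.2) ^+ 2)%:E)%E//.
set W := (\int[_]_p _)%E; set H := hdot_mhalf_sq v => main.
have W0 : (0 <= W)%E by apply: integral_ge0 => p _; rewrite lee_fin sqr_ge0.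
have H0 : (0 <= H)%E by exact: hdot_ge0.
pose al := nu `^ (2 / (d + 1)%:R).
have al0 : 0 < al by exact: powR_gt0.
pose k := r0 ^- 2 / al.
have k0 : 0 <= k by rewrite divr_ge0 ?invr_ge0 ?exprn_ge0 ?ltW.
have C0 := ltW (@C_level_gt0 R _ d0).
have four : (4 : R) = 2 ^+ 2 by rewrite -natrX.
have eight : (8 : R) = 2 ^+ 3 by rewrite -natrX.
have alE : al = (a `^ (2 / (d + 1)%:R) * (8 ^+ n) ^+ 2)^-1.
  rewrite -powR_scale ?exprn_gt0//; congr (_ `^ _); rewrite /nu /mu0 /r0 -invfM; congr (_^-1).
  rewrite four eight -!exprM mulrCA -exprD; congr (a * 2 ^+ _); ring.
have kE : k = a `^ (- ((2 * d)%:R / (d + 1)%:R)) * 4 ^+ n.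
  rewrite /k alE invrK -powR_exponent// /r0.
  have -> : (8 ^+ n) ^+ 2 = (4 ^+ n) ^+ 3 :> R.
    by rewrite four eight -!exprM; congr (2 ^+ _); ring.
  by field; rewrite !gt_eqF.
have E1 : ((r0 ^- 2)%:E * W + ((mu0 * r0)^-1)%:E * H <= (k * S ^+ 3)%:E)%E.
  apply: (@le_trans _ _ (k%:E * (al%:E * W + (al / nu)%:E * H))%E); last first.
    rewrite [leRHS]EFinM; apply: lee_wpmul2l; first by rewrite lee_fin.
    by move: hlt; rewrite powR_ratio// => /ltW.
  have aW0 : (0 <= al%:E * W)%E by rewrite mule_ge0// lee_fin ltW.
  have aH0 : (0 <= (al / nu)%:E * H)%E by rewrite mule_ge0// lee_fin divr_ge0 ?ltW.
  rewrite (ge0_muleDr _ aW0 aH0) !muleA -!EFinM.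
  rewrite /k divfK ?gt_eqF// (_ : r0 ^- 2 / al * (al / nu) = (mu0 * r0)^-1)//.
  by rewrite /nu; field; rewrite !gt_eqF.
have H1 := le_trans main (lee_wpmul2l (_ : 0 <= (@C_level R d)%:E)%E (leeD (lexx _) E1)).
have {H1} := H1 C0.
have n0 : (0 <= ((4 ^+ n)^-1 : R)%:E)%E by rewrite lee_fin invr_ge0 ltW.
move=> /(lee_wpmul2l n0); rewrite -EFinD -!EFinM.
have -> : (4 ^+ n)^-1 * (@C_level R d * (r0 * BV + k * S ^+ 3)) = budget.
  by rewrite /budget kE /r0; field; rewrite gt_eqF.
apply: le_trans; rewrite ge0_sume_distrr; last first.
  move=> j _; rewrite mule_ge0// lee_fin mulr_ge0 ?exprn_ge0//.
  by rewrite ltW// height_gt0.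
by apply: lee_sum => j _; rewrite (mulrC (4 ^+ j)) -mulrA EFinM -muleA.
Qed.

End rescaled.

(** * Layers and the power p *)

Section layers.
Context {R : realType} {d : nat}.
Local Notation base := (2 ^+ (3 * d + 1) : R).
Local Notation p := ((3 * d + 3)%:R / (3 * d + 1)%:R : R).
Local Notation h n j := (height (d := d) (base ^- n) j).

Let base_gt0 : 0 < base. Proof. exact: exprn_gt0. Qed.

Let base_ge2 : 2 <= base.
Proof. by rewrite addn1 exprS ler_peMr// exprn_ege1// ler1n. Qed.

Let h_gt0 n j : 0 < h n j.
Proof. by rewrite height_gt0// invr_gt0 exprn_gt0. Qed.

Lemma base_powR m : (base ^+ m) `^ p = 4 ^+ m * base ^+ m.
Proof.
have d1 : (3 * d + 1)%:R != 0 :> R by rewrite pnatr_eq0 addn1.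
rewrite -exprM -[X in X `^ _]powR_mulrn// -powRrM natrM.
rewrite (_ : _ * _ = ((3 * d + 3) * m)%:R); last by rewrite natrM; field.
rewrite powR_mulrn// (_ : (4 : R) = 2 ^+ 2); last by rewrite -natrX.
rewrite -exprM -exprD; congr (2 ^+ _); ring.
Qed.

Lemma height_powR n j : (h n j) `^ p = 4 ^+ j / 4 ^+ n * h n j.
Proof.
have bn : 0 < base ^+ n by rewrite exprn_gt0.
rewrite /height powRM ?invr_ge0 ?exprn_ge0 ?ltW// base_powR.
rewrite -(powR_inv1 (ltW bn)) -powRrM mulN1r powRN base_powR (powR_inv1 (ltW bn)).
by rewrite invfM; ring.
Qed.

Lemma height_powR2 n j : (h n j.+2) `^ p = 16 * base ^+ 2 * (4 ^+ j / 4 ^+ n * h n j).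
Proof.
rewrite height_powR /height !exprS; ring.
Qed.

Lemma height_first n : h n 1 = base / base ^+ n.
Proof. by rewrite /height expr1 mulrC. Qed.

Lemma height_last n : h n (2 * n).+1 = base ^+ n.+1.
Proof.
rewrite /height; move: base base_gt0 => b b0.
by rewrite exprS mul2n -addnn exprD mulrCA mulKf -?exprS// expf_neq0// gt_eqF.
Qed.

(** The layer that contains [y] alone suffices: if h_(j+1) < y <= h_(j+2), the j-th term is
    h_(j+2)^p. The factor [16 * base ^+ 2] is the p-th power of the two steps lost between the
    height in the weight and the top of the layer. *)
Lemma layer_bound n J y : h n 1 < y <= h n J.+1 ->
  y `^ p <= \sum_(j < J) 16 * base ^+ 2 * (4 ^+ j / 4 ^+ n * h n j) * (h n j.+1 < y)%R%:R.
Proof.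
move=> /andP[y1]; have y0 : 0 <= y by rewrite ltW// (lt_trans _ y1).
elim: J => [|J ih] yJ; first by move: y1; rewrite ltNge yJ.
rewrite big_ord_recr/=.
have t0 j : 0 <= 16 * base ^+ 2 * (4 ^+ j / 4 ^+ n * h n j).
  by rewrite mulr_ge0 ?mulr_ge0 ?invr_ge0 ?exprn_ge0 ?ltW.
have [yJ1|yJ1] := leP y (h n J.+1).
  by rewrite (le_trans (ih yJ1))// lerDl mulr_ge0.
rewrite mulr1 -height_powR2 (@le_trans _ _ (h n J.+2 `^ p))//.
  by rewrite ge0_ler_powR ?nnegrE ?divr_ge0// ltW.
by rewrite lerDr; apply: sumr_ge0 => j _; rewrite mulr_ge0.
Qed.

(** Equivalently base^(1-n) < y <= base^(n+1), an interval that increases with n to all positive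
    reals. *)
Definition in_layers n y := (h n 1 < y) && (y <= h n (2 * n).+1).

Lemma in_layers_mono m n y : (m <= n)%N -> in_layers m y -> in_layers n y.
Proof.
move=> mn; rewrite /in_layers !height_first !height_last => /andP[y1 y2].
have b1 : 1 <= base by rewrite (le_trans _ base_ge2)// ler1n.
apply/andP; split.
  apply: le_lt_trans y1; rewrite ler_pM2l// lef_pV2 ?posrE ?exprn_gt0//.
  exact: ler_weXn2l.
by rewrite (le_trans y2)// ler_weXn2l.
Qed.

Lemma in_layers_eventually y : 0 < y -> exists n, in_layers n y.
Proof.
move=> y0; have grow k : k%:R <= base ^+ k.
  elim: k => [|k ih]; first by rewrite expr0 ler01.
  rewrite exprS -natr1; have b2 : 2 * base ^+ k <= base * base ^+ k by rewrite ler_wpM2r ?exprn_ge0.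
  apply: le_trans b2; rewrite mulr_natl mulr2n lerD// exprn_ege1//.
  by rewrite (le_trans _ base_ge2)// ler1n.
pose n := maxn (Num.truncn y).+1 (Num.truncn (base / y)).+1.
exists n; rewrite /in_layers height_first height_last; apply/andP; split.
  rewrite ltr_pdivrMr ?exprn_gt0// mulrC -ltr_pdivrMr//.
  by rewrite (lt_le_trans (truncnS_gt _))// (le_trans _ (grow n))// ler_nat leq_maxr.
rewrite (le_trans (ltW (truncnS_gt _)))// (le_trans _ (grow n.+1))// ler_nat.
by rewrite ltnS; apply: leq_trans (leq_maxl _ _); exact: leqnSn.
Qed.

End layers.

Section power_bound.
Context {R : realType} {d : nat}.
Local Notation L := (lebesgue_rV d).
Local Notation base := (2 ^+ (3 * d + 1) : R).
Local Notation p := ((3 * d + 3)%:R / (3 * d + 1)%:R : R).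
Local Notation h n j := (height (d := d) (base ^- n) j).
Variables (u : 'rV[R]_d -> R) (BV S : R).
Hypotheses (d0 : (0 < d)%N) (iu : L.-integrable setT (EFin \o u)) (u0 : forall x, 0 <= u x)
  (uV : (gradient_variation u <= BV%:E)%E) (S0 : 0 < S) (uS : (sup_inf u < S%:E)%E).

Let mu : measurable_fun setT u.
Proof. by apply/measurable_EFinP; exact: measurable_int iu. Qed.

(** The estimate on the layers is uniform in n, so monotone convergence extends it to [u]. *)
Lemma integral_powR_le (a : R) : 0 < a ->
  (\int[L]_x (u x `^ p)%:E <= (16 * base ^+ 2 * @budget R d BV S a)%:E)%E.
Proof.
move=> a0; pose f n x : R := (in_layers (d := d) n (u x))%:R * u x `^ p.
have mlayer n : measurable [set x | in_layers (d := d) n (u x)].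
  have -> : [set x | in_layers (d := d) n (u x)] =
      [set x | h n 1 < u x] `&` [set x | u x <= h n (2 * n).+1].
    by apply/seteqP; split => x /= => [/andP[]|[? ?]]//; apply/andP.
  by apply: measurableI; [exact: measurable_fun_lt_cst|exact: measurable_fun_le_cst].
have mup : measurable_fun setT (fun x => u x `^ p) by exact: (measurableT_comp (measurable_powR p)).
have mf n : measurable_fun setT (EFin \o f n).
  by apply/measurable_EFinP; apply: measurable_funM => //; exact: measurable_boolR.
have f0 n x : (0 <= (f n x)%:E)%E by rewrite lee_fin mulr_ge0// powR_ge0.
have fmono x : {homo (fun n => (f n x)%:E) : m n / (m <= n)%N >-> (m <= n)%E}.
  move=> m n mn; rewrite lee_fin ler_wpM2r ?powR_ge0//.
  case: (boolP (in_layers m (u x))) => // hm.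
  by rewrite (in_layers_mono mn hm).
have flim x : limn (fun n => (f n x)%:E) = (u x `^ p)%:E.
  suff [N HN] : exists N, forall n, (N <= n)%N -> f n x = u x `^ p.
    apply: cvg_lim => //; apply: cvg_near_cst; exists N => // n /= Nn.
    by rewrite HN.
  have [ux|ux] := eqVneq (u x) 0.
    by exists 0%N => n _; rewrite /f ux powR0// mulr0.
  have [N hN] : exists N, in_layers (d := d) N (u x).
    by apply: in_layers_eventually; rewrite lt_neqAle eq_sym ux u0.
  by exists N => n Nn; rewrite /f (in_layers_mono Nn hN) mul1r.
have cv := @cvg_monotone_convergence _ _ _ L _ measurableT _ mf (fun n x _ => f0 n x) (fun x _ => fmono x).
rewrite (eq_integral (fun x => limn (fun n => (f n x)%:E))); last by move=> x _; rewrite flim.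
rewrite -[leLHS](cvg_lim _ cv)//; apply: lime_le; first exact: cvgP cv.
apply: nearW => n.
have K0 : 0 <= 16 * base ^+ 2 by rewrite mulr_ge0// exprn_ge0// exprn_ge0.
pose c j := 4 ^+ j / 4 ^+ n * h n j.
have c0 j : 0 <= c j.
  by rewrite mulr_ge0 ?divr_ge0 ?exprn_ge0// ltW// height_gt0// invr_gt0 !exprn_gt0.
have mlt j : measurable [set x | h n j.+1 < u x] by exact: measurable_fun_lt_cst.
have Kc0 j : (0 <= (16 * base ^+ 2 * c j)%:E)%E by rewrite lee_fin mulr_ge0.
have mb j : measurable_fun setT (fun x => ((h n j.+1 < u x)%R%:R : R)%:E).
  by apply/measurable_EFinP; exact: measurable_boolR.
have mKb j := measurable_funeM (16 * base ^+ 2 * c j)%:E (mb j).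
apply: (@le_trans _ _ (\int[L]_x \sum_(j < 2 * n)
    ((16 * base ^+ 2 * c j)%:E * ((h n j.+1 < u x)%R%:R : R)%:E))%E).
  apply: ge0_le_integral => //.
  - by move=> x _; exact: f0.
  - by apply: emeasurable_sum => j; exact: mKb.
  move=> x _; under eq_bigr do rewrite -EFinM.
  rewrite sumEFin lee_fin /f.
  case: (boolP (in_layers n (u x))) => hx; last first.
    by rewrite mul0r; apply: sumr_ge0 => j _; rewrite !mulr_ge0.
  by rewrite mul1r; exact: layer_bound.
rewrite ge0_integral_sum//; last by move=> j x _; rewrite mule_ge0.
have := level_sum_rescaled d0 iu u0 uV S0 uS a0 n (2 * n).
move=> /(lee_wpmul2l (_ : 0 <= (16 * base ^+ 2)%:E)%E) -/(_ K0).
rewrite -EFinM; apply: le_trans; rewrite ge0_sume_distrr; last first.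
  by move=> j _; rewrite mule_ge0// lee_fin; exact: c0.
apply: lee_sum => j _; rewrite ge0_integralZl//.
by rewrite integral_boolR// muleA -EFinM.
Qed.

End power_bound.

Section optimise.
Context {R : realType}.

(** At a = (X / B)^e the two terms a B and a^(-g) X are equal, each being X^e B^f. *)
Lemma optimal_scale (X B e f g : R) : 0 < X -> 0 < B -> e + f = 1 -> e * g = f ->
  (X / B) `^ e * B + ((X / B) `^ e) `^ (- g) * X = 2 * (X `^ e * B `^ f).
Proof.
move=> X0 B0 ef eg.
have key t : (X / B) `^ t = X `^ t / B `^ t.
  rewrite powRM ?invr_ge0 ?ltW//; congr (_ * _).
  by rewrite -(powR_inv1 (ltW B0)) -powRrM mulN1r powRN.
have Xe : X = X `^ e * X `^ f by rewrite -powRD ?ef ?powRr1 ?oner_eq0 ?ltW.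
have Be : B = B `^ e * B `^ f by rewrite -powRD ?ef ?powRr1 ?oner_eq0 ?ltW.
rewrite -powRrM mulrN eg powRN !key.
rewrite [X in _ * X + _]Be [X in _ + _ * X]Xe.
have : X `^ e != 0 by rewrite gt_eqF// powR_gt0.
have : X `^ f != 0 by rewrite gt_eqF// powR_gt0.
have : B `^ e != 0 by rewrite gt_eqF// powR_gt0.
have : B `^ f != 0 by rewrite gt_eqF// powR_gt0.
move: (X `^ e) (X `^ f) (B `^ e) (B `^ f) => x y b c *.
by field; apply/and3P.
Qed.

End optimise.

Section conclusion.
Context {R : realType} {d : nat}.
Local Notation L := (lebesgue_rV d).
Local Notation base := (2 ^+ (3 * d + 1) : R).
Local Notation p := ((3 * d + 3)%:R / (3 * d + 1)%:R : R).
Local Notation theta := ((2 * d)%:R / (3 * d + 3)%:R : R).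

Let K := 16 * base ^+ 2 * @C_level R d * 2.

Definition C_final : R := K `^ p^-1.

Let K_gt0 : (0 < d)%N -> 0 < K.
Proof. by move=> d0; rewrite !mulr_gt0 ?exprn_gt0 ?C_level_gt0 ?exprn_gt0. Qed.

Lemma C_final_gt0 : (0 < d)%N -> 0 < C_final.
Proof. by move=> d0; rewrite powR_gt0// K_gt0. Qed.

Variables (u : 'rV[R]_d -> R) (d0 : (0 < d)%N).
Hypotheses (iu : L.-integrable setT (EFin \o u)) (u0 : forall x, 0 <= u x).

(** Upper bounds [BV] and [S] replace the two quantities themselves: positivity is needed to choose
    the scale, strictness to pick near-minimisers. *)
Lemma Lnorm_le (BV S : R) : 0 < BV -> 0 < S ->
  (gradient_variation u <= BV%:E)%E -> (sup_inf u < S%:E)%E ->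
  ('N[L]_(p%:E) [EFin \o u] <= (C_final * BV `^ theta * S)%:E)%E.
Proof.
move=> BV0 S0 uV uS.
have n1 : 3 * d%:R + 1 != 0 :> R by rewrite -natrM natr1 pnatr_eq0.
have n2 : d%:R + 1 != 0 :> R by rewrite natr1 pnatr_eq0.
(* [g] is the exponent of [a] in [budget], and e = 1 / (1 + g), f = g / (1 + g). After the p-th
   root, f / p = theta and e / p = 1/3, which undoes the cube of [S]. *)
pose e : R := (d + 1)%:R / (3 * d + 1)%:R.
pose f : R := (2 * d)%:R / (3 * d + 1)%:R.
pose g : R := (2 * d)%:R / (d + 1)%:R.
have ef : e + f = 1.
  by rewrite /e /f (natrD _ d 1) (natrD _ (3 * d) 1) !natrM; field.
have eg : e * g = f.
  by rewrite /e /f /g (natrD _ d 1) (natrD _ (3 * d) 1) !natrM; field; rewrite n1 n2.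
have S3 : 0 < S ^+ 3 by rewrite exprn_gt0.
have := optimal_scale S3 BV0 ef eg.
set a := (S ^+ 3 / BV) `^ e => opt.
have a0 : 0 < a by rewrite powR_gt0// divr_gt0.
have := integral_powR_le d0 iu u0 uV S0 uS a0.
rewrite /budget -/g opt.
rewrite unlock.
have -> : (\int[L]_x (`|(EFin \o u) x| `^ p) = \int[L]_x (u x `^ p)%:E)%E.
  by apply: eq_integral => x _; rewrite /= ger0_norm.
set Y := (S ^+ 3) `^ e * BV `^ f.
have -> : 16 * base ^+ 2 * (@C_level R d * (2 * Y)) = K * Y by rewrite /K; ring.
have Y0 : 0 < Y by rewrite mulr_gt0// powR_gt0.
have p0 : 0 < p by rewrite divr_gt0// ltr0n ?addn3 ?addn1.
have I0 : (0 <= \int[L]_x (u x `^ p)%:E)%E.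
  by apply: integral_ge0 => x _; rewrite lee_fin powR_ge0.
have KY : 0 < K * Y by rewrite mulr_gt0// K_gt0.
move=> H; have ip0 : 0 <= p^-1 by rewrite invr_ge0 ltW.
apply: le_trans (gt0_ler_poweR ip0 _ _ H) _.
- by rewrite in_itv/= leey andbT.
- by rewrite in_itv/= leey andbT lee_fin ltW.
rewrite poweR_EFin lee_fin le_eqVlt; apply/orP; left; apply/eqP.
rewrite powRM ?(ltW Y0) ?(ltW (K_gt0 d0))// -mulrA; congr (_ * _).
rewrite powRM ?powR_ge0// -!powRrM mulrC; congr (_ * _).
  congr (_ `^ _); rewrite /f invf_div mulrA divfK// pnatr_eq0 addn1//.
have -> : e * p^-1 = 3^-1.
  rewrite /e invf_div mulrA divfK ?pnatr_eq0 ?addn1//.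
  rewrite (_ : 3 * d + 3 = 3 * d.+1)%N; last by rewrite mulnS addnC.
  by rewrite natrM invfM mulrC mulrVK// unitfE pnatr_eq0.
by rewrite -powR_mulrn ?(ltW S0)// -powRrM divff// powRr1// ltW.
Qed.

Lemma gradient_variation_ge0 : (0 <= gradient_variation u)%E.
Proof.
rewrite leNgt; apply/negP => neg.
have [V0 uV V0lt] : exists2 V : R, (gradient_variation u <= V%:E)%E & V < 0.
  move: neg; case: (gradient_variation u) => [r r0| |_].
  - by exists r => //; rewrite -lte_fin.
  - by rewrite ltNge leey.
  - by exists (-1); rewrite ?leNye// ltrN10.
(* With no level at all, the sum of the slopes is empty and the bound reads 0 <= d V. *)
have [W [W0 _]] := @bv_levels _ _ _ _ 0 (fun=> 0) iu uV (fun=> lexx _).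
by rewrite big_ord0 pmulr_rge0 ?ltr0n// leNgt V0lt.
Qed.

End conclusion.

Theorem proposition1p4 (R : realType) (d : nat) (hd : (0 < d)%N) :
  exists C : R, 0 < C /\
    forall u : 'rV[R]_d -> R,
      (forall x, 0 <= u x) ->
      (lebesgue_rV d).-integrable setT (EFin \o u) ->
      (gradient_variation u < +oo)%E ->
      (sup_inf u < +oo)%E ->
      ('N[lebesgue_rV d]_(((3 * d + 3)%:R / (3 * d + 1)%:R)%:E) [EFin \o u] <=
       C%:E * gradient_variation u `^ ((2 * d)%:R / (3 * d + 3)%:R) * sup_inf u)%E.
Proof.
exists (@C_final R d); split; first exact: C_final_gt0.
move=> u u0 iu Voo Soo.
have V0 := gradient_variation_ge0 hd iu.
have S0 := sup_inf_ge0 u.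
set V := fine (gradient_variation u); set s := fine (sup_inf u).
have VE : gradient_variation u = V%:E by rewrite fineK// ge0_fin_numE.
have sE : sup_inf u = s%:E by rewrite fineK// ge0_fin_numE.
set theta := (2 * d)%:R / _ : R.
have theta0 : 0 < theta by rewrite divr_gt0// ltr0n ?addn3// muln_gt0.
have C0 := @C_final_gt0 R d hd.
move: V0 S0; rewrite VE sE !lee_fin => V0 s0.
have main BV S := @Lnorm_le R d u hd iu u0 BV S.
(* The slack [e] pays for an [S] strictly above the supremum and, if the variation vanishes, for a
   positive bound [BV]. *)
rewrite poweR_EFin -!EFinM; apply/lee_addgt0Pr => e e0.
have [Vp|Vn] := ltP 0 V.
  have k0 : 0 < @C_final R d * V `^ theta by rewrite mulr_gt0// powR_gt0.
  have t0 : s < s + e / (@C_final R d * V `^ theta) by rewrite ltrDl divr_gt0.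
  apply: le_trans (main _ _ Vp (le_lt_trans s0 t0) _ _) _; rewrite ?VE ?sE ?lte_fin//.
  by rewrite -EFinD lee_fin mulrDr (mulrC _ (e / _)) divfK// gt_eqF.
(* Here the right-hand side is 0; [B] is chosen so that the bound with BV = B and S = s + 1 is
   exactly [e]. *)
have Vz : V = 0 by apply/eqP; rewrite eq_le Vn.
have S1 : s < s + 1 by rewrite ltrDl.
have S1' : 0 < s + 1 := le_lt_trans s0 S1.
pose q := e / (@C_final R d * (s + 1)).
have q0 : 0 < q by rewrite divr_gt0// mulr_gt0.
pose B := q `^ theta^-1.
have B0 : 0 < B by rewrite powR_gt0.
apply: le_trans (main _ _ B0 S1' _ _) _; rewrite ?VE ?sE ?lte_fin ?lee_fin ?Vz ?(ltW B0)//.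
rewrite -/theta powR0 ?gt_eqF// mulr0 mul0r add0r /B -powRrM mulVf ?gt_eqF// powRr1 ?(ltW q0)//.
by rewrite mulrAC mulrC /q divfK// gt_eqF// mulr_gt0.
Qed.
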